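(* Let $d\ge1$. The map $j=\iota\kappa^{-1}$ defined on $\kappa(\Sigma_d)$ extends to a weak-$*$ continuous complete isomorphism between $\overline{\mathcal M}_d$ and $\overline E_d$. More precisely, $\|j\|_{cb}\le1$ and $\|j^{-1}\|_{cb}\le2d+1$.
   Context: **von Neumann reduced free product.** $(M_i,\phi_i)_{i\in I}$ is a family of von Neumann algebras with normal states $\phi_i$ whose GNS representations are faithful. $H_i=L_2(M_i,\phi_i)$ is the GNS Hilbert space with cyclic vector $\xi_i$, $a\mapsto\hat a=a\xi_i$, $\langle\hat a,\hat b\rangle=\phi_i(a^*b)$; $\mathring H_i=\xi_i^\perp$, $\mathring M_i=\ker\phi_i$. The notation $i_1\ne i_2\ne\cdots\ne i_n$ means consecutive indices are distinct. Let $\mathcal F=\mathbb C\Omega\oplus\bigoplus_{n\ge1,\ i_1\ne\cdots\ne i_n}\mathring H_{i_1}\otimes\cdots\otimes\mathring H_{i_n}$ (Hilbert space sum). $M_i$ acts faithfully and unitally on $\mathcal F$: for $a\in\mathring M_i$, $a\Omega=\hat a$, and for $h_1\otimes\cdots\otimes h_n\in\mathring H_{i_1}\otimes\cdots\otimes\mathring H_{i_n}$, $a\cdot(h_1\otimes\cdots\otimes h_n)=\hat a\otimes h_1\otimes\cdots\otimes h_n$ if $i\ne i_1$, and $=[ah_1-\langle\xi_i,ah_1\rangle\xi_i]\otimes h_2\otimes\cdots\otimes h_n+\langle\xi_i,ah_1\rangle h_2\otimes\cdots\otimes h_n$ if $i=i_1$. Let $\Sigma_d=\bigoplus_{i_1\ne\cdots\ne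 i_d}\mathring M_{i_1}\otimes\cdots\otimes\mathring M_{i_d}$ (algebraic), embedded in $\mathbb B(\mathcal F)$ by letting $a_1\otimes\cdots\otimes a_d$ act as the product $a_1\cdots a_d$. The von Neumann reduced free product $\overline{*}_i(M_i,\phi_i)$ is the weak-$*$ closure in $\mathbb B(\mathcal F)$ of the algebra generated by the $M_i$; $\phi$ denotes its vacuum state $\langle\Omega,\cdot\,\Omega\rangle$. $\overline{\mathcal M}_d$ is the weak-$*$ closure of $\Sigma_d$ in $\mathbb B(\mathcal F)$ and $\kappa:\Sigma_d\to\overline{\mathcal M}_d$ is the inclusion. **The space $\overline X_d$.** Let $\mathcal L=\bigoplus_{i\in I}\mathring H_i$ (Hilbert space sum), $\mathcal L^{\otimes 0}=\mathbb C$, and let $\ell_\infty((M_i))$ be the $\ell_\infty$-direct sum of the $M_i$. Put $$\overline X_d=\bigoplus_{k=0}^d\mathbb B(\mathcal L^{\otimes(d-k)},\mathcal L^{\otimes k})\ \oplus_\infty\ \bigoplus_{k=0}^{d-1}\mathbb B(\mathcal L^{\otimes(d-k-1)},\mathcal L^{\otimes k})\,\overline\otimes\,\ell_\infty((M_i)),$$ with its natural dual operator space structure ($\overline\otimes$ is the weak-$*$ closed spatial tensor product). (In the paper $\mathcal L^{\otimes k}$ appears as $L_1^k$, the $k$-fold Haagerup power of $L_1\approx\mathcal L_C$, the column operator space spanned by the operators $P_ka P_k^\perp$, $a\in\mathring M_k$, with $P_k$ the projection onto words beginning with a letter in $\mathring H_k$; and $\mathcal L^{\otimes m}$ as the dual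 of $K_1^m$, the $m$-fold Haagerup power of the row space $K_1=L_1^*$ of adjoints.) **The map $\iota$ and $\overline E_d$.** $\iota:\Sigma_d\to\overline X_d$ is the linear map which sends $a=a_1\otimes\cdots\otimes a_d\in\mathring M_{i_1}\otimes\cdots\otimes\mathring M_{i_d}$ ($i_1\ne\cdots\ne i_d$) to the element whose $k$-th component in the first sum is the operator $$\hat b_1\otimes\cdots\otimes\hat b_{d-k}\mapsto\phi(a_db_1)\phi(a_{d-1}b_2)\cdots\phi(a_{k+1}b_{d-k})\,\hat a_1\otimes\cdots\otimes\hat a_k$$ (each $b_l$ in some $\mathring M_j$), and whose $k$-th component in the second sum is $T\otimes a_{k+1}$, where $a_{k+1}$ is placed in the coordinate $i_{k+1}$ of $\ell_\infty((M_i))$ and $T$ is the operator $\hat b_1\otimes\cdots\otimes\hat b_{d-k-1}\mapsto\phi(a_db_1)\cdots\phi(a_{k+2}b_{d-k-1})\,\hat a_1\otimes\cdots\otimes\hat a_k$. $\overline E_d$ is the weak-$*$ closure of $\iota(\Sigma_d)$ in $\overline X_d$. *)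

(* Defs.v *)
From HB Require Import structures.
From mathcomp Require Import all_boot all_order all_algebra sesquilinear.
From mathcomp Require Import complex.
From mathcomp Require Import all_classical all_reals all_analysis.

Set Implicit Arguments.
Unset Strict Implicit.
Unset Printing Implicit Defensive.

Import Order.TTheory GRing.Theory Num.Theory.
Import numFieldNormedType.Exports.

Local Open Scope classical_set_scope.
Local Open Scope complex_scope.
Local Open Scope ring_scope.

Record hilbert (R : realType) := Hilbert {
  hcar :> completeNormedModType R[i];
  hform : {dot hcar for Num.conj};
  hnormE : forall x : hcar, `|x| ^+ 2 = hform x x
}.

(* MathComp forms are linear in the first variable; [inner x y] is <x, y> with
   the physicists' convention: antilinear in x and linear in y. *)
Definition inner (R : realType) (H : hilbert R) (x y : H) : R[i] :=
  hform H y x.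

Definition lspan (K : pzRingType) (V : lmodType K) (A : set V) : set V :=
  [set v | exists (n : nat) (c : 'I_n -> K) (a : 'I_n -> V),
     (forall k, A (a k)) /\ v = \sum_(k < n) c k *: a k].

Definition total_set (R : realType) (H : hilbert R) (A : set H) : Prop :=
  closure (lspan A) = setT.

Section BoundedOperators.
Variables (R : realType) (H K : hilbert R).

Definition bop_pred : {pred (H -> K)} := fun T => `[< linear T /\ continuous T >].

Record bop := Bop { bop_fun :> H -> K; _ : bop_fun \in bop_pred }.

HB.instance Definition _ := [isSub for bop_fun].
HB.instance Definition _ := [Choice of bop by <:].

Lemma bopP (T : bop) : linear T /\ continuous T.
Proof. by have := valP T; rewrite unfold_in => /asboolP. Qed.

Fact bop_submod_closed : submod_closed bop_pred.
Proof.
split=> [|a f g]; rewrite !unfold_in.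
  apply/asboolP; split; last exact: cst_continuous.
  by move=> a u v /=; rewrite scaler0 addr0.
move=> /asboolP[lf cf] /asboolP[lg cg]; apply/asboolP; split.
  move=> b u v; rewrite !fctE lf lg /= !scalerDr !scalerA (mulrC a b).
  by rewrite addrACA.
move=> x; apply: cvgD; last exact: cg.
by apply: cvgZr; exact: cf.
Qed.
HB.instance Definition _ :=
  GRing.isSubmodClosed.Build _ _ bop_pred bop_submod_closed.
HB.instance Definition _ := [SubChoice_isSubLmodule of bop by <:].

End BoundedOperators.
Arguments bop_pred {R} H K.

Section Composition.
Variables (R : realType) (H K L : hilbert R).

Fact bid_subproof : (idfun : H -> H) \in bop_pred H H.
Proof. by rewrite unfold_in; apply/asboolP; split=> // x; exact: cvg_id. Qed.
Definition bid : bop H H := Bop bid_subproof.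

Fact bcomp_subproof (S : bop K L) (T : bop H K) : S \o T \in bop_pred H L.
Proof.
have [[lS cS] [lT cT]] := (bopP S, bopP T); rewrite unfold_in.
apply/asboolP; split; first by move=> a u v /=; rewrite lT lS.
by move=> x; apply: continuous_comp; [exact: cT | exact: cS].
Qed.
Definition bcomp (S : bop K L) (T : bop H K) : bop H L :=
  Bop (bcomp_subproof S T).

End Composition.
Arguments bid {R H}.

Definition is_adjoint (R : realType) (H : hilbert R) (T S : bop H H) : Prop :=
  forall x y, inner x (T y) = inner (S x) y.

(* Only the data of a dual operator space are recorded: the norms on M_n(E) and
   the weak-* continuous functionals. The instances below are the spaces of
   bounded operators between Hilbert spaces and their finite l_oo-sums. *)
Record dual_opspace (R : realType) := DualOpspace {
  os_car :> lmodType R[i];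
  os_norm : forall n : nat, ('I_n -> 'I_n -> os_car) -> R;
  os_predual : set (os_car -> R[i])
}.

Arguments os_predual {R} E : rename.

Section OperatorSpaces.
Variable R : realType.

Definition weakstar (E : dual_opspace R) : Type :=
  initial_topology ((fun x w => val w x) :
    E -> prod_topology (fun _ : os_predual E => R[i]^o)).
HB.instance Definition _ (E : dual_opspace R) :=
  Topological.on (weakstar E).

Definition wclosure (E : dual_opspace R) (A : set E) : set E :=
  @closure (weakstar E) A.

Definition wcontinuous_on (E E' : dual_opspace R) (A : set E) (f : E -> E') :=
  {within (A : set (weakstar E)), continuous (f : weakstar E -> weakstar E')}.

Definition cbnorm (E E' : dual_opspace R) (A : set E) (f : E -> E') : \bar R :=
  ereal_sup [set y | exists (n : nat) (x : 'I_n -> 'I_n -> E),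
    [/\ forall p q, A (x p q), os_norm x <= 1 &
        y = (os_norm (fun p q => f (x p q)))%:E]].

Definition square_summable (H : hilbert R) (x : nat -> H) : Prop :=
  cvgn (series (fun n => `|x n| ^+ 2 : R[i]^o)).

(* The functionals given by trace-class operators, that is
   T |-> sum_n <y_n, T x_n>. *)
Definition normal_functional (H K : hilbert R) : set (bop H K -> R[i]) :=
  [set w | exists (x : nat -> H) (y : nat -> K),
    [/\ square_summable x, square_summable y &
      forall T : bop H K,
        series (fun n => inner (y n) (T (x n)) : R[i]^o) @ \oo --> (w T : R[i]^o)]].

(* The norm of [x p q] as an operator from the n-fold Hilbert sum H^n to K^n. *)
Definition bop_mxnorm (H K : hilbert R) (n : nat) (x : 'I_n -> 'I_n -> bop H K)
    : R :=
  inf [set c : R | 0 <= c /\ forall h : 'I_n -> H,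
    \sum_p `|\sum_q x p q (h q)| ^+ 2 <= c%:C ^+ 2 * \sum_q `|h q| ^+ 2].

Definition Bspace (H K : hilbert R) : dual_opspace R :=
  DualOpspace (@bop_mxnorm H K) (@normal_functional H K).

End OperatorSpaces.

Definition dprod (K : pzRingType) (J : Type) (V : J -> lmodType K) : Type :=
  forall j, V j.

Section DependentProduct.
Variables (K : pzRingType) (J : Type) (V : J -> lmodType K).

HB.instance Definition _ := gen_eqMixin (dprod V).
HB.instance Definition _ := gen_choiceMixin (dprod V).

Let add (x y : dprod V) : dprod V := fun j => x j + y j.
Let opp (x : dprod V) : dprod V := fun j => - x j.
Let zero : dprod V := fun=> 0.
Let scale (a : K) (x : dprod V) : dprod V := fun j => a *: x j.

Fact dprod_addA : associative add.
Proof. by move=> x y z; apply: functional_extensionality_dep => j; exact: addrA. Qed.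
Fact dprod_addC : commutative add.
Proof. by move=> x y; apply: functional_extensionality_dep => j; exact: addrC. Qed.
Fact dprod_add0 : left_id zero add.
Proof. by move=> x; apply: functional_extensionality_dep => j; exact: add0r. Qed.
Fact dprod_addN : left_inverse zero opp add.
Proof. by move=> x; apply: functional_extensionality_dep => j; exact: addNr. Qed.
HB.instance Definition _ :=
  GRing.isZmodule.Build (dprod V) dprod_addA dprod_addC dprod_add0 dprod_addN.

Fact dprod_scaleA a b (x : dprod V) : scale a (scale b x) = scale (a * b) x.
Proof. by apply: functional_extensionality_dep => j; exact: scalerA. Qed.
Fact dprod_scale1 : left_id 1 scale.
Proof. by move=> x; apply: functional_extensionality_dep => j; exact: scale1r. Qed.
Fact dprod_scaleDr : right_distributive scale +%R.
Proof. by move=> a x y; apply: functional_extensionality_dep => j; exact: scalerDr. Qed.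
Fact dprod_scaleDl (x : dprod V) : {morph scale^~ x : a b / a + b}.
Proof. by move=> a b; apply: functional_extensionality_dep => j; exact: scalerDl. Qed.
HB.instance Definition _ := GRing.Zmodule_isLmodule.Build K (dprod V)
  dprod_scaleA dprod_scale1 dprod_scaleDr dprod_scaleDl.

End DependentProduct.

Definition linfty_sum (R : realType) (J : finType) (E : J -> dual_opspace R)
    : dual_opspace R :=
  @DualOpspace R (dprod (fun j => os_car (E j)))
    (fun n x => \big[Num.max/0]_j os_norm (fun p q => x p q j))
    [set w | exists v : forall j, os_car (E j) -> R[i],
       (forall j, os_predual (E j) (v j)) /\ w = fun x => \sum_j v j (x j)].

Record vn_algebra (R : realType) := VNAlgebra {
  vn_space : hilbert R;
  vn_set : set (bop vn_space vn_space);
  vn1 : vn_set bid;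
  vn_lin : forall a S T, vn_set S -> vn_set T -> vn_set (a *: S + T);
  vnM : forall S T, vn_set S -> vn_set T -> vn_set (bcomp S T);
  vn_adj : forall T, vn_set T -> exists2 S, vn_set S & is_adjoint T S;
  vn_closed : wclosure (vn_set : set (Bspace vn_space vn_space)) `<=` vn_set
}.

Arguments vn_set {R} M : rename.
Notation vn_bop M := (bop (vn_space M) (vn_space M)).

Record normal_state (R : realType) (M : vn_algebra R)
    (phi : vn_bop M -> R[i]) : Prop := NormalState {
  ns_lin : forall a S T, vn_set M S -> vn_set M T ->
    phi (a *: S + T) = a * phi S + phi T;
  ns1 : phi bid = 1;
  ns_ge0 : forall S T, vn_set M S -> vn_set M T -> is_adjoint T S ->
    0 <= phi (bcomp S T);
  ns_normal : {within
    (vn_set M : set (weakstar (Bspace (vn_space M) (vn_space M)))),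
    continuous (phi : weakstar (Bspace (vn_space M) (vn_space M)) -> R[i]^o)}
}.

(* A GNS triple (H, pi, xi) of (M, phi); it is unique up to a unitary. *)
Record gns_triple (R : realType) (M : vn_algebra R) (phi : vn_bop M -> R[i]) :=
    GNSTriple {
  gns_space : hilbert R;
  gns_rep : vn_bop M -> bop gns_space gns_space;
  gns_vec : gns_space;
  gns_lin : forall a S T, vn_set M S -> vn_set M T ->
    gns_rep (a *: S + T) = a *: gns_rep S + gns_rep T;
  gnsM : forall S T, vn_set M S -> vn_set M T ->
    gns_rep (bcomp S T) = bcomp (gns_rep S) (gns_rep T);
  gns_adj : forall S T, vn_set M S -> vn_set M T -> is_adjoint T S ->
    is_adjoint (gns_rep T) (gns_rep S);
  gns_state : forall T, vn_set M T -> phi T = inner gns_vec (gns_rep T gns_vec);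
  gns_cyclic : closure [set gns_rep T gns_vec | T in vn_set M] = setT
}.

Record nc_space (R : realType) := NCSpace {
  nc_alg : vn_algebra R;
  nc_state : vn_bop nc_alg -> R[i];
  nc_normal : normal_state nc_state;
  nc_gns : gns_triple nc_state;
  nc_faithful : forall S T, vn_set nc_alg S -> vn_set nc_alg T ->
    gns_rep nc_gns S = gns_rep nc_gns T -> S = T
}.

Notation nc_bop A := (vn_bop (nc_alg A)).
Notation nc_L2 A := (gns_space (nc_gns A)).
Notation nc_rep A := (gns_rep (nc_gns A)).
Notation nc_xi A := (gns_vec (nc_gns A)).

(* Hilbert sums and tensor products are determined up to a unitary by the inner
   products of their elementary vectors and the totality of these (which also
   force multilinearity), so they are described by realizations. *)

Section HilbertConstructions.
Variable R : realType.

Definition tagged_inner (I : eqType) (H : I -> hilbert R)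
    (u v : {i & H i}) : R[i] :=
  if tag u == tag v then inner (tagged u) (tagged_as u v) else 0.

(* The Hilbert sum of closed subspaces of the H i; D collects their elements.
   The value of [hs_in] outside D is irrelevant. *)
Record hilbert_sum (I : eqType) (H : I -> hilbert R) (D : set {i & H i}) :=
    HilbertSum {
  hs_space :> hilbert R;
  hs_in : {i & H i} -> hs_space;
  hs_inner : forall u v, D u -> D v ->
    inner (hs_in u) (hs_in v) = tagged_inner u v;
  hs_total : total_set [set hs_in u | u in D]
}.

(* The n-fold tensor power; [hp_tens] is meant for sequences of length n. For
   n = 0 this is the scalar field. *)
Record hilbert_power (H : hilbert R) (n : nat) := HilbertPower {
  hp_space :> hilbert R;
  hp_tens : seq H -> hp_space;
  hp_inner : forall s t, size s = n -> size t = n ->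
    inner (hp_tens s) (hp_tens t) = \prod_(p <- zip s t) inner p.1 p.2;
  hp_total : total_set [set hp_tens s | s in [set s | size s = n]]
}.

Record hilbert_tensor (H K : hilbert R) := HilbertTensor {
  ht_space :> hilbert R;
  ht_tens : H -> K -> ht_space;
  ht_inner : forall h h' k k',
    inner (ht_tens h k) (ht_tens h' k') = inner h h' * inner k k';
  ht_total : total_set [set ht_tens p.1 p.2 | p in [set: H * K]]
}.

End HilbertConstructions.

Definition reduced (I : eqType) (T : I -> Type) (w : seq {i & T i}) : bool :=
  sorted (fun u v => tag u != tag v) w.

Section FreeProduct.
Variables (R : realType) (I : eqType) (A : I -> nc_space R).

Definition hletter := {i & nc_L2 (A i)}.
Definition aletter := {i & nc_bop (A i)}.

Definition in_Hring : set hletter :=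
  [set u : hletter | inner (nc_xi (A (tag u))) (tagged u) = 0].
Definition in_Mring : set aletter :=
  [set u : aletter | vn_set (nc_alg (A (tag u))) (tagged u) /\ nc_state (tagged u) = 0].

Definition Hword : set (seq hletter) :=
  [set w : seq hletter | reduced w /\ forall u, u \in w -> in_Hring u].

Definition hat (u : aletter) : hletter :=
  Tagged (fun i => nc_L2 (A i)) (nc_rep (A (tag u)) (tagged u) (nc_xi (A (tag u)))).

Record fock_space := FockSpace {
  fk_space :> hilbert R;
  fk_vec : seq hletter -> fk_space;
  fk_inner : forall w w', Hword w -> Hword w' ->
    inner (fk_vec w) (fk_vec w') =
      if size w == size w' then \prod_(p <- zip w w') tagged_inner p.1 p.2 else 0;
  fk_total : total_set [set fk_vec w | w in Hword]
}.

(* L is the sum of the orthogonal complements Hring_i of xi_i, on whose powers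
   the components of Xbar_d act; S is the sum of the H_i, on which l_oo((M_i))
   acts diagonally. *)
Record free_spaces := FreeSpaces {
  fs_L : hilbert_sum in_Hring;
  fs_pow : forall n, hilbert_power fs_L n;
  fs_S : hilbert_sum [set: hletter];
  fs_powS : forall n, hilbert_tensor (fs_pow n) fs_S;
  fs_F : fock_space
}.

Variable W : free_spaces.
Local Notation L := (fs_L W).
Local Notation Lp := (fs_pow W).
Local Notation S := (fs_S W).
Local Notation LS := (fs_powS W).
Local Notation F := (fs_F W).
Local Notation HL h := (Tagged (fun i => nc_L2 (A i)) h).

Definition is_left_action (u : aletter) (T : bop F F) : Prop :=
  let i := tag u in let a := nc_rep (A i) (tagged u) in let xi := nc_xi (A i) in
  [/\ T (fk_vec F [::]) = fk_vec F [:: hat u],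
      forall v w, Hword (v :: w) -> tag v != i ->
        T (fk_vec F (v :: w)) = fk_vec F [:: hat u, v & w] &
      forall (h : nc_L2 (A i)) w, Hword (HL h :: w) ->
        T (fk_vec F (HL h :: w)) =
          fk_vec F (HL (a h - inner xi (a h) *: xi) :: w)
          + inner xi (a h) *: fk_vec F w].

(* For u in Mring_i the action is bounded and determined by the formulas; [xget]
   picks this operator. The same device is used for [contract_op] and
   [op_tensor] below. *)
Definition left_action (u : aletter) : bop F F := xget 0 (is_left_action u).

Definition vacuum_state (T : bop F F) : R[i] :=
  inner (fk_vec F [::]) (T (fk_vec F [::])).

Definition kappa_word (a : seq aletter) : bop F F :=
  foldr (fun u T => bcomp (left_action u) T) bid a.

(* Elements of the algebraic tensor sum Sigma_d are represented by finite
   formal linear combinations of elementary tensors a_1 (x) ... (x) a_d. *)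
Definition formal_sum := seq (R[i] * seq aletter).

Definition Sigma (d : nat) : set formal_sum :=
  [set f : formal_sum | forall p, p \in f ->
     [/\ size p.2 = d, reduced p.2 & forall u, u \in p.2 -> in_Mring u]].

Definition kappa (f : formal_sum) : Bspace F F :=
  \sum_(p <- f) p.1 *: kappa_word p.2.

Definition Mbar (d : nat) : set (Bspace F F) := wclosure (kappa @` Sigma d).

Definition tensL n (b : seq aletter) : Lp n :=
  hp_tens (Lp n) [seq hs_in L (hat u) | u <- b].

(* The operator b^_1 (x) ... (x) b^_m |->
   phi(v_1 b_1) ... phi(v_m b_m) c^_1 (x) ... (x) c^_k. *)
Definition contract_op (m k : nat) (v c : seq aletter) : bop (Lp m) (Lp k) :=
  xget 0 [set T : bop (Lp m) (Lp k) | forall b : seq aletter,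
    size b = m -> (forall u, u \in b -> in_Mring u) ->
    T (tensL m b) =
      (\prod_(p <- zip v b)
         vacuum_state (bcomp (left_action p.1) (left_action p.2)))
      *: tensL k c].

Definition op_tensor (m k : nat) (T : bop (Lp m) (Lp k)) (x : bop S S)
    : bop (LS m) (LS k) :=
  xget 0 [set y : bop (LS m) (LS k) |
    forall h s, y (ht_tens (LS m) h s) = ht_tens (LS k) (T h) (x s)].

(* l_oo((M_i)), acting diagonally on S through the faithful GNS
   representations. *)
Definition linfty_M : set (bop S S) :=
  [set x | exists a : forall i, nc_bop (A i),
     (forall i, vn_set (nc_alg (A i)) (a i)) /\
     forall i (h : nc_L2 (A i)),
       x (hs_in S (HL h)) = hs_in S (HL (nc_rep (A i) (a i) h))].

(* The element of l_oo((M_i)) with [tagged u] in the coordinate [tag u] and 0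
   elsewhere. *)
Definition coordinate (u : aletter) : bop S S :=
  xget 0 [set x : bop S S |
    (forall h : nc_L2 (A (tag u)), x (hs_in S (HL h)) =
       hs_in S (HL (nc_rep (A (tag u)) (tagged u) h))) /\
    (forall v : hletter, tag v != tag u -> x (hs_in S v) = 0)].

Definition vn_tensor (m k : nat) : set (Bspace (LS m) (LS k)) :=
  @wclosure R (Bspace (LS m) (LS k))
    (lspan [set y | exists (T : bop (Lp m) (Lp k)) (x : bop S S),
       linfty_M x /\ y = op_tensor T x]).

Section Degree.
Variable d : nat.

Definition Xindex : finType := ('I_d.+1 + 'I_d)%type.

Definition Xcomp (j : Xindex) : dual_opspace R :=
  match j with
  | inl k => Bspace (Lp (d - k)%N) (Lp k)
  | inr k => Bspace (LS (d - k - 1)%N) (LS k)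
  end.

(* Xbar_d is the weak-* closed subspace of Xambient where the components of the
   second kind lie in B (x)bar l_oo((M_i)). *)
Definition Xambient : dual_opspace R := linfty_sum Xcomp.

Definition Xbar : set Xambient :=
  [set x : Xambient | forall k : 'I_d,
     @vn_tensor (d - k - 1)%N k (x (inr k) : bop (LS (d - k - 1)%N) (LS k))].

Definition iota_word (a : seq aletter) : Xambient :=
  fun j => match j return Xcomp j with
  | inl k => contract_op (d - k)%N k (rev (drop k a)) (take k a)
  | inr k =>
      if drop k a is u :: v then
        op_tensor (contract_op (d - k - 1)%N k (rev v) (take k a)) (coordinate u)
      else 0
  end.

Definition iota_map (f : formal_sum) : Xambient :=
  \sum_(p <- f) p.1 *: iota_word p.2.

Definition Ebar : set Xambient := Xbar `&` wclosure (iota_map @` Sigma d).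

End Degree.
End FreeProduct.

Arguments Sigma {R I} A d _.
Arguments kappa {R I A} W f.
Arguments Mbar {R I A} W d _.
Arguments Xambient {R I A} W d.
Arguments Xbar {R I A} W d _.
Arguments iota_map {R I A} W d f.
Arguments Ebar {R I A} W d _.

(* Main.v *)
(** A letter [a] of mean zero splits, relative to the words that begin in its own
algebra, into a creation part, a diagonal part and an annihilation part. Hence a
reduced product [a_1 ... a_d] acts on words as a sum of [2d+1] operators: for each
[k], the last [d-k] factors annihilate and the first [k] create, or the last
[d-k-1] annihilate, [a_{k+1}] acts diagonally and the first [k] create.

Each component of [iota] is a compression of the product: the first kind between
words of lengths [d-k] and [k]; the second kind, separately for each index [i],
between spaces [v (x) H_i], where [xi_i] is realized by the word [v] itself.
Conversely each of the [2d+1] operators is an ampliation of a component of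
[iota], compressed to reduced words. All these maps have the form
[x |-> sum_b Q'_b x Q_b^*] for families of contractions [Q_b], [Q'_b] with pairwise
orthogonal ranges; such a map is defined on the whole operator space, completely
contractive and weak-* continuous. So [j] and its inverse are restrictions of
globally defined maps, and the identities between them pass from elementary
tensors to weak-* closures. *)

Require Import Defs.
From HB Require Import structures.
From mathcomp Require Import all_boot all_order all_algebra sesquilinear.
From mathcomp Require Import complex ring lra zify.
From mathcomp Require Import all_classical all_reals all_analysis.

Set Implicit Arguments.
Unset Strict Implicit.
Unset Printing Implicit Defensive.

Import Order.TTheory GRing.Theory Num.Theory.
Import numFieldNormedType.Exports.

Local Open Scope classical_set_scope.
Local Open Scope complex_scope.
Local Open Scope ring_scope.

(** * Inner products *)

(** The second kind of component is what forces families of contractions: one word v must stand for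
    v (x) xi_i for every index i other than that of its last letter, although these tensors are
    pairwise orthogonal, so a single contraction cannot do. In the other direction the families are
    indexed by the tails b that the operators leave untouched; letting b run over words in a fixed
    orthonormal basis of the letters makes the ranges for different tails orthogonal. Non-reduced
    words may be sent to 0 consistently because two words of the same length with nonzero inner
    product have the same indices, hence are reduced together.

    The index set and the bases are arbitrary, so sums over a family are limits over finite sets. A
    normal functional, however, is given by two sequences of vectors; weak-* continuity therefore
    rests on the countable support of a summable family.

    Several operators in the definitions are merely chosen among those satisfying given formulas, so
    each needs an existence proof: the left action of a letter is a (x) 1 on H_i (x) F(i), itself a
    sum over tails, and the contractions are of rank one. *)

Notation normc := ComplexField.Normc.normc.

Section InnerProduct.
Variables (R : realType) (H : hilbert R).
Implicit Types (x y z : H) (a : R[i]).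

Lemma innerDr x y z : inner x (y + z) = inner x y + inner x z.
Proof. exact: linearDl. Qed.

Lemma innerZr a x y : inner x (a *: y) = a * inner x y.
Proof. exact: linearZl_LR. Qed.

Lemma innerC x y : inner x y = (inner y x)^*%R.
Proof. by rewrite /inner hermC expr0 mul1r. Qed.

Lemma innerDl x y z : inner (x + y) z = inner x z + inner y z.
Proof. by rewrite innerC innerDr rmorphD /= -!innerC. Qed.

Lemma innerZl a x y : inner (a *: x) y = a^*%R * inner x y.
Proof. by rewrite innerC innerZr rmorphM /= -innerC. Qed.

Lemma inner0r x : inner x 0 = 0.
Proof. by rewrite -(scale0r x) innerZr mul0r. Qed.

Lemma inner0l x : inner 0 x = 0.
Proof. by rewrite innerC inner0r rmorph0. Qed.

Lemma innerNr x y : inner x (- y) = - inner x y.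
Proof. by rewrite -scaleN1r innerZr mulN1r. Qed.

Lemma innerNl x y : inner (- x) y = - inner x y.
Proof. by rewrite -scaleN1r innerZl rmorphN1 mulN1r. Qed.

Lemma innerBr x y z : inner x (y - z) = inner x y - inner x z.
Proof. by rewrite innerDr innerNr. Qed.

Lemma innerBl x y z : inner (x - y) z = inner x z - inner y z.
Proof. by rewrite innerDl innerNl. Qed.

Lemma inner_sumr (J : Type) (r : seq J) (P : pred J) (F : J -> H) x :
  inner x (\sum_(j <- r | P j) F j) = \sum_(j <- r | P j) inner x (F j).
Proof. by apply: (big_morph (inner x)); [exact: innerDr | exact: inner0r]. Qed.

Lemma inner_suml (J : Type) (r : seq J) (P : pred J) (F : J -> H) x :
  inner (\sum_(j <- r | P j) F j) x = \sum_(j <- r | P j) inner (F j) x.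
Proof.
by apply: (big_morph (fun y => inner y x)); [move=> *; exact: innerDl | exact: inner0l].
Qed.

(** Norms take values in [R[i]]; the real squared norm keeps all estimates within reach of
    ordered-field tactics. *)
Definition sqn x : R := complex.Re (inner x x).

Lemma norm2E x : `|x| ^+ 2 = (sqn x)%:C.
Proof.
have e := hnormE x; rewrite e /sqn RRe_real // /inner -e.
by rewrite rpredX // normr_real.
Qed.

Lemma sqnE x : (sqn x)%:C = inner x x.
Proof. by rewrite -norm2E hnormE. Qed.

Lemma sqn_ge0 x : 0 <= sqn x.
Proof. by rewrite -lecR -norm2E exprn_ge0. Qed.

Lemma sqn0 : sqn 0 = 0.
Proof. by rewrite /sqn inner0r. Qed.

Lemma sqn_eq0 x : sqn x = 0 -> x = 0.
Proof.
move=> e; apply/eqP; rewrite -normr_eq0 -sqrf_eq0 norm2E e.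
by apply/eqP.
Qed.

Lemma normE x : `|x| = (Num.sqrt (sqn x))%:C.
Proof.
apply/eqP; rewrite -(@eqrXn2 _ 2) ?normr_ge0 ?ler0c ?sqrtr_ge0 //.
by rewrite norm2E -rmorphXn /= sqr_sqrtr ?sqn_ge0.
Qed.

Lemma sqnZ a x : sqn (a *: x) = normc a ^+ 2 * sqn x.
Proof.
apply: complexI; rewrite -norm2E normrZ exprMn norm2E.
by rewrite [RHS]rmorphM rmorphXn /= normc_def; case: a.
Qed.

Lemma sqnN x : sqn (- x) = sqn x.
Proof. by rewrite /sqn innerNr innerNl opprK. Qed.

Lemma sqnBC x y : sqn (x - y) = sqn (y - x).
Proof. by rewrite -sqnN opprB. Qed.

Lemma Re_inner x y : complex.Re (inner x y) = complex.Re (inner y x).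
Proof. by rewrite innerC; case: (inner y x). Qed.

Lemma sqnD x y : sqn (x + y) = sqn x + sqn y + 2 * complex.Re (inner x y).
Proof.
rewrite /sqn innerDr !innerDl !raddfD /= (Re_inner y x); ring.
Qed.

Lemma sqnB x y : sqn (x - y) = sqn x + sqn y - 2 * complex.Re (inner x y).
Proof. by rewrite sqnD sqnN innerNr raddfN /= mulrN. Qed.

Lemma parallelogram x y : sqn (x + y) + sqn (x - y) = 2 * sqn x + 2 * sqn y.
Proof. rewrite sqnD sqnB; ring. Qed.

Lemma sqnD_le x y : sqn (x + y) <= 2 * sqn x + 2 * sqn y.
Proof. by rewrite -parallelogram lerDl sqn_ge0. Qed.

Lemma sqnB_le x y z : sqn (x - z) <= 2 * sqn (x - y) + 2 * sqn (y - z).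
Proof. by rewrite -[x - z](subrKA y) sqnD_le. Qed.

Lemma sqnD_orth x y : inner x y = 0 -> sqn (x + y) = sqn x + sqn y.
Proof. by move=> o; rewrite sqnD o /= mulr0 addr0. Qed.

Lemma cauchy_schwarz x y : normc (inner x y) ^+ 2 <= sqn x * sqn y.
Proof.
have [y0|y_neq0] := eqVneq (sqn y) 0.
  by rewrite (sqn_eq0 y0) inner0r sqn0 mulr0 /= expr0n addr0 sqrtr0 expr0n.
have y_gt0 : 0 < sqn y by rewrite lt_neqAle eq_sym y_neq0 sqn_ge0.
(* The expansion of this square is [sqn y] times the gap in the claimed inequality. *)
have : 0 <= sqn (((sqn y)%:C : R[i]) *: x - inner y x *: y) by exact: sqn_ge0.
rewrite sqnB !sqnZ innerZl innerZr (innerC x y).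
case: (inner y x) => u v /=.
have p (a b : R) : 0 <= a ^+ 2 + b ^+ 2 by rewrite addr_ge0 ?sqr_ge0.
rewrite oppr0 sqrrN !(sqr_sqrtr (p _ _)) expr0n addr0 => h.
have {}h : 0 <= sqn y * (sqn x * sqn y - (u ^+ 2 + v ^+ 2)).
  apply: le_trans h _; rewrite le_eqVlt; apply/orP; left; apply/eqP; ring.
by rewrite pmulr_rge0 // subr_ge0 in h.
Qed.

Lemma inner_eq0 x : (forall y, inner y x = 0) -> x = 0.
Proof. by move=> h; apply: sqn_eq0; rewrite /sqn h. Qed.

Lemma inner_inj x y : (forall z, inner z x = inner z y) -> x = y.
Proof.
move=> h; apply/eqP; rewrite -subr_eq0; apply/eqP/inner_eq0 => z.
by rewrite innerBr h subrr.
Qed.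

End InnerProduct.

Lemma sqn_sum_orth (R : realType) (H : hilbert R) (J : eqType) (r : seq J)
    (F : J -> H) : uniq r ->
  (forall i j, i \in r -> j \in r -> i != j -> inner (F i) (F j) = 0) ->
  sqn (\sum_(j <- r) F j) = \sum_(j <- r) sqn (F j).
Proof.
elim: r => [|i r IH] /=; first by rewrite !big_nil sqn0.
case/andP=> ir ur o; rewrite !big_cons sqnD_orth.
  by rewrite IH // => j k jr kr; apply: o; rewrite inE (jr, kr) orbT.
rewrite inner_sumr big1_seq // => j /andP[_ jr].
apply: o; rewrite ?inE ?eqxx ?jr ?orbT //.
by apply: contraNneq ir => ->.
Qed.

(** The factor [size r] becomes the number of components when the bound on the inverse map is
    computed. *)
Lemma sqn_sum_le (R : realType) (H : hilbert R) (J : Type) (r : seq J)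
    (F : J -> H) :
  sqn (\sum_(j <- r) F j) <= (size r)%:R * \sum_(j <- r) sqn (F j).
Proof.
elim: r => [|i r IH]; first by rewrite !big_nil sqn0 mulr0.
rewrite !big_cons; set x := F i; set y := \sum_(j <- r) F j in IH *.
set s := \sum_(j <- r) sqn (F j) in IH *; rewrite /= -natr1 sqnD.
set n : R := (size r)%:R in IH *.
have [r0|n0] := posnP (size r).
  have -> : y = 0 by rewrite /y (size0nil r0) big_nil.
  have -> : s = 0 by rewrite /s (size0nil r0) big_nil.
  by rewrite /n r0 sqn0 inner0r /= add0r mul1r !(addr0, mulr0).
have n_gt0 : 0 < n by rewrite ltr0n.
(* Divided by n, this gives 2 Re <x, y> <= n |x|^2 + |y|^2 / n, and |y|^2 <= n s by induction. *)
have : 0 <= sqn ((n%:C : R[i]) *: x - y) by exact: sqn_ge0.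
rewrite sqnB sqnZ innerZl.
have -> : normc (n%:C : R[i]) ^+ 2 = n ^+ 2.
  by rewrite /= expr0n addr0 sqr_sqrtr ?sqr_ge0.
have -> : complex.Re (((n%:C : R[i])^*)%R * inner x y) = n * complex.Re (inner x y).
  by case: (inner x y) => u v /=; rewrite oppr0 mul0r subr0.
nra.
Qed.

(** * Bounded operators and closed spans *)

Lemma sqrt_lt (R : realType) (a e : R) : 0 < e -> (Num.sqrt a < e) = (a < e ^+ 2).
Proof.
by move=> e0; rewrite -{1}[e]ger0_norm ?ltW // -sqrtr_sqr ltr_sqrt // exprn_gt0.
Qed.

Lemma nbhs_sqnP (R : realType) (H : hilbert R) (x : H) (A : set H) :
  nbhs x A <-> exists2 e : R, 0 < e & forall y, sqn (y - x) < e -> A y.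
Proof.
split.
  move=> /nbhs_normP[e /= e0 he].
  have er : (complex.Re e)%:C = e by rewrite RRe_real // gtr0_real.
  have re0 : 0 < complex.Re e by rewrite -ltcR er.
  exists (complex.Re e ^+ 2); first by rewrite exprn_gt0.
  move=> y hy; apply: he; rewrite /= -er normE ltcR sqnBC.
  by rewrite sqrt_lt.
case=> e e0 he; apply/nbhs_normP; exists (Num.sqrt e)%:C => /=.
  by rewrite ltcR sqrtr_gt0.
move=> y /=; rewrite normE ltcR ltr_sqrt // sqnBC; exact: he.
Qed.

Lemma closure_sqnP (R : realType) (H : hilbert R) (x : H) (A : set H) :
  closure A x <-> forall e : R, 0 < e -> exists2 y, A y & sqn (y - x) < e.
Proof.
split=> [cA e e0|h B /nbhs_sqnP[e e0 he]].
  have [|y [Ay hy]] := cA [set y | sqn (y - x) < e]; last by exists y.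
  by apply/nbhs_sqnP; exists e.
by have [y Ay /he By] := h e e0; exists y.
Qed.

Lemma eps_eq (R : realType) (H : hilbert R) (x y : H) :
  (forall e : R, 0 < e -> sqn (x - y) <= e) -> x = y.
Proof.
move=> h; apply/eqP; rewrite -subr_eq0; apply/eqP/sqn_eq0.
apply/eqP; rewrite eq_le sqn_ge0 andbT; apply/ler_addgt0Pl => e e0.
by rewrite addr0 h.
Qed.

Lemma sqn_sqrtZ (R : realType) (H : hilbert R) (t : R) (x : H) : 0 <= t ->
  sqn ((Num.sqrt t)%:C *: x) = t * sqn x.
Proof.
by move=> t0; rewrite sqnZ /= expr0n addr0 sqrtr_sqr ger0_norm ?sqrtr_ge0 // sqr_sqrtr.
Qed.

(** * Convergence along directed sets *)

Section Nets.
Variables (R : realType) (D : Type) (le : D -> D -> Prop).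

Definition directed :=
  [/\ forall d, le d d, forall a b c, le a b -> le b c -> le a c,
      inhabited D & forall a b, exists2 c, le a c & le b c].

(** Nets are used because sums over an arbitrary index set are limits over its finite subsets. *)
Definition netcvg (H : hilbert R) (u : D -> H) (l : H) :=
  forall e : R, 0 < e -> exists d0, forall d, le d0 d -> sqn (u d - l) < e.

Hypothesis dirD : directed.

Lemma netcvg_uniq (H : hilbert R) (u : D -> H) l l' :
  netcvg u l -> netcvg u l' -> l = l'.
Proof.
case: dirD => _ _ _ dD cl cl'; apply: eps_eq => e e0.
have [a ha] := cl _ (divr_gt0 e0 (ltr0n _ 4)).
have [b hb] := cl' _ (divr_gt0 e0 (ltr0n _ 4)).
have [c /ha hc /hb hc'] := dD a b.
rewrite (le_trans (sqnB_le _ (u c) _)) // sqnBC; move: hc hc'; set p := sqn _; set q := sqn _; lra.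
Qed.

Lemma netcauchy_cvg (H : hilbert R) (u : D -> H) :
  (forall e : R, 0 < e -> exists d0, forall d, le d0 d -> sqn (u d - u d0) < e) ->
  exists l, netcvg u l.
Proof.
case: dirD => rD tD [d00] dD hu.
pose F : set_system H := [set A | exists d0, forall d, le d0 d -> A (u d)].
have FF : ProperFilter F.
  split; first by case=> d0 /(_ d0 (rD _)).
  split; first by exists d00.
    move=> P Q [a ha] [b hb]; have [c ac bc] := dD a b.
    by exists c => d cd; split; [apply: ha; apply: tD cd|apply: hb; apply: tD cd].
  by move=> P Q PQ [a ha]; exists a => d /ha /PQ.
have /cauchy_cvgP/cvg_ex[l Fl] : cauchy F.
  apply: cauchy_exP => e e0.
  have er : (complex.Re e)%:C = e by rewrite RRe_real // gtr0_real.
  have re0 : 0 < complex.Re e by rewrite -ltcR er.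
  have [d0 hd0] := hu _ (exprn_gt0 2 re0).
  exists (u d0); exists d0 => d /hd0 h.
  rewrite -ball_normE /= -er normE ltcR sqnBC.
  by rewrite sqrt_lt.
exists l => e e0; apply: (Fl [set y | sqn (y - l) < e]).
by apply/nbhs_sqnP; exists e.
Qed.

End Nets.

Lemma nat_directed : directed (fun m n : nat => (m <= n)%N).
Proof.
split=> //; first by move=> a b c; exact: leq_trans.
  exact: (inhabits 0%N).
by move=> a b; exists (maxn a b); rewrite ?leq_maxl ?leq_maxr.
Qed.

Section Operators.
Variables (R : realType) (H K : hilbert R).
Implicit Types (S T : bop H K) (x y : H).

Lemma bopDr T x y : T (x + y) = T x + T y.
Proof. by have [lT _] := bopP T; have := lT 1 x y; rewrite !scale1r. Qed.

Lemma bop0r T : T 0 = 0.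
Proof. by apply: (addrI (T 0)); rewrite -bopDr !addr0. Qed.

Lemma bopZr T a x : T (a *: x) = a *: T x.
Proof. by have [lT _] := bopP T; have := lT a x 0; rewrite bop0r !addr0. Qed.

Lemma bopNr T x : T (- x) = - T x.
Proof. by rewrite -scaleN1r bopZr scaleN1r. Qed.

Lemma bopBr T x y : T (x - y) = T x - T y.
Proof. by rewrite bopDr bopNr. Qed.

Lemma bop_sumr T (J : Type) (r : seq J) (P : pred J) (F : J -> H) :
  T (\sum_(j <- r | P j) F j) = \sum_(j <- r | P j) T (F j).
Proof. by apply: (big_morph T); [exact: bopDr | exact: bop0r]. Qed.

Lemma bop_ext S T : (forall x, S x = T x) -> S = T.
Proof. by move=> h; apply: val_inj; apply: funext. Qed.

Lemma bopDE S T x : (S + T) x = S x + T x. Proof. by []. Qed.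
Lemma bop0E x : (0 : bop H K) x = 0. Proof. by []. Qed.
Lemma bopZE a T x : (a *: T) x = a *: T x. Proof. by []. Qed.
Lemma bopNE T x : (- T) x = - T x. Proof. by []. Qed.

Lemma bop_sumE (J : Type) (r : seq J) (P : pred J) (F : J -> bop H K) x :
  (\sum_(j <- r | P j) F j) x = \sum_(j <- r | P j) F j x.
Proof. by apply: (big_morph (fun T : bop H K => T x)). Qed.

Lemma bop_bounded T : exists2 C : R, 0 <= C & forall x, sqn (T x) <= C * sqn x.
Proof.
have [lT cT] := bopP T.
have : nbhs (0 : H) (T @^-1` [set y | sqn y < 1]).
  apply: (cT 0); rewrite bop0r; apply/nbhs_sqnP; exists 1 => // y; by rewrite subr0.
case/nbhs_sqnP=> e e0 he; exists (2 / e); first by rewrite divr_ge0 ?ltW.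
move=> x; have [x0|xn0] := eqVneq (sqn x) 0.
  by rewrite (sqn_eq0 x0) bop0r !sqn0 mulr0.
have xp : 0 < sqn x by rewrite lt_neqAle eq_sym xn0 sqn_ge0.
(* Scaling by the root of this number brings [x] to squared norm e/2, inside the ball on which
   [sqn (T y) < 1]; whence the constant 2/e. *)
have tp : 0 < e / (2 * sqn x) by rewrite divr_gt0 // mulr_gt0.
set t := e / (2 * sqn x) in tp.
have := he ((Num.sqrt t)%:C *: x).
rewrite /= bopZr subr0 !sqn_sqrtZ ?(ltW tp) //.
have -> : t * sqn x = e / 2 by rewrite /t; field; rewrite gt_eqF.
have h2 : e / 2 < e by lra.
move=> /(_ h2) h; rewrite -(ler_pM2l tp) (le_trans (ltW h)) //.
by rewrite le_eqVlt; apply/orP; left; apply/eqP; rewrite /t; field; rewrite !gt_eqF.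
Qed.

Lemma mkbop (f : H -> K) (C : R) : linear f ->
  (forall x, sqn (f x) <= C * sqn x) -> exists T : bop H K, forall x, T x = f x.
Proof.
move=> lf bf.
have fB x y : f (x - y) = f x - f y.
  by rewrite -[- y]scaleN1r addrC lf scaleN1r addrC.
suff hf : f \in bop_pred H K by exists (Bop hf).
rewrite unfold_in; apply/asboolP; split=> // x A /nbhs_sqnP[e e0 he].
have C1 : 0 < `|C| + 1 by rewrite ltr_wpDl.
apply/nbhs_sqnP; exists (e / (`|C| + 1)); first by rewrite divr_gt0.
move=> y; rewrite ltr_pdivlMr // => hy; apply: he.
rewrite -fB (le_lt_trans (bf _)) // (le_lt_trans _ hy) // mulrC.
by rewrite ler_wpM2l ?sqn_ge0 // (le_trans (ler_norm _)) // lerDl.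
Qed.

End Operators.

Section Spans.
Variable R : realType.
Implicit Types H K : hilbert R.

Definition cspan H (A : set H) : set H := closure (lspan A).

Lemma lspan_incl (V : lmodType R[i]) (A : set V) : A `<=` lspan A.
Proof.
move=> x Ax; exists 1%N, (fun=> 1), (fun=> x).
by split=> //; rewrite big_ord1 scale1r.
Qed.

Lemma lspan_add (V : lmodType R[i]) (A : set V) x y : lspan A x -> lspan A y -> lspan A (x + y).
Proof.
case=> n [c [a [Aa ->]]] [m [c' [a' [Aa' ->]]]].
exists (n + m)%N, (fun k => match fintype.split k with inl i => c i | inr j => c' j end),
  (fun k => match fintype.split k with inl i => a i | inr j => a' j end).
split; first by move=> k; case: fintype.split.
rewrite big_split_ord /=; congr (_ + _); apply: eq_bigr => i _.
  by rewrite -[lshift _ _]/(unsplit (inl i)) unsplitK.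
by rewrite -[rshift _ _]/(unsplit (inr i)) unsplitK.
Qed.

Lemma lspan_scale (V : lmodType R[i]) (A : set V) b x : lspan A x -> lspan A (b *: x).
Proof.
case=> n [c [a [Aa ->]]]; exists n, (fun k => b * c k), a; split=> //.
by rewrite scaler_sumr; apply: eq_bigr => k _; rewrite scalerA.
Qed.

Lemma lspan0 (V : lmodType R[i]) (A : set V) : lspan A 0.
Proof.
by exists 0%N, (fun=> 0), (fun=> 0); split; [case | rewrite big_ord0].
Qed.

Lemma cspan_add H (A : set H) x y : cspan A x -> cspan A y -> cspan A (x + y).
Proof.
move=> /closure_sqnP hx /closure_sqnP hy; apply/closure_sqnP => e e0.
have [x' Ax' dx] := hx _ (divr_gt0 e0 (ltr0n _ 4)).
have [y' Ay' dy] := hy _ (divr_gt0 e0 (ltr0n _ 4)).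
exists (x' + y'); first exact: lspan_add.
rewrite opprD addrACA (le_lt_trans (sqnD_le _ _)) //.
move: dx dy; set p := sqn _; set q := sqn _; lra.
Qed.

Lemma cspan_sub H (A : set H) : A `<=` cspan A.
Proof. by move=> x Ax; apply: subset_closure; apply: lspan_incl. Qed.

Lemma cspan_scale H (A : set H) b x : cspan A x -> cspan A (b *: x).
Proof.
move=> /closure_sqnP hx; apply/closure_sqnP => e e0.
have b0 : 0 < normc b ^+ 2 + 1 by rewrite ltr_wpDl // sqr_ge0.
have [x' Ax' dx] := hx _ (divr_gt0 e0 b0).
exists (b *: x'); first exact: lspan_scale.
rewrite -scalerBr sqnZ; rewrite ltr_pdivlMr // mulrC in dx.
by rewrite (le_lt_trans _ dx) // ler_wpM2r ?sqn_ge0 // lerDl.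
Qed.

Lemma cspan0 H (A : set H) : cspan A 0.
Proof. by apply: subset_closure; exact: lspan0. Qed.

Lemma cspan_lspan H (A : set H) x (B : set H) :
  A `<=` cspan B -> lspan A x -> cspan B x.
Proof.
move=> AB [n [c [a [Aa ->]]]].
elim/big_ind: _ => [|y z|k _]; [exact: cspan0 | exact: cspan_add |].
by apply: cspan_scale; apply: AB.
Qed.

Lemma cspan_closed H (A : set H) : closed (cspan A).
Proof. exact: closed_closure. Qed.

Lemma cspan_cspan H (A B : set H) : A `<=` cspan B -> cspan A `<=` cspan B.
Proof.
move=> AB x /closure_sqnP hx.
apply: (@cspan_closed _ B); apply/closure_sqnP => e /hx[y Ay xy].
by exists y => //; apply: cspan_lspan Ay.
Qed.

Lemma cspan_map H K (T : bop H K) (A : set H) (B : set K) x :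
  (forall a, A a -> cspan B (T a)) -> cspan A x -> cspan B (T x).
Proof.
move=> AB /closure_sqnP hx; apply: (@cspan_closed _ B).
apply/closure_sqnP => e e0.
have [C C0 bT] := bop_bounded T.
have C1 : 0 < C + 1 by rewrite ltr_wpDl.
have [y [n [c [a [Aa ->]]]] xy] := hx _ (divr_gt0 e0 C1).
exists (T (\sum_(k < n) c k *: a k)).
  rewrite bop_sumr; elim/big_ind: _ => [|u v|k _]; [exact: cspan0 | exact: cspan_add |].
  by rewrite bopZr; apply: cspan_scale; apply: AB.
rewrite -bopBr (le_lt_trans (bT _)) //.
rewrite ltr_pdivlMr // mulrC in xy.
by rewrite (le_lt_trans _ xy) // ler_wpM2r ?sqn_ge0 // lerDl.
Qed.

Lemma cspan_orth H (A : set H) x z :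
  (forall a, A a -> inner z a = 0) -> cspan A x -> inner z x = 0.
Proof.
move=> Az /closure_sqnP hx.
have z1 : 0 < sqn z + 1 by rewrite ltr_wpDl // sqn_ge0.
suff h : normc (inner z x) ^+ 2 <= 0.
  apply/ComplexField.Normc.eq0_normc/eqP; rewrite -sqrf_eq0 eq_le h.
  by rewrite sqr_ge0.
apply/ler_addgt0Pl => e e0; rewrite addr0.
have [y [n [c [a [Aa ->]]]]] := hx _ (divr_gt0 e0 z1).
set y' := \sum_(k < n) _; have zy : inner z y' = 0.
  by rewrite inner_sumr big1 // => k _; rewrite innerZr Az ?mulr0.
rewrite ltr_pdivlMr // => xy.
have -> : inner z x = inner z (x - y') by rewrite innerBr zy subr0.
rewrite sqnBC in xy; rewrite (le_trans (cauchy_schwarz _ _)) //.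
rewrite (le_trans _ (ltW xy)) // mulrC ler_wpM2l ?sqn_ge0 // lerDl.
exact: ler01.
Qed.

Lemma total_eq H K (A : set H) (S T : bop H K) :
  total_set A -> (forall a, A a -> S a = T a) -> S = T.
Proof.
move=> tA h; apply: bop_ext => x; apply/eqP; rewrite -subr_eq0; apply/eqP.
have : cspan A x by rewrite /cspan tA.
(* The closed span of the empty set is {0}: vanishing is phrased as membership in it, so that
   [cspan_map] supplies the continuity argument. *)
suff /(_ x) h2 : forall x, cspan A x -> cspan (set0 : set K) ((S - T) x).
  move=> /h2; rewrite bopDE bopNE => h3.
  apply/inner_eq0 => z; exact: (cspan_orth _ h3).
move=> y; apply: cspan_map => a Aa.
by rewrite bopDE bopNE h // subrr; exact: cspan0.
Qed.

Lemma total_inner_eq0 H (A : set H) x :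
  total_set A -> (forall a, A a -> inner a x = 0) -> x = 0.
Proof.
move=> tA h; apply: inner_eq0 => y.
have : cspan A y by rewrite /cspan tA.
rewrite innerC => hy; rewrite (cspan_orth _ hy) ?rmorph0 // => a Aa.
by rewrite innerC h // rmorph0.
Qed.

Lemma total_sub H (A B : set H) : total_set A -> A `<=` cspan B -> total_set B.
Proof.
move=> tA AB; apply/seteqP; split=> // x _.
by apply: (cspan_cspan AB); rewrite /cspan tA.
Qed.

End Spans.

(** * Projections and the Riesz representation *)

Section Norm.
Variables (R : realType) (H : hilbert R).
Implicit Types x y : H.

Definition hn x : R := Num.sqrt (sqn x).

Lemma hn_ge0 x : 0 <= hn x. Proof. exact: sqrtr_ge0. Qed.

Lemma hnD x y : hn (x + y) <= hn x + hn y.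
Proof. by have := ler_normD x y; rewrite !normE -rmorphD lecR. Qed.

Lemma hnN x : hn (- x) = hn x. Proof. by rewrite /hn sqnN. Qed.

Lemma hn_sub x y : hn x <= hn y + hn (y - x).
Proof. by rewrite -{1}[x](subKr y) (le_trans (hnD _ _)) // hnN. Qed.

Lemma hn_lt x e : 0 < e -> (hn x < e) = (sqn x < e ^+ 2).
Proof. exact: sqrt_lt. Qed.

Lemma hn_sqr x : hn x ^+ 2 = sqn x.
Proof. by rewrite /hn sqr_sqrtr ?sqn_ge0. Qed.

End Norm.

(** The bound survives approximation of both vectors. After taking roots the triangle inequality
    makes the total error linear in the tolerance, so e / (sqrt C + 1) suffices. *)
Lemma sqn_approx (R : realType) (H K : hilbert R) (C : R) (x : H) (y : K) :
  0 <= C ->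
  (forall e : R, 0 < e -> exists x' y',
     [/\ sqn (x' - x) < e, sqn (y' - y) < e & sqn y' <= C * sqn x']) ->
  sqn y <= C * sqn x.
Proof.
move=> C0 h.
suff : hn y <= Num.sqrt C * hn x.
  by rewrite -[_ * hn x]ger0_norm ?mulr_ge0 ?sqrtr_ge0 ?hn_ge0 // -(ler_sqr) ?nnegrE ?hn_ge0 //
     real_normK ?num_real // exprMn !hn_sqr sqr_sqrtr.
apply/ler_addgt0Pl => e e0.
set s := Num.sqrt C; have s0 : 0 <= s by exact: sqrtr_ge0.
have s1 : 0 < s + 1 by rewrite ltr_wpDl.
have d0 : 0 < e / (s + 1) by rewrite divr_gt0.
have [x' [y' [hx hy xy]]] := h _ (exprn_gt0 2 d0).
move: hx hy; rewrite -!hn_lt // => hx hy.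
have {}xy : hn y' <= s * hn x' by rewrite /hn /s -sqrtrM // ler_wsqrtr.
have h1 := hn_sub y y'; have h2 : hn x' <= hn x + hn (x' - x).
  by rewrite -{1}[x'](subrK x) addrC hnD.
have h3 : s * hn x' <= s * (hn x + e / (s + 1)).
  by rewrite ler_wpM2l // (le_trans h2) // lerD2l ltW.
have -> : e + s * hn x = s * (hn x + e / (s + 1)) + e / (s + 1).
  by field; rewrite gt_eqF.
rewrite (le_trans h1) // lerD ?(le_trans xy) // ltW //.
Qed.

Section Projection.
Variables (R : realType) (H : hilbert R).

(** By the parallelogram law, a minimizing sequence for the distance to the span is Cauchy.
    Orthogonality is proved approximately for its members and then passed to the limit. *)
Lemma projection (A : set H) (v : H) :
  exists2 p, cspan A p & forall a, A a -> inner a (v - p) = 0.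
Proof.
pose B := [set sqn (v - c) | c in lspan A]; pose m := inf B.
have Bl : lbound B 0 by move=> _ [c _ <-]; exact: sqn_ge0.
have Bi : has_inf B.
  by split; [exists (sqn (v - 0)); exists 0 => //; exact: lspan0 | exists 0].
have mB c : lspan A c -> m <= sqn (v - c).
  by move=> Ac; apply: ge_inf; [exists 0 | exists c].
have ex (n : nat) : exists c, lspan A c /\ sqn (v - c) < m + n.+1%:R^-1.
  have n0 : 0 < n.+1%:R^-1 :> R by rewrite invr_gt0.
  by have [_ [c Ac <-] hc] := inf_adherent n0 Bi; exists c.
have [u hu] := choice ex.
have uA n : lspan A (u n) by case: (hu n).
have um n : sqn (v - u n) < m + n.+1%:R^-1 by case: (hu n).
have cau n k : sqn (u k - u n) <= 2 * (n.+1%:R^-1 + k.+1%:R^-1).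
  pose z := v - (2%:R^-1 : R[i]) *: (u n + u k).
  have mz : m <= sqn z by apply/mB/lspan_scale/lspan_add.
  have := parallelogram (v - u n) (v - u k).
  have -> : v - u n - (v - u k) = u k - u n by rewrite opprB addrC addrA subrK.
  have -> : v - u n + (v - u k) = (2%:R : R[i]) *: z.
    rewrite scalerBr scalerA divff ?pnatr_eq0 // scale1r scaler_nat mulr2n.
    by rewrite opprD addrACA.
  have -> : (2%:R : R[i]) = (Num.sqrt 4%:R)%:C.
    have -> : (4%:R : R) = 2%:R ^+ 2 by rewrite -natrX.
    by rewrite sqrtr_sqr ger0_norm // rmorph_nat.
  rewrite sqn_sqrtZ ?ler0n //.
  have := um n; have := um k; move: mz.
  move: (sqn (v - u n)) (sqn (v - u k)) (sqn (u k - u n)) (sqn z) => p q r t.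
  move: (n.+1%:R^-1) (k.+1%:R^-1) => i j; lra.
have [p up] : exists p, netcvg (fun a b : nat => (a <= b)%N) u p.
  apply: (netcauchy_cvg nat_directed) => e e0.
  have [N _ hN] := near_infty_natSinv_lt (PosNum (divr_gt0 e0 (ltr0n R 4))).
  exists N => d Nd; have := hN N (leqnn _); have := hN d Nd; have := cau N d.
  rewrite /=; move: (d.+1%:R^-1) (N.+1%:R^-1) (sqn _) => a b s; lra.
exists p.
  by apply/closure_sqnP => e /up[N hN]; exists (u N); rewrite ?hN.
move=> a Aa; apply/ComplexField.Normc.eq0_normc/eqP; rewrite -sqrf_eq0 eq_le sqr_ge0 andbT.
(* Moving [u n] by s <a, v - u n> a, with s = 1 / (|a|^2 + 1), cannot lower the squared distance
   below the infimum, which [u n] misses by less than 1/(n+1). *)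
have key n : normc (inner a (v - u n)) ^+ 2 <= (sqn a + 1) * n.+1%:R^-1.
  pose s := (sqn a + 1)^-1.
  have a1 : 0 < sqn a + 1 by rewrite ltr_wpDl // sqn_ge0.
  have s0 : 0 < s by rewrite invr_gt0.
  have := mB _ (lspan_add (uA n) (lspan_scale (s%:C * inner a (v - u n)) (lspan_incl Aa))).
  rewrite opprD addrA sqnB sqnZ innerZr (innerC _ a) -mulrA.
  set w := v - u n; case: (inner a w) => x y /=.
  have p' (c d : R) : 0 <= c ^+ 2 + d ^+ 2 by rewrite addr_ge0 ?sqr_ge0.
  rewrite !(sqr_sqrtr (p' _ _)) => h.
  have {h} : 0 <= sqn w - m + (x ^+ 2 + y ^+ 2) * (s * s * sqn a - 2 * s).
    move: h; rewrite -subr_ge0; congr (0 <= _); ring.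
  have -> : s * s * sqn a - 2 * s = - s * (1 + s).
    rewrite /s; field; exact: lt0r_neq0.
  move=> h; rewrite mulrC -ler_pdivrMr // -/s.
  have : sqn w - m < n.+1%:R^-1 by rewrite ltrBlDl um.
  have : 0 <= (x ^+ 2 + y ^+ 2) * s * s by rewrite !mulr_ge0 // ltW.
  move: h; move: (n.+1%:R^-1) (sqn w) (x ^+ 2 + y ^+ 2) => i c d; nra.
apply/ler_addgt0Pl => e e0; rewrite addr0.
have a1 : 0 < 4 * (sqn a + 1) by rewrite mulr_gt0 // ltr_wpDl // sqn_ge0.
have d0 := divr_gt0 e0 a1.
have [N1 hN1] := up _ d0.
have [N2 _ hN2] := near_infty_natSinv_lt (PosNum d0).
pose N := maxn N1 N2.
have {}hN1 : sqn (u N - p) < e / (4 * (sqn a + 1)) by apply: hN1; rewrite leq_maxl.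
have {}hN2 : N.+1%:R^-1 < e / (4 * (sqn a + 1)) by apply: (hN2 N) => /=; rewrite leq_maxr.
have -> : inner a (v - p) = inner a (v - u N) + inner a (u N - p).
  by rewrite -innerDr subrKA.
have cs := cauchy_schwarz a (u N - p).
have k := key N.
have c2 (y z : R[i]) : normc (y + z) ^+ 2 <= 2 * normc y ^+ 2 + 2 * normc z ^+ 2.
  case: y => y1 y2; case: z => z1 z2 /=; rewrite !sqr_sqrtr ?addr_ge0 ?sqr_ge0 //.
  have := sqr_ge0 (y1 - z1); have := sqr_ge0 (y2 - z2); nra.
apply: le_trans (c2 _ _) _.
rewrite ltr_pdivlMr // in hN1; rewrite ltr_pdivlMr // in hN2.
have := sqn_ge0 (u N - p); have := sqn_ge0 a.
have : 0 <= N.+1%:R^-1 :> R by rewrite invr_ge0.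
move: cs k hN1 hN2; move: (normc _ ^+ 2) (normc _ ^+ 2) (sqn a) (sqn (u N - p)) (N.+1%:R^-1).
move=> x1 x2 s1 s2 t; nra.
Qed.

Lemma total_orth (A : set H) :
  (forall z, (forall a, A a -> inner a z = 0) -> z = 0) -> total_set A.
Proof.
move=> h; apply/seteqP; split=> // v _.
have [p Cp hp] := projection A v.
by have /eqP := h _ hp; rewrite subr_eq0 => /eqP ->.
Qed.

Lemma riesz (w : H -> R[i]) (C : R) :
  (forall a x y, w (a *: x + y) = a * w x + w y) ->
  (forall x, normc (w x) ^+ 2 <= C * sqn x) ->
  exists z, forall x, w x = inner z x.
Proof.
move=> lw bw.
have [w0|/existsNP[v wv]] := pselect (forall x, w x = 0).
  by exists 0 => x; rewrite w0 inner0l.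
have wD x y : w (x + y) = w x + w y by have := lw 1 x y; rewrite scale1r mul1r.
have w0 : w 0 = 0 by apply: (addrI (w 0)); rewrite -wD !addr0.
have wZ a x : w (a *: x) = a * w x by have := lw a x 0; rewrite !addr0 w0 addr0.
pose A := [set x | w x = 0].
have [p Cp hp] := projection A v.
(* The bound on [w] makes its kernel closed, so the projection onto the closed span of the kernel
   stays in the kernel. *)
have wp : w p = 0.
  apply/ComplexField.Normc.eq0_normc/eqP; rewrite -sqrf_eq0 eq_le sqr_ge0 andbT.
  apply/ler_addgt0Pl => e e0; rewrite addr0.
  have C1 : 0 < `|C| + 1 by rewrite ltr_wpDl.
  have [y [n [c [a [Aa ->]]]]] := (closure_sqnP _ _).1 Cp _ (divr_gt0 e0 C1).
  set y' := \sum_(k < n) _ => py.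
  have wy : w y' = 0.
    rewrite /y'; elim/big_ind: _ => // [x z wx wz|k _]; first by rewrite wD wx wz addr0.
    by rewrite wZ Aa mulr0.
  have -> : w p = w (p - y') by rewrite wD -[- y']scaleN1r wZ wy mulr0 addr0.
  rewrite (le_trans (bw _)) // sqnBC; rewrite ltr_pdivlMr // in py.
  rewrite (le_trans _ (ltW py)) // mulrC ler_wpM2l ?sqn_ge0 //.
  by rewrite (le_trans (ler_norm _)) // lerDl.
pose q := v - p.
have wq : w q = w v by rewrite wD -[- p]scaleN1r wZ wp mulr0 addr0.
have wq0 : w q != 0 by rewrite wq; exact/eqP.
have q0 : inner q q != 0.
  apply: contra wq0 => /eqP qq; have -> : q = 0; last by rewrite w0.
  by apply: sqn_eq0; rewrite /sqn qq.
(* The coefficient is forced by the value at [q]; it is conjugated because [inner] is antilinear on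
   the left. *)
exists ((w q / inner q q)^*%R *: q) => x.
rewrite innerZl conjCK.
have : inner (x - (w x / w q) *: q) q = 0.
  by apply: hp; rewrite /A /= wD -scaleN1r scalerA wZ mulN1r mulNr divfK // subrr.
rewrite innerC => /(congr1 Num.conj); rewrite conjCK rmorph0 innerBr innerZr => /eqP.
by rewrite subr_eq0 => /eqP ->; rewrite mulrCA mulfVK // divfK.
Qed.

End Projection.

(** * Adjoints and extension of partial isometries *)

Section Adjoint.
Variable R : realType.
Implicit Types H K : hilbert R.

(** The norm estimate for adjoints, with x the adjoint applied to y and t = T x: Cauchy-Schwarz
    bounds |x|^4 by C |x|^2 |y|^2, and one factor |x|^2 cancels. *)
Lemma sqn_adj_le H K (C : R) (x : H) (y t : K) : 0 <= C ->
  inner x x = inner y t -> sqn t <= C * sqn x -> sqn x <= C * sqn y.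
Proof.
move=> C0 e tx; have [->|x0] := eqVneq (sqn x) 0; first by rewrite mulr_ge0 ?sqn_ge0.
have xp : 0 < sqn x by rewrite lt_neqAle eq_sym x0 sqn_ge0.
have := cauchy_schwarz y t; rewrite -e -sqnE /= expr0n addr0 sqrtr_sqr real_normK ?num_real // => h.
by rewrite -(ler_pM2r xp) -expr2 (le_trans h) // -mulrA mulrCA ler_wpM2l ?sqn_ge0.
Qed.

Lemma adjoint_exists H K (T : bop H K) :
  exists S : bop K H, forall x y, inner (S y) x = inner y (T x).
Proof.
have [C C0 bT] := bop_bounded T.
have ex y : exists z, forall x, inner y (T x) = inner z x.
  apply: (@riesz _ _ (fun x => inner y (T x)) (sqn y * C)) => [a u v|x].
    by rewrite bopDr bopZr innerDr innerZr.
  by rewrite (le_trans (cauchy_schwarz _ _)) // -mulrA ler_wpM2l ?sqn_ge0.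
have [f hf] := choice ex.
have [||S hS] := @mkbop _ _ _ f C.
- move=> a u v; apply: inner_inj => x; rewrite innerC -hf innerDl innerZl.
  by rewrite rmorphD rmorphM /= conjCK !hf -!innerC innerDr innerZr.
- move=> y; apply: (@sqn_adj_le _ _ C (f y) y (T (f y))) => //; exact: bT.
- by exists S => x y; rewrite hS hf.
Qed.

Definition adj H K (T : bop H K) : bop K H := projT1 (cid (adjoint_exists T)).

Lemma adjP H K (T : bop H K) x y : inner (adj T y) x = inner y (T x).
Proof. by rewrite /adj; case: cid => S /=. Qed.

Lemma adjPr H K (T : bop H K) x y : inner x (adj T y) = inner (T x) y.
Proof. by rewrite innerC adjP -innerC. Qed.

Lemma adj_uniq H K (T : bop H K) (S : bop K H) :
  (forall x y, inner (S y) x = inner y (T x)) -> adj T = S.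
Proof.
by move=> h; apply: bop_ext => y; apply: inner_inj => x; rewrite adjPr innerC -h -innerC.
Qed.

Lemma adj_le H K (T : bop H K) (C : R) : 0 <= C ->
  (forall x, sqn (T x) <= C * sqn x) -> forall y, sqn (adj T y) <= C * sqn y.
Proof.
move=> C0 bT y.
by apply: (@sqn_adj_le _ _ C (adj T y) y (T (adj T y))) => //; rewrite adjP.
Qed.

Lemma adj_eq0 H K (T : bop H K) (A : set H) y : total_set A ->
  (forall a, A a -> inner (T a) y = 0) -> adj T y = 0.
Proof. by move=> tA h; apply: (total_inner_eq0 tA) => a Aa; rewrite adjPr h. Qed.

Lemma adj_eq H K (T : bop H K) (A : set H) y z : total_set A ->
  (forall a, A a -> inner (T a) y = inner a z) -> adj T y = z.
Proof.
move=> tA h; apply/eqP; rewrite -subr_eq0; apply/eqP/(total_inner_eq0 tA) => a Aa.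
by rewrite innerBr adjPr h // subrr.
Qed.

(** [G] is the graph of an operator prescribed on a total set. The bound on its span does
    everything: applied to differences it makes the closed graph [Ga] single-valued, and it makes
    second coordinates Cauchy when first coordinates converge. *)
Lemma extension H K (G : set (H * K)%type) (C : R) : 0 <= C ->
  total_set [set p.1 | p in G] ->
  (forall p, lspan G p -> sqn p.2 <= C * sqn p.1) ->
  exists T : bop H K, (forall p, G p -> T p.1 = p.2) /\
    forall x, sqn (T x) <= C * sqn x.
Proof.
move=> C0 tG bG.
pose Ga (v : H) (y : K) := forall e : R, 0 < e ->
  exists p, [/\ lspan G p, sqn (p.1 - v) < e & sqn (p.2 - y) < e].
have Gle v y : Ga v y -> sqn y <= C * sqn v.
  move=> h; apply: sqn_approx => // e /h[p [Gp h1 h2]].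
  by exists p.1, p.2; split=> //; exact: bG.
have Glin a v y v' y' : Ga v y -> Ga v' y' -> Ga (a *: v + v') (a *: y + y').
  move=> h h' e e0; pose c := normc a ^+ 2 + 1.
  have c0 : 0 < c by rewrite ltr_wpDl ?sqr_ge0.
  have e1 : 0 < e / (4 * c) by rewrite divr_gt0 ?mulr_gt0.
  have [p [Gp p1 p2]] := h _ e1; have [q [Gq q1 q2]] := h' _ (divr_gt0 e0 (ltr0n _ 4)).
  have aux (V : hilbert R) (x x' u u' : V) : sqn (x - u) < e / (4 * c) ->
      sqn (x' - u') < e / 4 -> sqn ((a *: x + x') - (a *: u + u')) < e.
    move=> hx hx'; rewrite opprD addrACA -scalerBr (le_lt_trans (sqnD_le _ _)) //.
    rewrite sqnZ.
    have : normc a ^+ 2 * sqn (x - u) <= c * sqn (x - u).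
      by rewrite ler_wpM2r ?sqn_ge0 // lerDl.
    have : c * sqn (x - u) < e / 4.
      have -> : e / 4 = c * (e / (4 * c)) by field; exact: lt0r_neq0.
      by rewrite ltr_pM2l.
    by lra.
  exists (a *: p + q); split; first by apply: lspan_add => //; exact: lspan_scale.
    exact: aux.
  exact: aux.
have ex v : exists y, Ga v y.
  have ex1 (n : nat) : exists p, lspan G p /\ sqn (p.1 - v) < n.+1%:R^-1.
    have n0 : 0 < n.+1%:R^-1 :> R by rewrite invr_gt0.
    have : cspan [set p.1 | p in G] v by rewrite /cspan tG.
    move=> /closure_sqnP /(_ _ n0) [y [k [c [b [Ab ->]]]]].
    have /choice[f hf] : forall i, exists p, G p /\ p.1 = b i.
      by move=> i; have [p Gp e] := Ab i; exists p.
    move=> hy; exists (\sum_(i < k) c i *: f i); split.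
      by exists k, c, f; split=> // i; case: (hf i).
    rewrite (_ : (_ : H * K).1 = \sum_(i < k) c i *: b i) //.
    rewrite (big_morph (@fst H K) (id1 := 0) (op1 := +%R)) //.
    by apply: eq_bigr => i _ /=; case: (hf i) => _ <-.
  have [u hu] := choice ex1.
  have [|y hy] := @netcauchy_cvg _ _ _ nat_directed K (fun n => (u n).2).
    move=> e e0; have C1 : 0 < 4 * (C + 1) by rewrite mulr_gt0 // ltr_wpDl.
    have [N _ hN] := near_infty_natSinv_lt (PosNum (divr_gt0 e0 C1)).
    exists N => d Nd.
    have [Gd dd] := hu d; have [GN dN] := hu N.
    have Gdiff : lspan G (u d - u N).
      by rewrite -[- u N]scaleN1r; apply: lspan_add => //; exact: lspan_scale.
    have h0 : sqn ((u d).1 - (u N).1) <= 2 * d.+1%:R^-1 + 2 * N.+1%:R^-1.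
      rewrite (le_trans (sqnB_le _ v _)) // lerD // ler_wpM2l // ltW //.
      by rewrite sqnBC.
    have h1 : sqn ((u d).2 - (u N).2) <= C * (2 * d.+1%:R^-1 + 2 * N.+1%:R^-1).
      by rewrite (le_trans (bG _ Gdiff)) // ler_wpM2l.
    have := hN N (leqnn _); have := hN d Nd; rewrite /= !ltr_pdivlMr //.
    have : 0 < N.+1%:R^-1 :> R by rewrite invr_gt0.
    have : 0 < d.+1%:R^-1 :> R by rewrite invr_gt0.
    move: h1; move: (d.+1%:R^-1) (N.+1%:R^-1) (sqn _) => i j t; lra.
  exists y => e e0.
  have [N1 hN1] := hy _ e0.
  have [N2 _ hN2] := near_infty_natSinv_lt (PosNum e0).
  exists (u (maxn N1 N2)); split; first by case: (hu (maxn N1 N2)).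
    case: (hu (maxn N1 N2)) => _ h; apply: (lt_trans h).
    by apply: (hN2 (maxn N1 N2)); rewrite /= leq_maxr.
  by apply: hN1; rewrite leq_maxl.
have [f hf] := choice ex.
have Guniq v y y' : Ga v y -> Ga v y' -> y = y'.
  move=> h h'; have := Glin (-1) _ _ _ _ h h'; rewrite scaleN1r addNr => /Gle.
  rewrite sqn0 mulr0 => h0; apply/eqP; rewrite eq_sym -subr_eq0; apply/eqP/sqn_eq0.
  by apply/eqP; rewrite eq_le sqn_ge0 andbT addrC -scaleN1r.
have [||T hT] := @mkbop _ _ _ f C.
- by move=> a u v; apply: (Guniq _ _ _ (hf _)); exact: Glin.
- by move=> x; exact: Gle.
exists T; split; last by move=> x; rewrite hT; exact: Gle.
move=> p Gp; rewrite hT; apply: (Guniq _ _ _ (hf _)) => e e0.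
by exists p; rewrite !subrr !sqn0; split=> //; exact: lspan_incl.
Qed.

(** The vectors [e x] with [P x] span a space orthogonal to the other generators; T is the
    projection onto that space followed by the isometry [e x] to [f x]. Here X will consist of words
    and P will express that the result is reduced. *)
Lemma partial_isometry H K (X : Type) (D P : set X) (e : X -> H) (f : X -> K) :
  total_set [set e x | x in D] ->
  (forall x y, D x -> D y -> P x -> P y -> inner (f x) (f y) = inner (e x) (e y)) ->
  (forall x y, D x -> D y -> P x -> ~ P y -> inner (e x) (e y) = 0) ->
  exists T : bop H K,
    [/\ forall x, D x -> P x -> T (e x) = f x,
        forall x, D x -> ~ P x -> T (e x) = 0,
        forall v, sqn (T v) <= sqn v,
        forall x, D x -> P x -> adj T (f x) = e x &
        forall g, (forall x, D x -> P x -> inner (f x) g = 0) -> adj T g = 0].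
Proof.
move=> tD ff ee.
pose f' x := if `[< P x >] then f x else 0.
pose G := [set (e x, f' x) | x in D].
have [//|||T [TG Tle]] := @extension H K G 1.
- rewrite /total_set -[RHS]tD; congr (closure (lspan _)); apply/seteqP; split.
    by move=> _ [_ [x Dx <-] <-]; exists x.
  by move=> _ [x Dx <-]; exists (e x, f' x) => //; exists x.
- move=> p [n [c [a [Ga ->]]]]; rewrite mul1r.
  have /choice[x hx] : forall k, exists x, D x /\ (e x, f' x) = a k.
    by move=> k; have [x Dx <-] := Ga k; exists x.
  have a1 k : (a k).1 = e (x k) by case: (hx k) => _ <-.
  have a2 k : (a k).2 = f' (x k) by case: (hx k) => _ <-.
  have Dx k : D (x k) by case: (hx k).
  rewrite (big_morph (@fst H K) (id1 := 0) (op1 := +%R)) //.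
  rewrite (big_morph (@snd H K) (id1 := 0) (op1 := +%R)) //.
  (* The terms outside P are orthogonal to the others and are sent to 0, so they only enlarge the
     norm of the source. *)
  rewrite [X in _ <= sqn X](bigID (fun k => `[< P (x k) >])) /=.
  rewrite [leRHS]sqnD_orth; last first.
    rewrite inner_suml big1 // => k /asboolP Pk.
    rewrite inner_sumr big1 // => l /asboolP Pl.
    by rewrite innerZl innerZr !a1 ee ?mulr0.
  rewrite ler_wpDr ?sqn_ge0 //.
  rewrite (bigID (fun k => `[< P (x k) >])) /= [X in _ + X]big1 ?addr0; last first.
    by move=> k /negbTE Pk; rewrite a2 /f' Pk scaler0.
  rewrite /sqn !inner_suml le_eqVlt; apply/orP; left; apply/eqP; congr (complex.Re _).
  apply: eq_bigr => k Pk; rewrite !inner_sumr; apply: eq_bigr => l Pl.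
  rewrite !innerZl !innerZr !a1 !a2 /f' Pk Pl ff //; exact/asboolP.
have Te x : D x -> T (e x) = f' x by move=> Dx; apply: (TG (e x, f' x)); exists x.
exists T; split.
- by move=> x Dx /asboolP Px; rewrite Te // /f' Px.
- by move=> x Dx /asboolPn/negbTE Px; rewrite Te // /f' Px.
- by move=> v; rewrite (le_trans (Tle v)) ?mul1r.
- move=> x Dx Px; apply: (adj_eq tD) => _ [y Dy <-]; rewrite Te // /f'.
  case: asboolP => Py; first exact: ff.
  by rewrite inner0l innerC ee // rmorph0.
- move=> g h; apply: (adj_eq0 tD) => _ [y Dy <-]; rewrite Te // /f'.
  by case: asboolP => Py; rewrite ?inner0l // h.
Qed.

End Adjoint.

(** * Families of contractions with orthogonal ranges *)

Section SeqNets.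
Variables (R : realType) (B : eqType).

Definition seq_sub (s t : seq B) : Prop := {subset s <= t}.

Lemma seq_directed : directed seq_sub.
Proof.
split; [by move=> a x | by move=> a b c ab bc x xa; apply: bc; exact: ab | |].
  exact: (inhabits [::]).
by move=> a b; exists (a ++ b) => x xi; rewrite mem_cat xi ?orbT.
Qed.

(** Removing duplicates lets a list serve as a finite set. *)
Definition usum (V : zmodType) (f : B -> V) (s : seq B) : V := \sum_(b <- undup s) f b.

Lemma usum_split (V : zmodType) (f : B -> V) (s t : seq B) : seq_sub s t ->
  usum f t = usum f s + \sum_(b <- undup t | b \notin s) f b.
Proof.
move=> st; rewrite /usum (bigID (mem s)) /=; congr (_ + _).
rewrite -big_filter; apply: perm_big; apply: uniq_perm; rewrite ?filter_uniq ?undup_uniq //.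
move=> b; rewrite mem_filter !mem_undup; apply/andP/idP => [[]//|bs].
by split=> //; exact: st.
Qed.

(** A list whose sum is within e of the supremum of all finite sums leaves less than e to any
    disjoint list. *)
Lemma usum_tail (g : B -> R) (M : R) : (forall b, 0 <= g b) ->
  (forall s, uniq s -> \sum_(b <- s) g b <= M) ->
  forall e : R, 0 < e -> exists s0 : seq B, forall t : seq B, uniq t ->
    (forall b, b \in t -> b \notin s0) -> \sum_(b <- t) g b < e.
Proof.
move=> g0 gM e e0.
pose A := [set \sum_(b <- s) g b | s in [set s | uniq s]].
have hA : has_sup A.
  split; first by exists (\sum_(b <- [::]) g b); exists [::].
  by exists M => _ [s us <-]; exact: gM.
have [_ [s us <-] hs] := sup_adherent e0 hA.
exists s => t ut ts.
have : \sum_(b <- s ++ t) g b <= sup A.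
  apply: ub_le_sup; first by case: hA.
  exists (s ++ t) => //=; rewrite cat_uniq us ut andbT /=.
  by apply/hasPn => b /ts.
rewrite big_cat /=; move: hs; set x := \sum_(b <- s) _; set y := \sum_(b <- t) _; lra.
Qed.

End SeqNets.

Section NetLimits.
Variables (R : realType) (D : Type) (le : D -> D -> Prop).
Hypothesis dirD : directed le.

Lemma netcvg_lin (H : hilbert R) (u v : D -> H) (a : R[i]) l l' :
  netcvg le u l -> netcvg le v l' -> netcvg le (fun d => a *: u d + v d) (a *: l + l').
Proof.
case: dirD => rD tD _ dD hu hv e e0.
have c0 : 0 < normc a ^+ 2 + 1 by rewrite ltr_wpDl ?sqr_ge0.
have [d1 h1] := hu _ (divr_gt0 e0 (mulr_gt0 (ltr0n _ 4) c0)).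
have [d2 h2] := hv _ (divr_gt0 e0 (ltr0n _ 4)).
have [d0 d10 d20] := dD d1 d2.
exists d0 => d d0d; rewrite opprD addrACA -scalerBr (le_lt_trans (sqnD_le _ _)) // sqnZ.
have := h1 d (tD _ _ _ d10 d0d); have := h2 d (tD _ _ _ d20 d0d).
rewrite !ltr_pdivlMr ?mulr_gt0 //.
have := sqn_ge0 (u d - l); move: (sqn (u d - l)) (sqn (v d - l')) (normc a ^+ 2) => x y z; lra.
Qed.

Lemma netcvg_cst (H : hilbert R) (l : H) : netcvg le (fun=> l) l.
Proof. by case: dirD => _ _ [d] _ e e0; exists d => d' _; rewrite subrr sqn0. Qed.

Lemma netcvg_sum (H : hilbert R) (J : Type) (r : seq J) (u : J -> D -> H) l :
  (forall j, netcvg le (u j) (l j)) ->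
  netcvg le (fun d => \sum_(j <- r) u j d) (\sum_(j <- r) l j).
Proof.
move=> h; elim: r => [|j r IH].
  rewrite big_nil (_ : (fun _ => _) = fun=> 0); first exact: netcvg_cst.
  by apply: funext => d; rewrite big_nil.
rewrite big_cons (_ : (fun _ => _) = fun d => 1 *: u j d + \sum_(i <- r) u i d).
  by rewrite -[l j]scale1r; exact: netcvg_lin.
by apply: funext => d; rewrite big_cons scale1r.
Qed.

Lemma netcvg_sqn (H : hilbert R) (u : D -> H) l (e : R) : 0 < e ->
  netcvg le u l -> exists d0, forall d, le d0 d -> sqn l <= sqn (u d) + e.
Proof.
move=> e0 hu; have l1 : 0 < sqn l + 1 by rewrite ltr_wpDl ?sqn_ge0.
(* Weight for Young's inequality: the cross term 2 Re <l, l - u d> is at most h |l|^2 + |l - u d|^2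
   / h, and each half is at most e/2. *)
pose h := e / (2 * (sqn l + 1)); have h0 : 0 < h by rewrite divr_gt0 ?mulr_gt0.
have [d0 hd0] := hu _ (mulr_gt0 h0 (divr_gt0 e0 (ltr0n _ 2))).
exists d0 => d /hd0; rewrite mulrC -ltr_pdivrMr // => hd.
have : 0 <= sqn ((Num.sqrt h)%:C *: l - (Num.sqrt h^-1)%:C *: (l - u d)) by exact: sqn_ge0.
rewrite sqnB !sqn_sqrtZ ?invr_ge0 ?(ltW h0) // innerZl innerZr.
have -> (x y : R) (z : R[i]) : complex.Re (((x%:C)^*)%R * (y%:C * z)) = x * y * complex.Re z.
  by case: z => p q /=; ring.
rewrite -sqrtrM ?(ltW h0) // divff ?lt0r_neq0 // sqrtr1 mul1r.
have := sqnB l (l - u d); rewrite subKr => ->.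
have : h * sqn l <= e / 2.
  have -> : e / 2 = h * (sqn l + 1) by rewrite /h; field; rewrite lt0r_neq0.
  by rewrite ler_pM2l // lerDl.
rewrite sqnBC in hd; rewrite [h^-1 * _]mulrC; have := sqn_ge0 (l - u d).
move: hd; move: (sqn (l - u d) / h) (h * sqn l) (sqn (l - u d)) (complex.Re _) (sqn l).
by move=> x y z t v; lra.
Qed.

Lemma netcvg_sum_sqn_le (H : hilbert R) (J : Type) (r : seq J) (u : J -> D -> H) l (M : R) :
  (forall j, netcvg le (u j) (l j)) ->
  (forall d, \sum_(j <- r) sqn (u j d) <= M) -> \sum_(j <- r) sqn (l j) <= M.
Proof.
case: (dirD) => rD tD _ dD hu hM; apply/ler_addgt0Pl => e e0.
suff [d0 hd0] : exists d0, forall d, le d0 d ->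
    \sum_(j <- r) sqn (l j) <= \sum_(j <- r) sqn (u j d) + e.
  by rewrite (le_trans (hd0 _ (rD d0))) // addrC lerD2l.
elim: r {hM} e e0 => [|j r IH] e e0.
  case: (dirD) => _ _ [d0] _; exists d0 => d _; rewrite !big_nil add0r; exact: ltW.
have e2 := divr_gt0 e0 (ltr0n R 2).
have [d1 h1] := IH _ e2; have [d2 h2] := netcvg_sqn e2 (hu j).
have [d0 d10 d20] := dD d1 d2; exists d0 => d d0d; rewrite !big_cons.
have := h1 d (tD _ _ _ d10 d0d); have := h2 d (tD _ _ _ d20 d0d).
move: (\sum_(j <- r) _) (\sum_(j <- r) _) => x y; lra.
Qed.

End NetLimits.

(** Equivalently, a contraction from the Hilbert sum of copies of H indexed by B, with orthogonal
    blocks; [orth_synth] is its norm bound and [orth_bessel] that of its adjoint. *)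
Record orth_family (R : realType) (B : eqType) (H K : hilbert R) := OrthFamily {
  ofam :> B -> bop H K;
  ofam_le : forall b v, sqn (ofam b v) <= sqn v;
  ofam_orth : forall b c v w, b != c -> inner (ofam b v) (ofam c w) = 0
}.

Section Bessel.
Variables (R : realType) (B : eqType) (H K : hilbert R) (Q : orth_family B H K).

Lemma orth_synth s (z : B -> H) : uniq s ->
  sqn (\sum_(b <- s) Q b (z b)) <= \sum_(b <- s) sqn (z b).
Proof.
move=> us; rewrite sqn_sum_orth // => [|b c _ _ bc]; last exact: ofam_orth.
by apply: ler_sum => b _; exact: ofam_le.
Qed.

(** The sum S equals <u, y> for y the sum of Q_b applied to [adj (Q b) u], and |y|^2 <= S by
    synthesis; Cauchy-Schwarz then gives S^2 <= |u|^2 S. *)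
Lemma orth_bessel s u : uniq s -> \sum_(b <- s) sqn (adj (Q b) u) <= sqn u.
Proof.
move=> us; set S := \sum_(b <- s) _.
have S0 : 0 <= S by apply: sumr_ge0 => *; exact: sqn_ge0.
have [->|Sn0] := eqVneq S 0; first exact: sqn_ge0.
have Sp : 0 < S by rewrite lt_neqAle eq_sym Sn0.
rewrite -(ler_pM2r Sp); pose y := \sum_(b <- s) Q b (adj (Q b) u).
have -> : S * S = normc (inner u y) ^+ 2.
  have -> : inner u y = S%:C.
    rewrite inner_sumr rmorph_sum; apply: eq_bigr => b _.
    by rewrite -adjP; symmetry; exact: sqnE.
  by rewrite /= expr0n addr0 sqrtr_sqr ger0_norm.
by rewrite (le_trans (cauchy_schwarz _ _)) // ler_wpM2l ?sqn_ge0 // orth_synth.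
Qed.

End Bessel.

(** * Maps induced by two orthogonal families *)

Section Theta.
Variables (R : realType) (B : eqType) (H K H' K' : hilbert R).
Variables (Q : orth_family B H H') (Q' : orth_family B K K').

Definition theta_term (x : bop H K) (u : H') (b : B) : K' := Q' b (x (adj (Q b) u)).

(** Complete contractivity at the level of finite sums: synthesis for Q', the bound on the matrix x
    separately for each b, then Bessel for Q. *)
Lemma theta_term_sum_le n (x : 'I_n -> 'I_n -> bop H K) (c : R) (h : 'I_n -> H') s :
  uniq s ->
  (forall h : 'I_n -> H, \sum_p sqn (\sum_q x p q (h q)) <= c * \sum_q sqn (h q)) ->
  0 <= c ->
  \sum_p sqn (\sum_q \sum_(b <- s) theta_term (x p q) (h q) b) <= c * \sum_q sqn (h q).
Proof.
move=> us hx c0.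
have -> : \sum_p sqn (\sum_q \sum_(b <- s) theta_term (x p q) (h q) b) =
   \sum_p sqn (\sum_(b <- s) Q' b (\sum_q x p q (adj (Q b) (h q)))).
  apply: eq_bigr => p _; rewrite exchange_big /=; congr sqn.
  by apply: eq_bigr => b _; rewrite bop_sumr.
have : \sum_p sqn (\sum_(b <- s) Q' b (\sum_q x p q (adj (Q b) (h q)))) <=
    \sum_p \sum_(b <- s) sqn (\sum_q x p q (adj (Q b) (h q))).
  by apply: ler_sum => p _; exact: (orth_synth Q' (fun b => \sum_q x p q (adj (Q b) (h q)))).
move/le_trans; apply; rewrite exchange_big /=.
have : \sum_(b <- s) \sum_p sqn (\sum_q x p q (adj (Q b) (h q))) <=
    \sum_(b <- s) c * \sum_q sqn (adj (Q b) (h q)).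
  by apply: ler_sum => b _; exact: (hx (fun q => adj (Q b) (h q))).
move/le_trans; apply; rewrite -mulr_sumr ler_wpM2l // exchange_big /=.
by apply: ler_sum => q _; exact: orth_bessel.
Qed.

Lemma theta_term_le (x : bop H K) (C : R) (u : H') s : 0 <= C -> uniq s ->
  (forall v, sqn (x v) <= C * sqn v) ->
  sqn (\sum_(b <- s) theta_term x u b) <= C * \sum_(b <- s) sqn (adj (Q b) u).
Proof.
move=> C0 us hx; rewrite (le_trans (orth_synth Q' _ us)) // mulr_sumr.
by apply: ler_sum => b _; exact: hx.
Qed.

(** The sum converges strongly: its tails are bounded by C times those of the squared norms of
    [adj (Q b) u], which are summable by Bessel. *)
Lemma theta_exists (x : bop H K) : exists T : bop H' K',
  forall u, netcvg (@seq_sub B) (usum (theta_term x u)) (T u).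
Proof.
have [C C0 bx] := bop_bounded x.
have ex u : exists l, netcvg (@seq_sub B) (usum (theta_term x u)) l.
  apply: netcauchy_cvg; first exact: seq_directed.
  move=> e e0; have C1 : 0 < C + 1 by rewrite ltr_wpDl.
  have [|//|s0 hs0] := @usum_tail R B (fun b => sqn (adj (Q b) u)) (sqn u) _ _ _ (divr_gt0 e0 C1).
    by move=> b; exact: sqn_ge0.
  - by move=> s; exact: orth_bessel.
  exists s0 => t st; rewrite (usum_split _ st) addrAC subrr add0r -big_filter.
  have ut : uniq [seq b <- undup t | b \notin s0] by rewrite filter_uniq ?undup_uniq.
  rewrite (le_lt_trans (theta_term_le u C0 ut bx)) //.
  have := hs0 _ ut; rewrite ltr_pdivlMr // => h.
  apply: le_lt_trans (h _); last by move=> b; rewrite mem_filter => /andP[].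
  by rewrite mulrC ler_wpM2l ?lerDl // sumr_ge0 // => *; exact: sqn_ge0.
have [f hf] := choice ex.
have [||T hT] := @mkbop _ _ _ f C.
- move=> a u v; apply: (netcvg_uniq (seq_directed B) (hf _)).
  have := netcvg_lin (seq_directed B) a (hf u) (hf v).
  congr netcvg; apply: funext => s.
  rewrite /usum scaler_sumr -big_split /=; apply: eq_bigr => b _.
  by rewrite /theta_term !(bopDr, bopZr).
- move=> u; apply: sqn_approx => // e e0; have [s hs] := hf u e e0.
  exists u, (usum (theta_term x u) s); rewrite subrr sqn0; split=> //.
    exact: (hs s (fun b h => h)).
  rewrite (le_trans (theta_term_le _ C0 (undup_uniq s) bx)) // ler_wpM2l //.
  exact: orth_bessel (undup_uniq s).
by exists T => u; rewrite hT; exact: hf.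
Qed.

Definition theta (x : bop H K) : bop H' K' := projT1 (cid (theta_exists x)).

Lemma thetaP x u : netcvg (@seq_sub B) (usum (theta_term x u)) (theta x u).
Proof. by rewrite /theta; case: cid => T /=. Qed.

Lemma theta_lin a x y : theta (a *: x + y) = a *: theta x + theta y.
Proof.
apply: bop_ext => u; apply: (netcvg_uniq (seq_directed B) (thetaP _ _)).
have := netcvg_lin (seq_directed B) a (thetaP x u) (thetaP y u).
congr netcvg; apply: funext => s.
rewrite /usum scaler_sumr -big_split /=; apply: eq_bigr => b _.
by rewrite /theta_term bopDE bopZE bopDr bopZr.
Qed.

(** This is how [theta] is evaluated on a generating vector, which only one member of the family
    reaches. *)
Lemma theta_single x u b : (forall c, c != b -> adj (Q c) u = 0) ->
  theta x u = Q' b (x (adj (Q b) u)).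
Proof.
move=> h; apply: (netcvg_uniq (seq_directed B) (thetaP _ _)) => e e0.
exists [:: b] => s /(_ b); rewrite inE eqxx => /(_ isT) bs.
rewrite /usum (bigD1_seq b) ?undup_uniq ?mem_undup //= big1 ?addr0 ?subrr ?sqn0 //.
by move=> c cb; rewrite /theta_term h // !bop0r.
Qed.

Lemma theta_zero x u : (forall c, adj (Q c) u = 0) -> theta x u = 0.
Proof.
move=> h; apply: (netcvg_uniq (seq_directed B) (thetaP _ _)) => e e0.
exists [::] => s _; rewrite /usum big1 ?subrr ?sqn0 // => c _.
by rewrite /theta_term h // !bop0r.
Qed.

Lemma theta_cc n (x : 'I_n -> 'I_n -> bop H K) (c : R) : 0 <= c ->
  (forall h : 'I_n -> H, \sum_p sqn (\sum_q x p q (h q)) <= c * \sum_q sqn (h q)) ->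
  forall h : 'I_n -> H', \sum_p sqn (\sum_q theta (x p q) (h q)) <= c * \sum_q sqn (h q).
Proof.
move=> c0 hx h.
apply: (netcvg_sum_sqn_le (seq_directed B)
  (u := fun p s => \sum_q usum (theta_term (x p q) (h q)) s)).
  by move=> p; apply: (netcvg_sum (seq_directed B)) => q; exact: thetaP.
by move=> s; apply: theta_term_sum_le => //; exact: undup_uniq.
Qed.

End Theta.

(** * Scalar limits, square-summable sequences and countable supports *)

Section ComplexLimits.
Variable R : realType.

Lemma normcB (x y : R[i]) : normc (x - y) = normc (y - x).
Proof.
by apply: complexI; move: (normrN (x - y)); rewrite opprB !normc_def; case: x => a b; case: y.
Qed.

Lemma normcE (x : R[i]) : `|x| = (normc x)%:C.
Proof. by rewrite normc_def; case: x. Qed.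

Lemma normc_ge0 (x : R[i]) : 0 <= normc x.
Proof. by case: x => a b; exact: sqrtr_ge0. Qed.

Lemma normcD (x y : R[i]) : normc (x + y) <= normc x + normc y.
Proof. by rewrite -lecR rmorphD /= -!normcE ler_normD. Qed.

Lemma normc_sum (J : Type) (r : seq J) (P : pred J) (f : J -> R[i]) :
  normc (\sum_(j <- r | P j) f j) <= \sum_(j <- r | P j) normc (f j).
Proof.
by rewrite -lecR rmorph_sum /= -normcE (le_trans (ler_norm_sum _ _ _)).
Qed.

Lemma cvg_normcP (z : nat -> R[i]) (l : R[i]) :
  ((z : nat -> R[i]^o) @ \oo --> (l : R[i]^o)) <->
  forall e : R, 0 < e -> exists N, forall n, (N <= n)%N -> normc (z n - l) < e.
Proof.
split.
  move=> /cvgrPdist_lt h e e0.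
  have [|N _ hN] := h e%:C; first by rewrite ltcR.
  by exists N => n /hN /=; rewrite normcE ltcR normcB.
move=> h; apply/cvgrPdist_lt => e e0.
have er : (complex.Re e)%:C = e by rewrite RRe_real // gtr0_real.
have [|N hN] := h (complex.Re e); first by rewrite -ltcR er.
by exists N => // n /hN hn; rewrite -er normcE ltcR normcB.
Qed.

Lemma square_summableP (H : hilbert R) (x : nat -> H) :
  square_summable x <-> exists M : R, forall n, \sum_(0 <= k < n) sqn (x k) <= M.
Proof.
have serE n : series (fun n => `|x n| ^+ 2 : R[i]^o) n = (\sum_(0 <= k < n) sqn (x k))%:C.
  rewrite /series /= rmorph_sum /=; apply: eq_bigr => k _; exact: norm2E.
split.
  move=> /cvg_seq_bounded /pinfty_ex_gt0[M M0 hM].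
  exists (complex.Re M) => n; have := hM n I; rewrite /= serE => h.
  have Mr : (complex.Re M)%:C = M.
    by rewrite RRe_real // gtr0_real.
  rewrite -lecR Mr (le_trans _ h) // ger0_norm // ler0c sumr_ge0 // => k _.
  exact: sqn_ge0.
case=> M hM; pose v n := \sum_(0 <= k < n) sqn (x k).
have nd : nondecreasing_seq v.
  by apply/nondecreasing_seqP => n; rewrite /v big_nat_recr //= lerDl sqn_ge0.
have : cvgn v.
  by apply: nondecreasing_is_cvgn => //; exists M => _ [n _ <-]; exact: hM.
move=> /cvg_ex[l /cvgrPdist_lt vl]; apply/cvg_ex; exists (l%:C : R[i]^o).
apply/cvg_normcP => e e0; have [N _ hN] := vl e e0.
exists N => n /hN /=; rewrite serE -rmorphB /= expr0n addr0 sqrtr_sqr.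
by rewrite distrC.
Qed.

End ComplexLimits.

Lemma big_pmap_oapp (V : nmodType) (X Y : Type) (e : X -> option Y) (s : seq X) (F : Y -> V) :
  \sum_(x <- s) oapp F 0 (e x) = \sum_(y <- pmap e s) F y.
Proof.
elim: s => [|x s IH]; first by rewrite !big_nil.
by rewrite big_cons /= IH; case: (e x) => [y|] /=; rewrite ?big_cons ?add0r.
Qed.

Section Enumeration.
Variables (R : realType) (B : eqType) (g : B -> R) (M : R).
Hypothesis g0 : forall b, 0 <= g b.
Hypothesis gM : forall s, uniq s -> \sum_(b <- s) g b <= M.

(** For each m some finite list leaves sums below 1/(m+1) outside it. The union of these lists is
    countable and contains the support of g; [None] fills the gaps of its enumeration. *)
Lemma summable_enum : exists e : nat -> option B,
  (forall N, uniq (pmap e (iota 0 N))) /\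
  forall b, g b != 0 -> exists n, e n = Some b.
Proof.
have ex (m : nat) : exists s : seq B, forall t : seq B, uniq t ->
    (forall b, b \in t -> b \notin s) -> \sum_(b <- t) g b < m.+1%:R^-1.
  by apply: usum_tail gM _ _ => //; rewrite invr_gt0.
have [s hs] := choice ex.
pose D := \bigcup_(m in [set: nat]) [set b | b \in s m].
have : countable D.
  apply: bigcup_countable => [|m _]; first exact: countableP.
  apply: finite_set_countable; exact: finite_seq.
case/countable_injP => f finj.
pose e n := if pselect (exists b, D b /\ f b = n) is left h then Some (projT1 (cid h)) else None.
have eP n b : e n = Some b -> D b /\ f b = n.
  by rewrite /e; case: pselect => // h [<-]; case: cid.
have eD b : D b -> e (f b) = Some b.
  move=> Db; rewrite /e; case: pselect => [h|]; last by case; exists b.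
  case: cid => c [Dc fc] /=; congr Some; apply: finj => //; exact/mem_set.
exists e; split.
  move=> N; have : uniq (iota 0 N) by exact: iota_uniq.
  elim: (iota 0 N) => //= n l IH /andP[nl /IH ul].
  case E : (e n) => [b|] //=; rewrite ul andbT.
  apply: contra nl; rewrite mem_pmap => /mapP[m ml E'].
  by have [_ <-] := eP _ _ E; have [_ ->] := eP _ _ (esym E').
move=> b gb; exists (f b); apply: eD.
apply: contrapT => nD; move/eqP: gb; apply.
apply/eqP; rewrite eq_le g0 andbT; apply/ler_addgt0Pl => d d0; rewrite addr0.
have [m _ hm] := near_infty_natSinv_lt (PosNum d0).
rewrite ltW // (lt_trans _ (hm m (leqnn m))) //=.
have := hs m [:: b] isT; rewrite big_seq1; apply => c; rewrite inE => /eqP ->.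
by apply/negP => bm; apply: nD; exists m.
Qed.

End Enumeration.

Lemma fst_bound (B : eqType) (s : seq (nat * B)) :
  exists N, forall k, k \in s -> (k.1 < N)%N.
Proof.
exists (\max_(k <- s) k.1).+1 => k ks; rewrite ltnS.
exact: (@leq_bigmax_seq _ _ xpredT (fun k : nat * B => k.1) k).
Qed.

(** A finite set of pairs is enlarged to a rectangle, on which Bessel applies row by row. *)
Lemma bessel2 (R : realType) (B : eqType) (H H' : hilbert R)
    (Q : orth_family B H H') (u : nat -> H') (M : R) :
  (forall n, \sum_(0 <= k < n) sqn (u k) <= M) ->
  forall s : seq (nat * B), uniq s -> \sum_(k <- s) sqn (adj (Q k.2) (u k.1)) <= M.
Proof.
move=> uM s us.
have [N hN] := fst_bound s; pose F := undup [seq k.2 | k <- s].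
pose G := [seq (n, b) | n <- iota 0 N, b <- F].
have uG : uniq G.
  by apply: allpairs_uniq; rewrite ?iota_uniq ?undup_uniq // => -[a b] [c d] _ _.
have sG : {subset s <= G}.
  move=> [n b] nb; apply/allpairsP; exists (n, b); split=> //=.
    by rewrite mem_iota add0n /= (hN _ nb).
  by rewrite mem_undup; apply/mapP; exists (n, b).
have := usum_split (fun k => sqn (adj (Q k.2) (u k.1))) sG.
rewrite /usum !undup_id // => h.
apply: le_trans (uM N); rewrite /index_iota subn0.
apply: (@le_trans _ _ (\sum_(k <- G) sqn (adj (Q k.2) (u k.1)))).
  by rewrite h lerDl sumr_ge0 // => k _; exact: sqn_ge0.
rewrite big_allpairs /=; apply: ler_sum => n _.
exact: orth_bessel (undup_uniq _).
Qed.

Lemma normc_inner_le (R : realType) (L : hilbert R) (x y : L) : normc (inner x y) <= sqn x + sqn y.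
Proof.
rewrite -ler_sqr ?nnegrE ?normc_ge0 ?addr_ge0 ?sqn_ge0 // (le_trans (cauchy_schwarz _ _)) //.
have := sqn_ge0 x; have := sqn_ge0 y; move: (sqn x) (sqn y) => a b; nra.
Qed.

(** * Normality of the induced maps *)

Section ThetaNormal.
Variables (R : realType) (B : eqType) (H K H' K' : hilbert R).
Variables (Q : orth_family B H H') (Q' : orth_family B K K').

(** Formally, w(theta x) is the double sum over (n, b) of <d, x c>, where c and d are the images of
    u_n and t_n under the adjoints of Q_b and Q'_b. Bessel makes it absolutely convergent, so its
    nonzero terms can be listed in one sequence without changing the sum. *)
Lemma theta_normal (w : bop H' K' -> R[i]) : normal_functional w ->
  normal_functional (fun x : bop H K => w (theta Q Q' x)).
Proof.
case=> u [t [/square_summableP[Mu hu] /square_summableP[Mt ht] hw]].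
pose c (k : nat * B) := adj (Q k.2) (u k.1); pose d (k : nat * B) := adj (Q' k.2) (t k.1).
pose g k := sqn (c k) + sqn (d k).
have g0 k : 0 <= g k by rewrite addr_ge0 ?sqn_ge0.
have bc := bessel2 Q hu; have bd := bessel2 Q' ht.
have gM s : uniq s -> \sum_(k <- s) g k <= Mu + Mt.
  by move=> us; rewrite big_split lerD ?bc ?bd.
have [e [ue he]] := summable_enum g0 gM.
have psum (L : hilbert R) (f : nat * B -> L) n :
    \sum_(0 <= k < n) sqn (oapp f 0 (e k)) = \sum_(k <- pmap e (iota 0 n)) sqn (f k).
  rewrite -big_pmap_oapp /index_iota subn0; apply: eq_bigr => k _.
  by case: (e k) => //=; rewrite sqn0.
exists (fun j => oapp c 0 (e j)), (fun j => oapp d 0 (e j)); split.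
- by apply/square_summableP; exists Mu => n; rewrite psum bc.
- by apply/square_summableP; exists Mt => n; rewrite psum bd.
move=> x; have [C C0 bx] := bop_bounded x.
pose a k := inner (d k) (x (c k)).
have C1 : 0 < C + 1 by rewrite ltr_wpDl.
have ag k : normc (a k) <= (C + 1) * g k.
  rewrite (le_trans (normc_inner_le _ _)) //.
  have := bx (c k); have := sqn_ge0 (c k); have := sqn_ge0 (d k).
  rewrite /g; move: (sqn (c k)) (sqn (d k)) (sqn (x _)) => p q r; nra.
pose th n := inner (t n) (theta Q Q' x (u n)).
(* Convergence of a single row; strong convergence of [theta x (u n)] is weakened by Cauchy-Schwarz,
   hence the tolerance divided by |t_n|^2 + 1. *)
have hth n (eps : R) : 0 < eps -> exists s0, forall s, seq_sub s0 s ->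
    normc (usum (fun b => a (n, b)) s - th n) < eps.
  move=> e0; have t1 : 0 < sqn (t n) + 1 by rewrite ltr_wpDl ?sqn_ge0.
  have [s0 hs] := thetaP Q Q' x (u n) (divr_gt0 (exprn_gt0 2 e0) t1).
  exists s0 => s /hs; rewrite ltr_pdivlMr // => h.
  rewrite -(ltr_pXn2r (n := 2)) ?nnegrE ?normc_ge0 ?(ltW e0) //.
  apply: le_lt_trans h; rewrite /usum /th.
  have -> : \sum_(b <- undup s) a (n, b) =
      inner (t n) (\sum_(b <- undup s) theta_term Q Q' x (u n) b).
    by rewrite inner_sumr; apply: eq_bigr => b _; rewrite /a /d adjP.
  rewrite -innerBr (le_trans (cauchy_schwarz _ _)) // mulrC ler_wpM2l ?sqn_ge0 //.
  by rewrite lerDl ler01.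
have hthN N (eps : R) : 0 < eps -> exists s0, forall s, seq_sub s0 s ->
    normc (\sum_(n <- iota 0 N) usum (fun b => a (n, b)) s - \sum_(n <- iota 0 N) th n) < eps.
  elim: (iota 0 N) eps => [|n r IH] eps e0.
    exists [::] => s _; rewrite !big_nil subrr /= !expr0n addr0 sqrtr0 //.
  have e2 := divr_gt0 e0 (ltr0n R 2).
  have [s1 h1] := IH _ e2; have [s2 h2] := hth n _ e2.
  exists (s1 ++ s2) => s ss; rewrite !big_cons opprD addrACA (le_lt_trans (normcD _ _)) //.
  rewrite [ltRHS](splitr eps); apply: ltrD; [apply: h2 | apply: h1] => b bs; apply: ss.
    by rewrite mem_cat bs orbT.
  by rewrite mem_cat bs.
apply/cvg_normcP => eps e0.
(* Since |a k| <= (C + 1) g k, this tolerance for g gives eps/4 for a. *)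
have e4 : 0 < eps / (4 * (C + 1)) by rewrite divr_gt0 ?mulr_gt0.
have [s0 hs0] := usum_tail g0 gM e4.
have mem_e k j n : e j = Some k -> (j < n)%N -> k \in pmap e (iota 0 n).
  by move=> ej jn; rewrite mem_pmap; apply/mapP; exists j; rewrite ?mem_iota.
(* Pairs with g k = 0 may never be listed, so only those with g k nonzero are awaited; the others
   contribute nothing. *)
have [J hJ] : exists J, forall n k, (J <= n)%N -> k \in s0 -> g k != 0 -> k \in pmap e (iota 0 n).
  elim: (s0) => [|k r [J hJ]]; first by exists 0%N.
  have [gk|/he[j ej]] := eqVneq (g k) 0.
    exists J => n l Jn; rewrite inE => /orP[/eqP ->|lr]; first by rewrite gk eqxx.
    exact: hJ.
  exists (maxn J j.+1) => n l; rewrite geq_max inE => /andP[Jn jn] /orP[/eqP -> _|lr].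
    exact: mem_e ej jn.
  exact: hJ.
exists J => n Jn.
have -> : series (fun j => inner (oapp d 0 (e j)) (x (oapp c 0 (e j))) : R[i]^o) n =
    \sum_(k <- pmap e (iota 0 n)) a k.
  rewrite -big_pmap_oapp /series /= /index_iota subn0; apply: eq_bigr => j _.
  by case: (e j) => //=; rewrite inner0l.
set E := pmap e (iota 0 n); have uE : uniq E by exact: ue.
have e1 := divr_gt0 e0 (ltr0n R 4).
have /cvg_normcP /(_ _ e1) [N1 hN1] := hw (theta Q Q' x).
have [N2 hN2] := fst_bound E; pose N := maxn N1 N2.
have [s1 hs1] := hthN N _ e1.
(* The rectangle G links the two orders of summation: it contains the listed pairs E, and it has
   enough columns for its N rows to be near their full sums. The three comparisons cost at most
   eps/4 each. *)
pose s := s1 ++ [seq k.2 | k <- E]; pose G := [seq (n, b) | n <- iota 0 N, b <- undup s].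
have uG : uniq G.
  by apply: allpairs_uniq; rewrite ?iota_uniq ?undup_uniq // => -[? ?] [? ?] _ _.
have sG : seq_sub E G.
  move=> [m b] nb; apply/allpairsP; exists (m, b); split=> //=.
    by rewrite mem_iota add0n /= leq_max (hN2 _ nb) orbT.
  by rewrite mem_undup mem_cat orbC; apply/orP; left; apply/mapP; exists (m, b).
have h1 : normc (\sum_(k <- G) a k - \sum_(n <- iota 0 N) th n) < eps / 4.
  rewrite big_allpairs; apply: (hs1 s) => b bs; by rewrite mem_cat bs.
have h2 : normc (\sum_(n <- iota 0 N) th n - w (theta Q Q' x)) < eps / 4.
  have := hN1 N; rewrite /series /= /index_iota subn0; apply; exact: leq_maxl.
have h3 : normc (\sum_(k <- G) a k - \sum_(k <- E) a k) <= eps / 4.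
  have := usum_split a sG; rewrite /usum !undup_id // => ->.
  rewrite addrAC subrr add0r (le_trans (normc_sum _ _ _)) //.
  have : \sum_(k <- G | k \notin E) normc (a k) <= (C + 1) * \sum_(k <- G | k \notin E) g k.
    by rewrite mulr_sumr; apply: ler_sum => k _; exact: ag.
  move/le_trans; apply; rewrite (bigID (fun k => g k == 0)) /= big1 ?add0r; last first.
    by move=> k /andP[_ /eqP].
  rewrite -big_filter; have := hs0 [seq k <- G | (k \notin E) && (g k != 0)].
  rewrite filter_uniq // => /(_ isT) h.
  have -> : eps / 4 = (C + 1) * (eps / (4 * (C + 1))) by field; exact: lt0r_neq0.
  rewrite ler_pM2l // ltW // h // => k; rewrite mem_filter => /andP[/andP[kE gk] _].
  by apply: contra kE => ks; exact: hJ.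
have -> : \sum_(k <- E) a k - w (theta Q Q' x) =
   (\sum_(k <- E) a k - \sum_(k <- G) a k) + ((\sum_(k <- G) a k - \sum_(n <- iota 0 N) th n) +
   (\sum_(n <- iota 0 N) th n - w (theta Q Q' x))) by rewrite !subrKA.
rewrite (le_lt_trans (normcD _ _)) //.
have := normcD (\sum_(k <- G) a k - \sum_(n <- iota 0 N) th n)
  (\sum_(n <- iota 0 N) th n - w (theta Q Q' x)).
rewrite normcB in h3; move: h1 h2 h3 e0.
move: (normc _) (normc _) (normc _) (normc _) => x1 x2 x3 x4; lra.
Qed.

End ThetaNormal.

(** * Matrix norms and weak-* topologies *)

Section MatrixNorm.
Variables (R : realType) (H K : hilbert R).

Lemma mxnorm_sqn (n : nat) (x : 'I_n -> 'I_n -> bop H K) (c : R) (h : 'I_n -> H) :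
  (\sum_p `|\sum_q x p q (h q)| ^+ 2 <= c%:C ^+ 2 * \sum_q `|h q| ^+ 2) =
  (\sum_p sqn (\sum_q x p q (h q)) <= c ^+ 2 * \sum_q sqn (h q)).
Proof.
rewrite -lecR rmorphM rmorphXn /= !rmorph_sum /=.
by congr (_ <= _ * _); apply: eq_bigr => k _; rewrite norm2E.
Qed.

Definition mxbounds (n : nat) (x : 'I_n -> 'I_n -> bop H K) : set R :=
  [set c | 0 <= c /\ forall h, \sum_p sqn (\sum_q x p q (h q)) <= c ^+ 2 * \sum_q sqn (h q)].

Lemma mxnormE (n : nat) (x : 'I_n -> 'I_n -> bop H K) : bop_mxnorm x = inf (mxbounds x).
Proof.
congr inf; apply/seteqP; split=> c [c0 hc]; split=> // h; first by rewrite -mxnorm_sqn.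
by rewrite mxnorm_sqn.
Qed.

Lemma mxbounds_lb (n : nat) (x : 'I_n -> 'I_n -> bop H K) : lbound (mxbounds x) 0.
Proof. by move=> c []. Qed.

Lemma mxbounds_neq0 (n : nat) (x : 'I_n -> 'I_n -> bop H K) : mxbounds x !=set0.
Proof.
have /choice[C hC] : forall pq : 'I_n * 'I_n, exists C : R,
    0 <= C /\ forall v, sqn (x pq.1 pq.2 v) <= C * sqn v.
  by move=> pq; have [C C0 hC] := bop_bounded (x pq.1 pq.2); exists C.
pose S := n%:R * \sum_pq C pq.
have S0 : 0 <= S by rewrite mulr_ge0 // sumr_ge0 // => pq _; case: (hC pq).
exists (Num.sqrt S); split=> [|h]; first exact: sqrtr_ge0.
rewrite sqr_sqrtr //.
have : \sum_p sqn (\sum_q x p q (h q)) <= \sum_p n%:R * \sum_q C (p, q) * sqn (h q).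
  apply: ler_sum => p _; rewrite (le_trans (sqn_sum_le _ _)) //.
  rewrite -[size _]/(size (index_enum _)) /index_enum -enumT size_enum_ord.
  rewrite ler_wpM2l // ler_sum // => q _.
  by case: (hC (p, q)).
move/le_trans; apply; rewrite -mulr_sumr -mulrA ler_wpM2l //.
rewrite pair_big /= mulr_suml; apply: ler_sum => -[p q] _ /=.
rewrite ler_wpM2l //; first by case: (hC (p, q)).
by rewrite (bigD1 q) //= lerDl sumr_ge0 // => *; exact: sqn_ge0.
Qed.

Lemma mxnorm_le (n : nat) (x : 'I_n -> 'I_n -> bop H K) (c : R) : 0 <= c ->
  (forall h, \sum_p sqn (\sum_q x p q (h q)) <= c ^+ 2 * \sum_q sqn (h q)) ->
  bop_mxnorm x <= c.
Proof.
move=> c0 hc; rewrite mxnormE; apply: ge_inf; first by exists 0; exact: mxbounds_lb.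
by split.
Qed.

Lemma mxnorm_ge0 (n : nat) (x : 'I_n -> 'I_n -> bop H K) : 0 <= bop_mxnorm x.
Proof. by rewrite mxnormE lb_le_inf //; [exact: mxbounds_neq0 | exact: mxbounds_lb]. Qed.

(** The infimum defining the matrix norm is attained. *)
Lemma mxnorm_bound (n : nat) (x : 'I_n -> 'I_n -> bop H K) h :
  \sum_p sqn (\sum_q x p q (h q)) <= bop_mxnorm x ^+ 2 * \sum_q sqn (h q).
Proof.
have S0 : 0 <= \sum_q sqn (h q) by rewrite sumr_ge0 // => q _; exact: sqn_ge0.
set T := \sum_p _; set S := \sum_q _ in S0 *; set m := bop_mxnorm x.
have m0 : 0 <= m by exact: mxnorm_ge0.
have key e : 0 < e -> e < 1 -> T <= (m + e) ^+ 2 * S.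
  move=> e0 e1; have hi : has_inf (mxbounds x).
    by split; [exact: mxbounds_neq0 | exists 0; exact: mxbounds_lb].
  have [c [c0 hc]] := inf_adherent e0 hi; rewrite -mxnormE -/m => cm.
  have me : 0 <= m + e by rewrite addr_ge0 // (ltW e0).
  by rewrite (le_trans (hc h)) // ler_wpM2r // ler_sqr ?nnegrE // (ltW cm).
apply/ler_addgt0Pl => e e0.
have d0 : 0 < (2 * m + 1) * S + 1 by rewrite ltr_wpDl // mulr_ge0 // addr_ge0 // mulr_ge0.
(* As d < 1, (m + d)^2 <= m^2 + d (2m + 1), and the second bound on d makes the excess, multiplied
   by S, at most e. *)
pose d := Num.min (2^-1) (e / ((2 * m + 1) * S + 1)).
have dp : 0 < d by rewrite lt_min invr_gt0 ltr0n divr_gt0.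
have d1 : d < 1 by rewrite gt_min invf_lt1 ?ltr1n.
have de : d * ((2 * m + 1) * S + 1) <= e by rewrite -ler_pdivlMr // ge_min lexx orbT.
rewrite (le_trans (key d dp d1)) //.
have : d * S * (1 - d) >= 0 by rewrite mulr_ge0 ?subr_ge0 ?mulr_ge0 // ltW.
move: de; nra.
Qed.

End MatrixNorm.

Lemma theta_mxnorm (R : realType) (B : eqType) (H K H' K' : hilbert R)
    (Q : orth_family B H H') (Q' : orth_family B K K') n (x : 'I_n -> 'I_n -> bop H K) :
  bop_mxnorm (fun p q => theta Q Q' (x p q)) <= bop_mxnorm x.
Proof.
apply: mxnorm_le; first exact: mxnorm_ge0.
by apply: theta_cc; [rewrite sqr_ge0 | exact: mxnorm_bound].
Qed.

Section WeakStar.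
Variable R : realType.
Implicit Types E F : dual_opspace R.

Lemma weakstar_functional E (w : E -> R[i]) : os_predual E w ->
  continuous (w : weakstar E -> R[i]^o).
Proof.
move=> hw; pose i : os_predual E := SigSub (mem_set hw).
pose f : weakstar E -> prod_topology (fun _ : os_predual E => R[i]^o) :=
  fun x v => val v x.
have cf : continuous f by exact: initial_continuous.
move=> x; apply: (@continuous_comp _ _ _ f (fun g => g i)); first exact: cf.
apply: (@proj_continuous (os_predual E) (fun=> R[i]^o) i).
Qed.

Lemma weakstar_continuous (T : topologicalType) F (f : T -> F) :
  (forall w, os_predual F w -> continuous (fun t => w (f t) : R[i]^o)) ->
  continuous (f : T -> weakstar F).
Proof.
move=> h; apply: continuous_comp_initial => x; apply/cvg_sup => i.
move: x; apply/(@continuousP _ (initial_topology (@^~ i))) => A [B oB <-].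
have /continuousP := h (val i) (set_mem (valP i)).
exact.
Qed.

Lemma wclosure_map E F (f : E -> F) (A : set E) (B : set F) :
  continuous (f : weakstar E -> weakstar F) ->
  (forall x, A x -> wclosure B (f x)) -> forall x, wclosure A x -> wclosure B (f x).
Proof.
move=> cf AB x Ax.
have cB : closed (wclosure B : set (weakstar F)) by exact: closed_closure.
have : closed ((f : weakstar E -> weakstar F) @^-1` (wclosure B)).
  by apply: preimage_closed => // ? ?; exact: cf.
move=> /closure_id cl.
suff : ((f : weakstar E -> weakstar F) @^-1` (wclosure B)) x by [].
by rewrite cl; apply: closure_subset Ax => y; exact: AB.
Qed.

(** Operator identities will be tested on one scalar functional at a time; the set where f - g
    vanishes is closed. *)
Lemma wclosure_eq E (f g : weakstar E -> R[i]^o) (A : set E) x :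
  continuous f -> continuous g ->
  (forall y, A y -> f y = g y) -> wclosure A x -> f x = g x.
Proof.
move=> cf cg fg Ax; apply/eqP; rewrite -subr_eq0; apply/eqP.
have cfg : continuous (fun y : weakstar E => f y - g y : R[i]^o).
  move=> y; by apply: cvgB; [exact: (@nbhs_filter (weakstar E)) | exact: cf | exact: cg].
have cl : closed ((fun y => f y - g y : R[i]^o) @^-1` [set 0]).
  apply: preimage_closed; last first.
    exact: (accessible_closed_set1 (hausdorff_accessible (@norm_hausdorff _ _))).
  by move=> y _; exact: cfg.
move: cl => /closure_id cl.
suff : ((fun y => f y - g y : R[i]^o) @^-1` [set 0]) x by [].
by rewrite cl; apply: closure_subset Ax => y Ay /=; rewrite fg // subrr.
Qed.

End WeakStar.

(** * Orthonormal complements *)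

Section OrthonormalBasis.
Variables (R : realType) (H : hilbert R).

Lemma total_span_orth (xi : H) (E : set H) : total_set (xi |` E) ->
  (forall x, E x -> inner xi x = 0) ->
  forall h, inner xi h = 0 -> cspan E h.
Proof.
move=> tE Exi h hxi; have [p Cp hp] := projection E h.
suff -> : h = p by [].
apply/eqP; rewrite -subr_eq0; apply/eqP/(total_inner_eq0 tE) => a [->|Ea]; last exact: hp.
by rewrite innerBr hxi (cspan_orth Exi Cp) subrr.
Qed.

Lemma orthonormal_complement (xi : H) : exists E : set H,
  [/\ forall x, E x -> inner xi x = 0,
      forall x, E x -> inner x x = 1,
      forall x y, E x -> E y -> x != y -> inner x y = 0 &
      forall h, inner xi h = 0 -> cspan E h].
Proof.
pose P (E : set H) := [/\ forall x, E x -> inner xi x = 0,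
      forall x, E x -> inner x x = 1 &
      forall x y, E x -> E y -> x != y -> inner x y = 0].
have [|E [[E1 E2 E3] Emax]] := @Zorn_bigcup H P.
  move=> F FP tF; split.
  - by move=> x [X /FP[+ _ _] Xx]; exact.
  - by move=> x [X /FP[_ + _] Xx]; exact.
  - move=> x y [X FX Xx] [Y FY Yy].
    have [XY|YX] := tF X Y FX FY.
      by have [_ _] := FP _ FY; apply=> //; exact: XY.
    by have [_ _] := FP _ FX; apply=> //; exact: YX.
exists E; split=> //; apply: total_span_orth => //.
(* A nonzero z orthogonal to xi and to the maximal set could be normalized and added to it. *)
apply: total_orth => z hz; apply: contrapT => z0.
have s0 : 0 < sqn z.
  by rewrite lt_neqAle sqn_ge0 andbT eq_sym; apply/eqP => /sqn_eq0.
pose e := (Num.sqrt (sqn z)^-1)%:C *: z.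
have ee : inner e e = 1.
  by rewrite -sqnE sqn_sqrtZ ?invr_ge0 ?sqn_ge0 // mulVf // lt0r_neq0.
have Ee a : E a -> inner a e = 0 by move=> Ea; rewrite innerZr hz ?mulr0 //; right.
have nE : ~ E e by move=> /Ee; rewrite ee => /eqP; rewrite oner_eq0.
apply: (Emax (e |` E)).
  by split; [move=> x; right | move=> h; apply: nE; apply: h; left].
split.
- by move=> x [->|/E1 //]; rewrite innerZr hz ?mulr0 //; left.
- by move=> x [->|/E2 //].
- move=> x y [->|Ex] [->|Ey]; rewrite ?eqxx // => xy.
  + by rewrite innerC Ee // rmorph0.
  + exact: Ee.
  + exact: E3.
Qed.

End OrthonormalBasis.

Section ScaledIsometry.
Variables (R : realType) (H K : hilbert R).

(* [G] multiplies inner products by a constant on the range of the projection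
   [p], so that [G \o p] is linear even though [G] may be arbitrary elsewhere. *)
Lemma scaled_isometry (p : bop H H) (G : H -> K) (c : R[i]) :
  (forall x y, inner (G (p x)) (G (p y)) = c * inner (p x) (p y)) ->
  exists T : bop H K, forall x, T x = G (p x).
Proof.
move=> hG; have [C C0 bp] := bop_bounded p.
(* The defect of additivity and homogeneity is orthogonal to every [G (p z)]; being itself a
   combination of such vectors, it vanishes. *)
have key z a x y :
    inner (G (p z)) (G (p (a *: x + y)) - (a *: G (p x) + G (p y))) = 0.
  rewrite innerBr innerDr innerZr !hG bopDr bopZr innerDr innerZr; ring.
apply: (@mkbop _ _ _ (fun x => G (p x)) (`|complex.Re c| * C)).
- move=> a x y; apply/eqP; rewrite -subr_eq0; apply/eqP/sqn_eq0.
  rewrite /sqn; set w := _ - _.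
  rewrite {1}/w innerBl innerDl innerZl /w !key; simpc; by rewrite ?(mulr0, addr0, oppr0, subrr).
- move=> x; have e : sqn (G (p x)) = complex.Re c * sqn (p x).
    by rewrite /sqn hG -sqnE; case: (c) => u v /=; rewrite mulr0 subr0.
  rewrite e -mulrA (le_trans (ler_wpM2r (sqn_ge0 _) (ler_norm (complex.Re c)))) //.
  by rewrite ler_wpM2l.
Qed.

End ScaledIsometry.

Lemma adjK (R : realType) (H K : hilbert R) (T : bop H K) : adj (adj T) = T.
Proof. by apply: adj_uniq => x y; rewrite adjPr. Qed.

Lemma inner_total0 (R : realType) (H1 H2 K : hilbert R) (S : bop H1 K) (T : bop H2 K)
    (A1 : set H1) (A2 : set H2) : total_set A1 -> total_set A2 ->
  (forall a b, A1 a -> A2 b -> inner (S a) (T b) = 0) ->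
  forall v w, inner (S v) (T w) = 0.
Proof.
move=> t1 t2 h v w; rewrite -adjP.
have -> : adj T (S v) = bcomp (adj T) S v by [].
rewrite (total_eq (S := bcomp (adj T) S) (T := 0) t1) ?bop0E ?inner0l // => a Aa.
apply: (adj_eq0 t2) => b Bb; rewrite innerC [inner _ _](h a b) ?rmorph0 //.
Qed.

(** * GNS spaces and letters *)

Section GNS.
Variables (R : realType) (N : nc_space R).
Local Notation H := (nc_L2 N).
Local Notation M := (nc_alg N).
Local Notation xi := (nc_xi N).
Local Notation pi := (nc_rep N).

Lemma vn_set0 : vn_set M 0.
Proof.
have := vn_lin (-1) (vn1 M) (vn1 M).
by rewrite scaleN1r addNr.
Qed.

Lemma rep0 : pi 0 = 0.
Proof.
have := gns_lin (nc_gns N) (-1) (vn1 M) (vn1 M).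
by rewrite !scaleN1r !addNr.
Qed.

Lemma cyclic_total : total_set [set pi T xi | T in vn_set M].
Proof.
apply/seteqP; split=> // x _.
suff : closure [set pi T xi | T in vn_set M] x.
  by apply: closure_subset; exact: lspan_incl.
by rewrite gns_cyclic.
Qed.

Lemma rep1 : pi bid = bid.
Proof.
apply: (total_eq cyclic_total) => _ [T MT <-].
have <- : bcomp bid T = T by apply: bop_ext.
by rewrite {1}(_ : bcomp bid T = T) ?(gnsM (nc_gns N) (vn1 M) MT); last exact: bop_ext.
Qed.

Lemma inner_xi : inner xi xi = 1.
Proof.
by have := gns_state (nc_gns N) (vn1 M); rewrite rep1 (ns1 (nc_normal N)) => <-.
Qed.

Definition centered (x : H) : H := x - inner xi x *: xi.

Lemma inner_xi_centered x : inner xi (centered x) = 0.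
Proof. by rewrite innerBr innerZr inner_xi mulr1 subrr. Qed.

Lemma centered_id x : inner xi x = 0 -> centered x = x.
Proof. by move=> e; rewrite /centered e scale0r subr0. Qed.

Lemma centered_xi : centered xi = 0.
Proof. by rewrite /centered inner_xi scale1r subrr. Qed.

Lemma sqn_xi : sqn xi = 1.
Proof. by rewrite /sqn inner_xi. Qed.

Lemma sqn_centered x : sqn x = sqn (centered x) + normc (inner xi x) ^+ 2.
Proof.
rewrite -{1}[x](subrK (inner xi x *: xi)) -/(centered x) sqnD_orth.
  by rewrite sqnZ sqn_xi mulr1.
by rewrite innerZr (innerC (centered x)) inner_xi_centered rmorph0 mulr0.
Qed.

Lemma centering : exists p : bop H H, forall x, p x = centered x.
Proof.
apply: (@mkbop _ _ _ centered 1) => [a x y|x].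
  rewrite /centered innerDr innerZr scalerDl -scalerA scalerBr opprD addrACA.
  by [].
by rewrite mul1r [leRHS]sqn_centered lerDl sqr_ge0.
Qed.

(** Since phi(ab) is the inner product of the vectors of the adjoint of a and of b, this S turns
    scalar contractions into inner products with centered letters. *)
Lemma star_exists (T : nc_bop N) : vn_set M T -> nc_state T = 0 ->
  exists S, [/\ vn_set M S, nc_state S = 0 &
    forall x, inner (pi S xi) x = inner xi (pi T x)].
Proof.
move=> MT T0; have [S MS ST] := vn_adj MT.
have e x : inner (pi S xi) x = inner xi (pi T x).
  exact: esym (@gns_adj _ _ _ (nc_gns N) S T MS MT ST xi x).
exists S; split=> //.
by rewrite (gns_state (nc_gns N) MS) innerC e -(gns_state (nc_gns N) MT) T0 rmorph0.
Qed.

(** Projecting the vector of T off xi gives the vector of T - phi(T) 1, which is centered. *)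
Lemma hat_dense h : inner xi h = 0 ->
  cspan [set pi T xi | T in [set T | vn_set M T /\ nc_state T = 0]] h.
Proof.
move=> hxi; have [p hp] := centering.
rewrite -(centered_id hxi) -hp.
have : cspan [set pi T xi | T in vn_set M] h by rewrite /cspan cyclic_total.
apply: cspan_map => _ [T MT <-]; apply: cspan_sub.
exists (- nc_state T *: bid + T).
  split; first exact: vn_lin (vn1 M) MT.
  by rewrite (ns_lin (nc_normal N) _ (vn1 M) MT) (ns1 (nc_normal N)) mulr1 addNr.
rewrite (gns_lin (nc_gns N) _ (vn1 M) MT) rep1 bopDE bopZE hp /centered.
by rewrite (gns_state (nc_gns N) MT) scaleNr addrC.
Qed.

End GNS.

Section Letters.
Variables (R : realType) (I : eqType) (A : I -> nc_space R).
Local Notation HL h := (Tagged (fun i => nc_L2 (A i)) h).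
Implicit Types (u v w : seq (hletter A)) (x y : hletter A).

Lemma tagged_innerE i (h k : nc_L2 (A i)) : tagged_inner (HL h) (HL k) = inner h k.
Proof. by rewrite /tagged_inner /= eqxx tagged_asE. Qed.

Lemma tagged_inner_neq x y : tag x != tag y -> tagged_inner x y = 0.
Proof. by rewrite /tagged_inner => /negbTE ->. Qed.

Lemma tagged_innerC x y : tagged_inner x y = (tagged_inner y x)^*%R.
Proof.
case: x => i h; case: y => j k; have [e|ij] := eqVneq i j.
  by case: j / e k => k; rewrite !tagged_innerE innerC.
by rewrite !tagged_inner_neq ?rmorph0 //= eq_sym.
Qed.

(** The last factor of [LS n] is a full H_i; ring letters together with vacuum letters span it. *)
Definition vacuum_letter x : Prop := tagged x = nc_xi (A (tag x)).

Lemma tagged_inner_vacuum x y : in_Hring x -> vacuum_letter y -> tagged_inner x y = 0.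
Proof.
case: x => i h; case: y => j k /= hx; rewrite /vacuum_letter /= => ->.
have [e|ij] := eqVneq i j; last exact: tagged_inner_neq.
by case: j / e k => _ /=; rewrite tagged_innerE innerC hx rmorph0.
Qed.

(** The common inner product of words of equal length in F and in the powers of L; maps between
    these spaces are isometric because of it. *)
Definition winner u v : R[i] := \prod_(p <- zip u v) tagged_inner p.1 p.2.

Lemma winner_cons x y u v : winner (x :: u) (y :: v) = tagged_inner x y * winner u v.
Proof. by rewrite /winner big_cons. Qed.

Lemma winner_nil : winner [::] [::] = 1.
Proof. by rewrite /winner big_nil. Qed.

Lemma winner_cat u1 u2 v1 v2 : size u1 = size v1 ->
  winner (u1 ++ u2) (v1 ++ v2) = winner u1 v1 * winner u2 v2.
Proof. by move=> s; rewrite /winner zip_cat // big_cat. Qed.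

Lemma winner_tags u v : size u = size v -> winner u v != 0 -> map tag u = map tag v.
Proof.
elim: u v => [|x u IH] [|y v] //= [s]; rewrite winner_cons mulf_eq0 negb_or => /andP[xy uv].
congr (_ :: _); last exact: IH.
by apply/eqP; apply: contraNT xy => xy; rewrite tagged_inner_neq.
Qed.

Lemma reducedE w : reduced w = sorted (fun i j => i != j) (map tag w).
Proof. by rewrite sorted_map. Qed.

Definition ringw w : Prop := forall x, x \in w -> in_Hring x.

Lemma ringw_cons x w : ringw (x :: w) <-> in_Hring x /\ ringw w.
Proof.
split=> [h|[hx hw] y]; last by rewrite inE => /orP[/eqP -> //|/hw].
by split=> [|y yw]; apply: h; rewrite inE ?eqxx ?yw ?orbT.
Qed.

Lemma ringw_cat u v : ringw (u ++ v) <-> ringw u /\ ringw v.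
Proof.
split=> [h|[hu hv] y]; last by rewrite mem_cat => /orP[/hu|/hv].
by split=> y yw; apply: h; rewrite mem_cat yw ?orbT.
Qed.

Lemma reduced_catl u v : reduced (u ++ v) -> reduced u.
Proof. by rewrite /reduced => /cat_sorted2[]. Qed.

Lemma reduced_catr u v : reduced (u ++ v) -> reduced v.
Proof. by rewrite /reduced => /cat_sorted2[]. Qed.

(** E is the union over i of orthonormal bases of the complements of xi_i; reduced words over E are
    then orthonormal in F. *)
Lemma letter_basis : exists E : set (hletter A),
  [/\ forall x, E x -> in_Hring x,
      forall x y, E x -> E y -> tagged_inner x y = (x == y)%:R &
      forall x, in_Hring x -> cspan [set h | E (HL h)] (tagged x)].
Proof.
have ex (i : I) := orthonormal_complement (nc_xi (A i)).
pose E i := projT1 (cid (ex i)).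
have EP i := projT2 (cid (ex i)).
exists [set x : hletter A | E (tag x) (tagged x)]; split.
- by move=> [i h] /=; case: (EP i) => h1 _ _ _; exact: h1.
- move=> [i h] [j k] /= Eh Ek; have [e|ij] := eqVneq i j; last first.
    rewrite tagged_inner_neq // (_ : _ == _ = false) //.
    by apply: contraNF ij => /eqP /(congr1 tag) /= ->.
  case: j / e k Ek => k Ek; rewrite tagged_innerE eq_Tagged /=.
  case: (EP i) => _ h2 h3 _.
  by have [->|hk] := eqVneq h k; [exact: h2 | exact: h3].
- by move=> [i h] /= hx; case: (EP i) => _ _ _; apply.
Qed.

End Letters.

(** * Words and total sets *)

Section Words.
Variables (R : realType) (I : eqType) (A : I -> nc_space R) (W : free_spaces A).
Local Notation L := (fs_L W).
Local Notation Lp := (fs_pow W).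
Local Notation S := (fs_S W).
Local Notation LS := (fs_powS W).
Local Notation F := (fs_F W).
Local Notation HL h := (Tagged (fun i => nc_L2 (A i)) h).
Implicit Types (u v w : seq (hletter A)) (x y : hletter A).

Definition fk w : F := fk_vec F w.
Definition Lw n u : Lp n := hp_tens (Lp n) (map (hs_in L) u).
Definition LSw n v x : LS n := ht_tens (LS n) (Lw n v) (hs_in S x).

Lemma inner_fk u v : Hword u -> Hword v -> size u = size v ->
  inner (fk u) (fk v) = winner u v.
Proof. by move=> hu hv s; rewrite /fk fk_inner // s eqxx. Qed.

Lemma inner_fk_size u v : Hword u -> Hword v -> size u != size v ->
  inner (fk u) (fk v) = 0.
Proof. by move=> hu hv s; rewrite /fk fk_inner // (negbTE s). Qed.

Lemma inner_Lw n u v : ringw u -> ringw v -> size u = n -> size v = n ->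
  inner (Lw n u) (Lw n v) = winner u v.
Proof.
move=> hu hv su sv; rewrite /Lw hp_inner ?size_map //.
have {su sv} : size u = size v by rewrite su sv.
elim: u v hu hv => [|x u IH] [|y v] //=; first by rewrite /winner !big_nil.
move=> /ringw_cons[hx hu] /ringw_cons[hy hv] [s].
by rewrite big_cons winner_cons IH //= hs_inner.
Qed.

Lemma inner_LSw n u v x y : ringw u -> ringw v -> size u = n -> size v = n ->
  inner (LSw n u x) (LSw n v y) = winner u v * tagged_inner x y.
Proof. by move=> hu hv su sv; rewrite /LSw ht_inner inner_Lw // hs_inner. Qed.

(** Words are specified only through their inner products; this recovers linearity and boundedness
    in one letter, centering the argument so that it is defined on all of H_i. *)
Lemma fk_insert i (p q : seq (hletter A)) :
  (forall h : nc_L2 (A i), inner (nc_xi (A i)) h = 0 -> Hword (p ++ HL h :: q)) ->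
  exists T : bop (nc_L2 (A i)) F, forall h, T h = fk (p ++ HL (centered h) :: q).
Proof.
move=> hw; have [P hP] := centering (A i).
have [|T hT] := @scaled_isometry _ _ F P (fun h => fk (p ++ HL h :: q)) (winner p p * winner q q).
  move=> x y; rewrite inner_fk ?size_cat //; try by apply: hw; rewrite hP inner_xi_centered.
  by rewrite winner_cat // winner_cons tagged_innerE mulrA mulrAC.
by exists T => h; rewrite hT hP.
Qed.

Lemma Lp_insert n (s t : seq L) : (size s + size t).+1%N = n ->
  exists T : bop L (Lp n), forall z, T z = hp_tens (Lp n) (s ++ z :: t).
Proof.
move=> sn; apply: (@scaled_isometry _ _ _ bid (fun z => hp_tens (Lp n) (s ++ z :: t))
  (\prod_(p <- zip s s) inner p.1 p.2 * \prod_(p <- zip t t) inner p.1 p.2)) => x y.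
rewrite hp_inner ?size_cat /= ?addnS //.
by rewrite zip_cat //= big_cat big_cons /= mulrA mulrAC.
Qed.

Lemma L_insert i : exists T : bop (nc_L2 (A i)) L, forall h, T h = hs_in L (HL (centered h)).
Proof.
have [P hP] := centering (A i).
have [|T hT] := @scaled_isometry _ _ L P (fun h => hs_in L (HL h)) 1.
  move=> x y; rewrite hs_inner ?tagged_innerE ?mul1r //.
    by rewrite /in_Hring /= hP inner_xi_centered.
  by rewrite /in_Hring /= hP inner_xi_centered.
by exists T => h; rewrite hT hP.
Qed.

Lemma S_insert i : exists T : bop (nc_L2 (A i)) S, forall h, T h = hs_in S (HL h).
Proof.
apply: (@scaled_isometry _ _ _ bid (fun h => hs_in S (HL h)) 1) => x y.
by rewrite hs_inner // tagged_innerE mul1r.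
Qed.

Lemma LS_insertl n (s : S) : exists T : bop (Lp n) (LS n), forall z, T z = ht_tens (LS n) z s.
Proof.
apply: (@scaled_isometry _ _ _ bid (fun z => ht_tens (LS n) z s) (inner s s)) => x y.
by rewrite ht_inner mulrC.
Qed.

Lemma LS_insertr n (t : Lp n) : exists T : bop S (LS n), forall z, T z = ht_tens (LS n) t z.
Proof.
apply: (@scaled_isometry _ _ _ bid (fun z => ht_tens (LS n) t z) (inner t t)) => x y.
by rewrite ht_inner.
Qed.

Section Density.
Variable X : set (hletter A).
Hypothesis Xring : forall x, X x -> in_Hring x.
Hypothesis Xdense : forall x, in_Hring x -> cspan [set h | X (HL h)] (tagged x).

Definition inw w : Prop := forall x, x \in w -> X x.

(* Properties of words that pass to closed spans of letters, one position at a
   time, need only be checked on words with letters in X. *)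
Lemma word_density (Q : seq (hletter A) -> Prop) :
  (forall w, Hword w -> inw w -> Q w) ->
  (forall p q i (h : nc_L2 (A i)), inner (nc_xi (A i)) h = 0 ->
     (forall k : nc_L2 (A i), inner (nc_xi (A i)) k = 0 -> Hword (p ++ HL k :: q)) ->
     (forall k : nc_L2 (A i), X (HL k) -> Q (p ++ HL k :: q)) -> Q (p ++ HL h :: q)) ->
  forall w, Hword w -> Q w.
Proof.
(* Induction on the prefix p of arbitrary letters: its last letter is replaced by letters of X,
   which then join the suffix q. *)
move=> Q0 Q1; suff h p q : Hword (p ++ q) -> inw q -> Q (p ++ q).
  by move=> w hw; have := h w [::]; rewrite cats0; apply.
elim/last_ind: p q => [|p [i h] IH] q; first exact: Q0.
rewrite cat_rcons => hw hq; apply: Q1.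
- by case: hw => _ /ringw_cat[_ /ringw_cons[]].
- move=> k hk; case: hw => rw /ringw_cat[hp /ringw_cons[_ hq']]; split.
    by move: rw; rewrite !reducedE !map_cat.
  by apply/ringw_cat; split=> //; apply/ringw_cons; split.
- move=> k hk; apply: IH; last first.
    by move=> x; rewrite inE => /orP[/eqP -> //|/hq].
  case: hw => rw /ringw_cat[hp /ringw_cons[_ hq']]; split.
    by move: rw; rewrite !reducedE !map_cat.
  by apply/ringw_cat; split=> //; apply/ringw_cons; split=> //; exact: Xring.
Qed.

Lemma fk_total_in : total_set [set fk w | w in [set w | Hword w /\ inw w]].
Proof.
apply: (total_sub (fk_total F)) => _ [w hw <-].
rewrite -[fk_vec F w]/(fk w); move: w hw; apply: word_density.
  by move=> w hw Xw; apply: cspan_sub; exists w.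
move=> p q i h hh hw hQ; have [T hT] := fk_insert hw.
rewrite -(centered_id hh) -hT.
apply: (cspan_map _ (Xdense (x := HL h) hh)) => k Xk.
by rewrite hT centered_id; [exact: hQ | exact: (Xring Xk)].
Qed.

Lemma Lw_total_in n : total_set [set Lw n u | u in [set u | size u = n /\ inw u]].
Proof.
apply: (total_sub (hp_total (Lp n))) => _ [s sn <-].
suff h u : (size u + size s)%N = n -> inw u ->
    cspan [set Lw n u | u in [set u | size u = n /\ inw u]] (hp_tens (Lp n) (map (hs_in L) u ++ s)).
  exact: (h [::]).
elim: s {sn} u => [|t s IH] u sn Xu.
  have su : size u = n by move: sn; rewrite /= addn0.
  by apply: cspan_sub; exists u; rewrite ?cats0.
have [|T hT] := @Lp_insert n (map (hs_in L) u) s; first by rewrite size_map -addnS.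
rewrite -hT; have tl : cspan [set hs_in L x | x in @in_Hring R I A] t by rewrite /cspan hs_total.
apply: cspan_map tl => _ [[i h] hh <-].
have [P hP] := L_insert i.
rewrite -(centered_id (x := h) hh) -hP -[T _]/((bcomp T P) h).
apply: (cspan_map _ (Xdense (x := HL h) hh)) => k Xk.
rewrite /= hP centered_id; last exact: (Xring Xk).
rewrite hT -cat_rcons -map_rcons; apply: IH; first by rewrite size_rcons addSnnS.
by move=> x; rewrite mem_rcons inE => /orP[/eqP -> //|/Xu].
Qed.

End Density.

Lemma ring_dense x : in_Hring x -> cspan [set h | in_Hring (HL h)] (tagged x).
Proof. by case: x => i h hx; apply: cspan_sub. Qed.

Lemma Lw_total n : total_set [set Lw n u | u in [set u | size u = n /\ ringw u]].
Proof. exact (@Lw_total_in (@in_Hring R I A) (fun x h => h) ring_dense n). Qed.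

Lemma LSw_total n : total_set
  [set LSw n p.1 p.2 | p in [set p : seq (hletter A) * hletter A |
     [/\ size p.1 = n, ringw p.1 & in_Hring p.2 \/ vacuum_letter p.2]]].
Proof.
apply: (total_sub (ht_total (LS n))) => _ [[t s] _ <-] /=.
have [T1 hT1] := LS_insertl n s; rewrite -hT1.
have : cspan [set Lw n u | u in [set u | size u = n /\ ringw u]] t by rewrite /cspan Lw_total.
apply: cspan_map => _ [u [su hu] <-]; rewrite hT1.
have [T2 hT2] := LS_insertr (Lw n u); rewrite -hT2.
have : cspan [set hs_in S x | x in [set: hletter A]] s by rewrite /cspan hs_total.
apply: cspan_map => _ [[i h] _ <-].
have [P hP] := S_insert i; rewrite -hP -[T2 _]/((bcomp T2 P) h).
rewrite -[h](subrK (inner (nc_xi (A i)) h *: nc_xi (A i))) bopDr bopZr.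
apply: cspan_add; last (apply: cspan_scale); apply: cspan_sub.
  exists (u, HL (centered h)); last by rewrite /= hP hT2.
  by split=> //; left; rewrite /in_Hring /= inner_xi_centered.
exists (u, HL (nc_xi (A i))); last by rewrite /= hP hT2.
by split=> //; right.
Qed.

End Words.

(** * The left action *)

Lemma bcompE (R : realType) (H K L : hilbert R) (S : bop K L) (T : bop H K) x :
  bcomp S T x = S (T x).
Proof. by []. Qed.

Lemma rank_one (R : realType) (H K : hilbert R) (z : H) (y : K) :
  exists T : bop H K, forall x, T x = inner z x *: y.
Proof.
apply: (@mkbop _ _ _ _ (sqn z * sqn y)) => [a u v|x].
  by rewrite innerDr innerZr scalerDl scalerA.
by rewrite sqnZ [leRHS]mulrAC ler_wpM2r ?sqn_ge0 // cauchy_schwarz.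
Qed.

Section OrthFamilies.
Variables (R : realType) (B : eqType) (H K : hilbert R) (Q : orth_family B H K).

Lemma adj_ofam_orth b c v : c != b -> adj (Q c) (Q b v) = 0.
Proof. by move=> cb; apply: inner_eq0 => z; rewrite adjPr ofam_orth. Qed.

Lemma adj_isometry (T : bop H K) : (forall x y, inner (T x) (T y) = inner x y) ->
  forall v, adj T (T v) = v.
Proof. by move=> hT v; apply: inner_inj => z; rewrite adjPr hT. Qed.

End OrthFamilies.

Section LeftAction.
Variables (R : realType) (I : eqType) (A : I -> nc_space R) (W : free_spaces A).
Local Notation F := (fs_F W).
Local Notation fk := (@fk R I A W).
Local Notation HL h := (Tagged (fun i => nc_L2 (A i)) h).
Local Notation xi i := (nc_xi (A i)).
Implicit Types (u v w : seq (hletter A)) (x y : hletter A).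

Definition startok (i : I) w : bool := if w is x :: _ then tag x != i else true.

Lemma reduced_cons x w : reduced (x :: w) = startok (tag x) w && reduced w.
Proof. by case: w => //= y w; rewrite eq_sym. Qed.

Lemma Hword_cons x w :
  Hword (x :: w) <-> [/\ in_Hring x, startok (tag x) w & Hword w].
Proof.
split; first by case; rewrite reduced_cons => /andP[h1 h2] /ringw_cons[h3 h4].
by case=> h1 h2 [h3 h4]; split; [rewrite reduced_cons h2 h3 | apply/ringw_cons].
Qed.

Lemma fk_zero i w : Hword (HL (0 : nc_L2 (A i)) :: w) -> fk (HL (0 : nc_L2 (A i)) :: w) = 0.
Proof.
move=> hw; apply: sqn_eq0.
by rewrite /sqn inner_fk // winner_cons tagged_innerE inner0r mul0r.
Qed.

(* The image of h (x) w under H_i (x) F(i) -> F, where F(i) is spanned by the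
   words that do not begin with a letter of index i. *)
Definition prepend i w (h : nc_L2 (A i)) : F :=
  fk (HL (centered h) :: w) + inner (xi i) h *: fk w.

Lemma Hword_centered i w (h : nc_L2 (A i)) : Hword w -> startok i w ->
  Hword (HL (centered h) :: w).
Proof. by move=> hw iw; apply/Hword_cons; split=> //; exact: inner_xi_centered. Qed.

Lemma prepend_bop i w : Hword w -> startok i w ->
  exists T : bop (nc_L2 (A i)) F, forall h, T h = prepend w h.
Proof.
move=> hw iw; have [|T1 hT1] := @fk_insert R I A W i [::] w.
  by move=> h hh; apply/Hword_cons; split.
have [T2 hT2] := rank_one (xi i) (fk w).
by exists (T1 + T2) => h; rewrite bopDE hT1 hT2.
Qed.

(** The cross terms vanish because a word beginning in index i is orthogonal to every word that does
    not; this makes H_i (x) F(i) -> F isometric. *)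
Lemma inner_prepend i b c (v w : nc_L2 (A i)) : Hword b -> Hword c ->
  startok i b -> startok i c ->
  inner (prepend b v) (prepend c w) = inner v w * inner (fk b) (fk c).
Proof.
move=> hb hc ib ic; rewrite /prepend !innerDl !innerDr !innerZl !innerZr.
have cross a d (h : nc_L2 (A i)) : Hword a -> Hword d -> startok i a -> startok i d ->
    inner (fk (HL (centered h) :: a)) (fk d) = 0.
  move=> ha hd ia id; have hha := Hword_centered h ha ia.
  have [s|s] := eqVneq (size (HL (centered h) :: a)) (size d); last exact: inner_fk_size.
  rewrite inner_fk //; case: d hd id s => [|y d] //= hd yi _.
  by rewrite winner_cons tagged_inner_neq ?mul0r // eq_sym.
rewrite (cross _ _ v hb hc ib ic) (innerC (fk b)) (cross _ _ w hc hb ic ib).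
rewrite rmorph0 !mulr0 addr0 add0r.
have -> : inner v w = inner (centered v) (centered w) + (inner (xi i) v)^*%R * inner (xi i) w.
  rewrite /centered innerBl !innerBr !innerZl !innerZr inner_xi (innerC v (xi i)); ring.
rewrite mulrDl mulrA; congr (_ + _).
have [s|s] := eqVneq (size b) (size c).
  rewrite !inner_fk //; [by rewrite winner_cons tagged_innerE | exact: Hword_centered.. |].
  by rewrite /= s.
by rewrite !inner_fk_size ?mulr0 //; exact: Hword_centered.
Qed.

Section Basis.
Variable E : set (hletter A).
Hypothesis Ering : forall x, E x -> in_Hring x.
Hypothesis Eorth : forall x y, E x -> E y -> tagged_inner x y = (x == y)%:R.
Hypothesis Edense : forall x, in_Hring x -> cspan [set h | E (HL h)] (tagged x).

Definition bword w : Prop := Hword w /\ inw E w.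

Lemma winner_basis b c : inw E b -> inw E c -> size b = size c -> winner b c = (b == c)%:R.
Proof.
elim: b c => [|x b IH] [|y c] //=; first by rewrite winner_nil.
move=> hb hc [s].
have [Ex Eb] : E x /\ inw E b by split=> [|z zb]; apply: hb; rewrite inE ?eqxx ?zb ?orbT.
have [Ey Ec] : E y /\ inw E c by split=> [|z zc]; apply: hc; rewrite inE ?eqxx ?zc ?orbT.
by rewrite winner_cons eqseq_cons Eorth // IH // -natrM mulnb.
Qed.

Lemma inner_fk_basis b c : bword b -> bword c -> inner (fk b) (fk c) = (b == c)%:R.
Proof.
case=> hb Eb [hc Ec]; have [s|s] := eqVneq (size b) (size c).
  by rewrite inner_fk // winner_basis.
rewrite inner_fk_size //; case: eqP => // e; by rewrite e eqxx in s.
Qed.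

Lemma prepend_family i : exists Q : orth_family (seq (hletter A)) (nc_L2 (A i)) F,
  forall b, bword b -> startok i b -> forall h, Q b h = prepend b h.
Proof.
have ex b : exists T : bop (nc_L2 (A i)) F,
    (bword b /\ startok i b -> forall h, T h = prepend b h) /\
    (~ (bword b /\ startok i b) -> T = 0).
  have [[hb ib]|nb] := pselect (bword b /\ startok i b); last by exists 0; split.
  by have [T hT] := prepend_bop hb.1 ib; exists T; split=> // /(_ (conj hb ib)).
have [Q hQ] := choice ex.
have Qle b (v : nc_L2 (A i)) : sqn (Q b v) <= sqn v.
  have [[hb ib]|nb] := pselect (bword b /\ startok i b); last first.
    by rewrite (hQ b).2 // bop0E sqn0 sqn_ge0.
  rewrite (hQ b).1 // /sqn inner_prepend ?inner_fk_basis ?eqxx ?mulr1 //; exact: hb.1.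
have Qorth b c (v w : nc_L2 (A i)) : b != c -> inner (Q b v) (Q c w) = 0.
  move=> bc.
  have [[hb ib]|nb] := pselect (bword b /\ startok i b); last first.
    by rewrite (hQ b).2 // bop0E inner0l.
  have [[hc ic]|nc] := pselect (bword c /\ startok i c); last first.
    by rewrite (hQ c).2 // bop0E inner0r.
  rewrite (hQ b).1 // (hQ c).1 // inner_prepend ?inner_fk_basis ?(negbTE bc) ?mulr0 //.
    exact: hb.1.
  exact: hc.1.
by exists (OrthFamily Qle Qorth) => b hb ib h /=; rewrite (hQ b).1.
Qed.

(** T is a (x) 1 on H_i (x) F(i), obtained as [theta] for the family indexed by basis words. The
    formula is immediate on these and spreads to all words letter by letter. *)
Lemma prepend_action i (a : bop (nc_L2 (A i)) (nc_L2 (A i))) : exists T : bop F F,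
  forall w, Hword w -> startok i w -> forall h, T (prepend w h) = prepend w (a h).
Proof.
have [Q hQ] := prepend_family i; exists (theta Q Q a).
apply: (word_density Ering).
  move=> b hb Eb ib h; have bb : bword b by [].
  rewrite -hQ // (theta_single _ _ (b := b)) => [|c cb]; last exact: adj_ofam_orth.
  rewrite adj_isometry ?hQ // => x y.
  by rewrite !hQ // inner_prepend // inner_fk_basis // eqxx mulr1.
move=> p q j h hh hw hE ipq g.
have ipk (k : nc_L2 (A j)) : startok i (p ++ HL k :: q) by move: ipq; case: (p).
have [T0 hT0] := fk_insert W hw.
have Tg (g' : nc_L2 (A i)) : exists T : bop (nc_L2 (A j)) F,
    forall k, T k = fk (HL (centered g') :: p ++ HL (centered k) :: q).
  have [|T hT] := @fk_insert R I A W j (HL (centered g') :: p) q.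
    by move=> k hk; apply: Hword_centered; [exact: hw | exact: ipk].
  by exists T => k; rewrite hT.
have [T1 hT1] := Tg g; have [T2 hT2] := Tg (a g).
(* The error in the formula, as a bounded operator in the one letter being replaced: it vanishes on
   basis letters, hence on h. *)
pose D := bcomp (theta Q Q a) (T1 + inner (xi i) g *: T0) - (T2 + inner (xi i) (a g) *: T0).
have DE k : inner (xi j) k = 0 -> D k = theta Q Q a (prepend (p ++ HL k :: q) g)
    - prepend (p ++ HL k :: q) (a g).
  move=> hk; rewrite /D bopDE bopNE bcompE !bopDE !bopZE hT1 hT2 !hT0 (centered_id hk).
  by [].
apply/eqP; rewrite -subr_eq0 -DE //; apply/eqP.
have : cspan (set0 : set F) (D h).
  apply: (cspan_map _ (Edense (x := HL h) hh)) => k Ek.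
  rewrite DE; last exact: (Ering Ek).
  by rewrite hE // subrr; exact: cspan0.
by move=> h0; apply: inner_eq0 => z; apply: cspan_orth h0.
Qed.

End Basis.

(** All three defining formulas are a (x) 1: a word not starting in index i is [prepend] of xi_i,
    and one starting with h in H_i is [prepend] of h. That phi(u) = 0 removes the scalar part of a
    xi_i. *)
Lemma left_action_exists (u : aletter A) : in_Mring u ->
  exists T : bop F F, is_left_action u T.
Proof.
case=> Mu phiu; have [E [Ering Eorth Edense]] := letter_basis A.
have [T hT] := prepend_action Ering Eorth Edense (nc_rep (A (tag u)) (tagged u)).
have phi0 : inner (xi (tag u)) (nc_rep (A (tag u)) (tagged u) (xi (tag u))) = 0.
  by rewrite -(gns_state (nc_gns (A (tag u))) Mu).
have Tw w : Hword w -> startok (tag u) w -> T (fk w) = fk (hat u :: w).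
  move=> hw iw; have := hT w hw iw (xi (tag u)).
  rewrite /prepend inner_xi phi0 scale0r scale1r centered_xi addr0 (centered_id phi0).
  rewrite fk_zero ?add0r //.
  by apply/Hword_cons; split=> //; rewrite /in_Hring /= inner0r.
exists T; split.
- by apply: Tw => //; split.
- by move=> v w hw vi; apply: Tw.
- move=> h w /Hword_cons[hh iw hw].
  have := hT w hw iw h; rewrite /prepend hh scale0r addr0 (centered_id hh).
  by [].
Qed.

Lemma left_actionP (u : aletter A) : in_Mring u -> is_left_action u (left_action W u).
Proof. by move=> /left_action_exists hu; apply: (xgetPex 0 hu). Qed.

End LeftAction.

(** * Products of letters acting on words *)

Lemma reduced_tags (I : eqType) (T : I -> Type) (w : seq {i & T i}) :
  reduced w = sorted (fun i j => i != j) (map tag w).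
Proof. by rewrite sorted_map. Qed.

Lemma reduced_behead (I : eqType) (T : I -> Type) x (w : seq {i & T i}) :
  reduced (x :: w) -> reduced w.
Proof. by case: w => //= y w /andP[]. Qed.

Section KappaAction.
Variables (R : realType) (I : eqType) (A : I -> nc_space R) (W : free_spaces A).
Local Notation F := (fs_F W).
Local Notation fk := (@fk R I A W).
Local Notation HL h := (Tagged (fun i => nc_L2 (A i)) h).
Local Notation xi i := (nc_xi (A i)).
Implicit Types (u v w : seq (hletter A)) (h : hletter A).
Implicit Types (x y : aletter A) (s a al : seq (aletter A)).

(** Meaningful when the indices agree; otherwise [tagged_as] falls back on [hat x]. *)
Definition act x h : nc_L2 (A (tag x)) := nc_rep (A (tag x)) (tagged x) (tagged_as (hat x) h).
(** For h = [hat y] this is phi(xy), see [vacuum_pairing]. *)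
Definition pairing x h : R[i] := if tag h == tag x then inner (xi (tag x)) (act x h) else 0.
Definition diag_letter x h : hletter A := HL (centered (act x h)).
Definition hats s : seq (hletter A) := map (@hat R I A) s.
Definition ringa s : Prop := forall x, x \in s -> in_Mring x.

Lemma actE x (g : nc_L2 (A (tag x))) : act x (HL g) = nc_rep (A (tag x)) (tagged x) g.
Proof. by rewrite /act tagged_asE. Qed.

Lemma hat_ring x : in_Mring x -> in_Hring (hat x).
Proof. by case=> Mx e; rewrite /in_Hring /= -(gns_state (nc_gns (A (tag x))) Mx). Qed.

Lemma ringa_cons x s : ringa (x :: s) <-> in_Mring x /\ ringa s.
Proof.
split=> [hs|[hx hs] y]; last by rewrite inE => /orP[/eqP -> //|/hs].
by split=> [|y ys]; apply: hs; rewrite inE ?eqxx ?ys ?orbT.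
Qed.

Lemma hats_ring s : ringa s -> ringw (hats s).
Proof. by move=> hs _ /mapP[x /hs xs ->]; exact: hat_ring. Qed.

Lemma hats_reduced s : reduced (hats s) = reduced s.
Proof. by rewrite !reduced_tags -map_comp. Qed.

Lemma rev_reduced (T : I -> Type) (t : seq {i & T i}) : reduced (rev t) = reduced t.
Proof.
rewrite !reduced_tags map_rev rev_sorted; congr (sorted _ _).
by apply: funext => i; apply: funext => j; rewrite eq_sym.
Qed.

Lemma ringa_rev s : ringa s -> ringa (rev s).
Proof. by move=> hs x; rewrite mem_rev; exact: hs. Qed.

Lemma left_create x u : in_Mring x -> Hword u -> startok (tag x) u ->
  left_action W x (fk u) = fk (hat x :: u).
Proof.
move=> hx hu xu; have [h1 h2 _] := left_actionP W hx.
by case: u hu xu => [|y u] hu xu; [exact: h1 | exact: h2].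
Qed.

Lemma left_same x h w : in_Mring x -> Hword (h :: w) -> tag h = tag x ->
  left_action W x (fk (h :: w)) = fk (diag_letter x h :: w) + pairing x h *: fk w.
Proof.
move=> hx; case: h => j g hw /= e; subst j.
have [_ _ h3] := left_actionP W hx.
by rewrite /pairing /diag_letter /= eqxx actE; exact: h3.
Qed.

Lemma kappa_cat s a (v : F) : kappa_word W (s ++ a) v = kappa_word W s (kappa_word W a v).
Proof. by elim: s => //= x s IH; rewrite -IH. Qed.

Lemma kappa_create s u : ringa s -> Hword u -> reduced (hats s ++ u) ->
  kappa_word W s (fk u) = fk (hats s ++ u).
Proof.
elim: s => [//|x s IH] /ringa_cons[hx hs] hu.
rewrite -[hats (x :: s) ++ u]/(hat x :: (hats s ++ u)) reduced_cons => /andP[xs rs].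
rewrite bcompE IH // left_create //; split=> //.
by apply/ringw_cat; split; [exact: hats_ring | case: hu].
Qed.

(* The result of applying the letters of [al], in this order, to the word [u]. *)
Fixpoint annihilate al u : F :=
  match al, u with
  | x :: al', h :: w =>
      if tag h == tag x then
        fk (hats (rev al') ++ diag_letter x h :: w) + pairing x h *: annihilate al' w
      else fk (hats (rev al) ++ u)
  | _, _ => fk (hats (rev al) ++ u)
  end.

Lemma diag_ring x h : in_Hring (diag_letter x h).
Proof. exact: inner_xi_centered. Qed.

Lemma reduced_revcat al x u : reduced (x :: al) -> reduced u -> startok (tag x) u ->
  reduced (hats (rev (x :: al)) ++ u).
Proof.
rewrite -rev_reduced -hats_reduced rev_cons /hats map_rcons => rx ru xu.
rewrite cat_rcons; move: rx ru; rewrite !reducedE !map_cat map_rcons /=.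
case: u xu => [|y u] /= yx; first by rewrite cats1.
case: (map tag (map (@hat R I A) (rev al))) => [|i r] /=.
  by rewrite (eq_sym (tag x)) yx.
by rewrite rcons_path cat_path /= (eq_sym (tag x)) yx => /andP[-> ->].
Qed.

(** When x meets a letter h of its own index, the diagonal part leaves a letter of that index, so
    the remaining letters of the reduced word can only create; only the scalar part lets
    annihilation go on. With different indices every letter creates. *)
Lemma kappa_annihilate al u : reduced al -> ringa al -> Hword u ->
  kappa_word W (rev al) (fk u) = annihilate al u.
Proof.
elim: al u => [|x al IH] u; first by case: u.
move=> rx /ringa_cons[hx ha] hu.
have ra := reduced_behead rx.
rewrite rev_cons -cats1 kappa_cat [kappa_word W [:: x] _]/=.
have cre v : Hword v -> startok (tag x) v ->
    kappa_word W (rev al) (left_action W x (fk v)) = fk (hats (rev (x :: al)) ++ v).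
  move=> hv xv; rewrite left_create // kappa_create.
  - by rewrite rev_cons /hats map_rcons cat_rcons.
  - exact: ringa_rev.
  - by apply/Hword_cons; split=> //; exact: hat_ring.
  - rewrite -cat_rcons -[rcons _ _](map_rcons (@hat R I A)) -rev_cons.
    by apply: reduced_revcat => //; case: hv.
case: u hu => [|h w] hu /=; first exact: cre.
have [e|ne] := eqVneq (tag h) (tag x); last exact: cre.
have [hh hs hw] := (Hword_cons _ _).1 hu.
rewrite left_same // bopDr bopZr (IH w) //.
congr (_ + _); rewrite kappa_create //; first exact: ringa_rev.
  apply/Hword_cons; split=> //; first exact: diag_ring.
  by rewrite /= -e.
have := reduced_revcat rx hw.1; rewrite -e => /(_ hs).
by rewrite rev_cons /hats map_rcons cat_rcons !reducedE !map_cat.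
Qed.

End KappaAction.

(** * The components of iota *)

Section Components.
Variables (R : realType) (I : eqType) (A : I -> nc_space R) (W : free_spaces A).
Local Notation Lp := (fs_pow W).
Local Notation S := (fs_S W).
Local Notation LS := (fs_powS W).
Local Notation fk := (@fk R I A W).
Local Notation Lw := (@Lw R I A W).
Local Notation HL h := (Tagged (fun i => nc_L2 (A i)) h).
Local Notation xi i := (nc_xi (A i)).
Implicit Types (u v w : seq (hletter A)) (h : hletter A).
Implicit Types (x y : aletter A) (s a al : seq (aletter A)).

Definition pairings s u : R[i] := \prod_(p <- zip s u) pairing p.1 p.2.

Lemma Hword_nil : Hword ([::] : seq (hletter A)).
Proof. by split. Qed.

Lemma Hword1 h : in_Hring h -> Hword [:: h].
Proof. by move=> hh; apply/Hword_cons; split. Qed.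

Lemma vacuum_pairing x y : in_Mring x -> in_Mring y ->
  vacuum_state (bcomp (left_action W x) (left_action W y)) = pairing x (hat y).
Proof.
move=> hx hy; rewrite /vacuum_state bcompE -!/(fk _).
have h0 := Hword_nil; have hhy := Hword1 (hat_ring hy).
rewrite (left_create W hy) //.
have [e|ne] := eqVneq (tag (hat y)) (tag x).
  rewrite left_same // innerDr innerZr.
  rewrite inner_fk_size //; last exact: (Hword1 (diag_ring _ _)).
  by rewrite inner_fk // winner_nil mulr1 add0r.
rewrite left_create //.
rewrite /pairing (negbTE ne) inner_fk_size //.
by apply/Hword_cons; split=> //; exact: hat_ring.
Qed.

Lemma star_letter x : in_Mring x -> exists g : hletter A,
  in_Hring g /\ forall h, tagged_inner g h = pairing x h.
Proof.
case=> Mx phix; have [T [MT phiT hT]] := star_exists Mx phix.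
exists (HL (nc_rep (A (tag x)) T (xi (tag x)))); split.
  by rewrite /in_Hring /= -(gns_state (nc_gns (A (tag x))) MT).
case=> j g; have [e|ne] := eqVneq j (tag x).
  by subst j; rewrite tagged_innerE /pairing /= eqxx actE hT.
by rewrite tagged_inner_neq /pairing /= ?(negbTE ne) // eq_sym.
Qed.

Lemma star_word s : ringa s -> exists v,
  [/\ ringw v, size v = size s & forall u, size u = size s -> winner v u = pairings s u].
Proof.
elim: s => [|x s IH] hs.
  by exists [::]; split=> // -[] // _; rewrite winner_nil /pairings big_nil.
have [hx /IH[v [rv sv hv]]] := (ringa_cons _ _).1 hs.
have [g [hg hgx]] := star_letter hx.
exists (g :: v); split; [exact/ringw_cons | by rewrite /= sv |].
move=> [|h u] //= [su]; rewrite winner_cons hgx hv //.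
by rewrite /pairings big_cons.
Qed.

Lemma tensLE n s : tensL W n s = Lw n (hats s).
Proof. by rewrite /tensL /Lw /hats -map_comp. Qed.

Lemma hats_dense h : in_Hring h ->
  cspan [set g | exists2 y, in_Mring y & hat y = HL g] (tagged h : nc_L2 (A (tag h))).
Proof.
case: h => i g /= hg; have := hat_dense hg; apply: cspan_cspan => _ [T hT <-].
apply: cspan_sub; exists (Tagged (fun i => nc_bop (A i)) T) => //.
Qed.

Lemma hats_total n : total_set [set tensL W n s | s in [set s | size s = n /\ ringa s]].
Proof.
have Xr h : (exists2 y, in_Mring y & hat y = h) -> in_Hring h.
  by case=> y hy <-; exact: hat_ring.
apply: (total_sub (Lw_total_in W Xr hats_dense n)) => _ [u [su hu] <-].
suff [s [ss hs <-]] : exists s, [/\ size s = n, ringa s & hats s = u].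
  by apply: cspan_sub; exists s; rewrite ?tensLE.
elim: u n su hu => [|h u IH] n su hu; first by exists [::].
case: n su => // n [su].
have [|s [ss hs e]] := IH n su; first by move=> g gu; apply: hu; rewrite inE gu orbT.
have [|y hy ey] := hu h; first by rewrite inE eqxx.
by exists (y :: s); split; [rewrite /= ss | exact/ringa_cons | rewrite /= ey e].
Qed.

(** The prescribed operator exists because it has rank one: its functional is the inner product with
    the word of starred letters. Totality of the vectors [tensL m b] makes it unique. *)
Lemma contract_opE m k s a : size s = m -> ringa s -> ringa a ->
  exists t, (forall z, contract_op W m k s a z = inner t z *: Lw k (hats a)) /\
    forall u, size u = m -> ringw u -> inner t (Lw m u) = pairings s u.
Proof.
move=> ss hs ha; have [v [rv sv hv]] := star_word hs.
have tE u : size u = m -> ringw u -> inner (Lw m v) (Lw m u) = pairings s u.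
  by move=> su hu; rewrite inner_Lw // ?hv ?sv ?ss.
exists (Lw m v); split=> //.
have [T hT] := rank_one (Lw m v) (Lw k (hats a)).
have TP : forall b : seq (aletter A), size b = m ->
    (forall x : aletter A, x \in b -> in_Mring x) ->
    T (tensL W m b) = (\prod_(p <- zip s b)
         vacuum_state (bcomp (left_action W p.1) (left_action W p.2))) *: tensL W k a.
  move=> b sb hb; rewrite hT !tensLE tE ?size_map //; last exact: hats_ring.
  congr (_ *: _); rewrite /pairings; have : size s = size b by rewrite ss sb.
  elim: (s) (b) hs hb => [|x s' IH] [|y b'] //=; first by rewrite !big_nil.
  move=> /ringa_cons[hx hs'] /ringa_cons[hy hb'] [sz].
  by rewrite !big_cons /= vacuum_pairing // IH.
move=> z; rewrite -hT; congr (bop_fun _ z); apply: (total_eq (hats_total m)) => _ [b [sb hb] <-].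
rewrite TP // /contract_op.
by case: xgetP => [T' _ hT'|nT]; [exact: hT' | case: (nT T TP)].
Qed.

Lemma coordinateE x h : coordinate W x (hs_in S h) =
  if tag h == tag x then hs_in S (HL (act x h)) else 0.
Proof.
have [T hT] := S_insert W (tag x).
have iT g g' : inner (T g) (T g') = inner g g' by rewrite !hT hs_inner // tagged_innerE.
(* T embeds H_i isometrically in the sum S, and its adjoint kills the other summands. *)
pose X := bcomp T (bcomp (nc_rep (A (tag x)) (tagged x)) (adj T)).
have hX : (forall g : nc_L2 (A (tag x)), X (hs_in S (HL g)) =
       hs_in S (HL (nc_rep (A (tag x)) (tagged x) g))) /\
    (forall v : hletter A, tag v != tag x -> X (hs_in S v) = 0).
  split=> [g|v vx]; first by rewrite /X !bcompE -hT adj_isometry // hT.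
  rewrite /X !bcompE (_ : adj T (hs_in S v) = 0) ?bop0r //.
  apply: inner_eq0 => z; rewrite adjPr hT hs_inner // tagged_inner_neq //= eq_sym.
  exact: vx.
rewrite /coordinate; case: xgetP => [X' _ [h1 h2]|nX]; last by case: (nX X hX).
case: h => j g; have [e|ne] := eqVneq j (tag x).
  by subst j; rewrite actE; exact: h1.
exact: h2.
Qed.

(** For rank-one T the tensor product is a composition: pair the first factor with t, apply X to the
    second, then tensor with c. *)
Lemma op_tensorE m k (T : bop (Lp m) (Lp k)) (X : bop S S) t c :
  (forall z, T z = inner t z *: c) ->
  forall z (s : S), op_tensor T X (ht_tens (LS m) z s) = ht_tens (LS k) (T z) (X s).
Proof.
move=> hT.
have [T1 hT1] := LS_insertr t; have [T2 hT2] := LS_insertr c.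
have hY z (s : S) : bcomp T2 (bcomp X (adj T1)) (ht_tens (LS m) z s) = ht_tens (LS k) (T z) (X s).
  rewrite !bcompE.
  have -> : adj T1 (ht_tens (LS m) z s) = inner t z *: s.
    by apply: inner_inj => y; rewrite adjPr hT1 ht_inner innerZr.
  have [T3 hT3] := LS_insertl k (X s).
  by rewrite !bopZr hT2 hT -!hT3 bopZr.
rewrite /op_tensor; case: xgetP => [Y _ hY'|nY]; [exact: hY' | by case: (nY _ hY)].
Qed.

End Components.

(** * Partial isometries between words and tensors *)

Section Families.
Variables (R : realType) (I : eqType) (A : I -> nc_space R) (W : free_spaces A).
Local Notation Lp := (fs_pow W).
Local Notation LS := (fs_powS W).
Local Notation F := (fs_F W).
Local Notation fk := (@fk R I A W).
Local Notation Lw := (@Lw R I A W).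
Local Notation LSw := (@LSw R I A W).
Local Notation HL h := (Tagged (fun i => nc_L2 (A i)) h).
Local Notation xi i := (nc_xi (A i)).
Implicit Types (b u v w : seq (hletter A)) (g h : hletter A).

(** Compression to reduced words; [fk_vec] is unspecified on the others. *)
Definition fk0 w : F := if reduced w then fk w else 0.

Definition slot n (p : seq (hletter A) * hletter A) : Prop :=
  [/\ size p.1 = n, ringw p.1 & in_Hring p.2 \/ vacuum_letter p.2].

(** A nonzero product forces equal indices, and reducedness depends only on indices. This is the
    orthogonality hypothesis of [partial_isometry]. *)
Lemma winner_eq0_cat u v b : size u = size v -> reduced (u ++ b) -> ~~ reduced (v ++ b) ->
  winner u v = 0.
Proof.
move=> s ru; apply: contraNeq => /(winner_tags s) e.
by move: ru; rewrite !reducedE !map_cat e.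
Qed.

Lemma winner_eq0_cat2 u v g h b : size u = size v -> reduced (u ++ g :: b) ->
  ~~ reduced (v ++ h :: b) -> winner u v * tagged_inner g h = 0.
Proof.
move=> s ru rv; have := @winner_eq0_cat (u ++ [:: g]) (v ++ [:: h]) b.
rewrite !size_cat s -!catA /= => /(_ erefl ru rv).
by rewrite winner_cat // winner_cons winner_nil mulr1.
Qed.

Lemma vacuum_nring h : vacuum_letter h -> ~ in_Hring h.
Proof.
case: h => i h; rewrite /vacuum_letter /in_Hring /= => ->.
by rewrite inner_xi => /eqP; rewrite oner_eq0.
Qed.

Lemma vacuum_inner g h : vacuum_letter g -> vacuum_letter h -> tag g = tag h ->
  tagged_inner g h = 1.
Proof.
case: g => i g; case: h => j h; rewrite /vacuum_letter /= => -> -> e.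
by subst j; rewrite tagged_innerE inner_xi.
Qed.

Section Tails.
Variable E : set (hletter A).
Hypothesis Eorth : forall g h, E g -> E h -> tagged_inner g h = (g == h)%:R.

Lemma winner_bword b : bword E b -> winner b b = 1.
Proof. by move=> [hb Eb]; rewrite (winner_basis Eorth) // eqxx. Qed.

Lemma Hword_cat u b : ringw u -> bword E b -> reduced (u ++ b) -> Hword (u ++ b).
Proof. by move=> hu [[_ hb] _] r; split=> //; apply/ringw_cat. Qed.

Lemma tail_isometry m b : bword E b -> exists T : bop (Lp m) F,
  [/\ forall u, size u = m -> ringw u -> T (Lw m u) = fk0 (u ++ b),
      forall z, sqn (T z) <= sqn z,
      forall u, size u = m -> ringw u -> reduced (u ++ b) -> adj T (fk (u ++ b)) = Lw m u &
      forall w, Hword w -> size w != (m + size b)%N -> adj T (fk w) = 0].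
Proof.
move=> hb.
have [||T [T1 T2 T3 T4 T5]] := @partial_isometry _ (Lp m) F _
  [set u | size u = m /\ ringw u] [set u | reduced (u ++ b)] (Lw m)
  (fun u => fk (u ++ b)) (Lw_total W m).
- move=> u v [su hu] [sv hv] ru rv.
  rewrite inner_fk ?size_cat ?su ?sv //; try exact: Hword_cat.
  by rewrite inner_Lw // winner_cat ?su // winner_bword // mulr1.
- move=> u v [su hu] [sv hv] ru /negP rv; rewrite inner_Lw //.
  by apply: winner_eq0_cat rv; rewrite ?su.
exists T; split=> //.
- move=> u su hu; rewrite /fk0; case: ifPn => [ru|/negP ru]; first exact: T1.
  exact: T2.
- by move=> u su hu ru; apply: T4.
- move=> w hw sw; apply: T5 => u [su hu] ru; apply: inner_fk_size => //.
    exact: Hword_cat.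
  by rewrite size_cat su eq_sym.
Qed.

(** For b different from c, either the words u ++ b and v ++ c differ in length, or b and c are
    orthogonal basis words of equal length. Indices that are not basis words get the zero
    operator. *)
Lemma tail_family m : exists Q : orth_family (seq (hletter A)) (Lp m) F,
  [/\ forall b u, bword E b -> size u = m -> ringw u -> Q b (Lw m u) = fk0 (u ++ b),
      forall b u, bword E b -> size u = m -> ringw u -> reduced (u ++ b) ->
        adj (Q b) (fk (u ++ b)) = Lw m u &
      forall b w, Hword w -> size w != (m + size b)%N -> adj (Q b) (fk w) = 0].
Proof.
have ex b : exists T : bop (Lp m) F, (~ bword E b -> T = 0) /\ (bword E b ->
  [/\ forall u, size u = m -> ringw u -> T (Lw m u) = fk0 (u ++ b),
      forall z, sqn (T z) <= sqn z,
      forall u, size u = m -> ringw u -> reduced (u ++ b) -> adj T (fk (u ++ b)) = Lw m u &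
      forall w, Hword w -> size w != (m + size b)%N -> adj T (fk w) = 0]).
  have [hb|nb] := pselect (bword E b); last by exists 0; split.
  by have [T hT] := tail_isometry m hb; exists T; split.
have [Q hQ] := choice ex.
have Qle b z : sqn (Q b z) <= sqn z.
  have [hb|nb] := pselect (bword E b); first by have [_ + _ _] := (hQ b).2 hb; apply.
  by rewrite (hQ b).1 // bop0E sqn0 sqn_ge0.
have Qorth b c z z' : b != c -> inner (Q b z) (Q c z') = 0.
  move=> bc.
  have [hb|nb] := pselect (bword E b); last by rewrite (hQ b).1 // bop0E inner0l.
  have [hc|nc] := pselect (bword E c); last by rewrite (hQ c).1 // bop0E inner0r.
  have [Tb _ _ _] := (hQ b).2 hb; have [Tc _ _ _] := (hQ c).2 hc.
  apply: (inner_total0 (Lw_total W m) (Lw_total W m)) => _ _ [u [su hu] <-] [v [sv hv] <-].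
  rewrite Tb // Tc // /fk0; case: ifP => ru; last by rewrite inner0l.
  case: ifP => rv; last by rewrite inner0r.
  have [hub hvc] := (Hword_cat hu hb ru, Hword_cat hv hc rv).
  have [s|s] := eqVneq (size (u ++ b)) (size (v ++ c)); last exact: inner_fk_size.
  have sbc : size b = size c by move: s; rewrite !size_cat su sv => /addnI.
  rewrite inner_fk // winner_cat ?su // (winner_basis Eorth hb.2 hc.2 sbc).
  by rewrite (negbTE bc) mulr0.
exists (OrthFamily Qle Qorth); split=> /=.
- by move=> b u hb su hu; have [+ _ _ _] := (hQ b).2 hb; apply.
- by move=> b u hb su hu ru; have [_ _ + _] := (hQ b).2 hb; apply.
- move=> b w hw sw; have [hb|nb] := pselect (bword E b).
    by have [_ _ _] := (hQ b).2 hb; apply.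
  by rewrite (hQ b).1 //; apply: inner_eq0 => z; rewrite adjPr bop0E inner0l.
Qed.

(** Sending the xi-component of the slot to 0 matches the diagonal part of a letter, which keeps
    only the centered part of a h. *)
Lemma slot_tail_isometry m b : bword E b -> exists T : bop (LS m) F,
  [/\ forall v h, size v = m -> ringw v -> in_Hring h -> T (LSw m v h) = fk0 (v ++ h :: b),
      forall v h, size v = m -> ringw v -> vacuum_letter h -> T (LSw m v h) = 0,
      forall z, sqn (T z) <= sqn z,
      forall v h, size v = m -> ringw v -> in_Hring h -> reduced (v ++ h :: b) ->
        adj T (fk (v ++ h :: b)) = LSw m v h &
      forall w, Hword w -> size w != (m + size b).+1 -> adj T (fk w) = 0].
Proof.
move=> hb.
have hw v h : ringw v -> in_Hring h -> reduced (v ++ h :: b) -> Hword (v ++ h :: b).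
  move=> hv hh r; split=> //; apply/ringw_cat; split=> //; apply/ringw_cons; split=> //.
  by case: hb => -[].
have [||T [T1 T2 T3 T4 T5]] := @partial_isometry _ (LS m) F _ (slot m)
  [set p | in_Hring p.2 /\ reduced (p.1 ++ p.2 :: b)] (fun p => LSw m p.1 p.2)
  (fun p => fk (p.1 ++ p.2 :: b)) (LSw_total W m).
- move=> [u g] [v h] /= [/= su hu _] [/= sv hv _] [hg ru] [hh rv].
  rewrite inner_fk ?size_cat /= ?su ?sv //; try exact: hw.
  by rewrite inner_LSw // winner_cat ?su // winner_cons winner_bword // mulr1.
- move=> [u g] [v h] /= [/= su hu _] [/= sv hv hh'] [hg ru] nP.
  rewrite inner_LSw //; case: hh' => [hh|hh].
    apply: winner_eq0_cat2 ru _; first by rewrite su.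
    by apply/negP => rv; apply: nP.
  by rewrite tagged_inner_vacuum // mulr0.
exists T; split=> //.
- move=> v h sv hv hh; rewrite /fk0; case: ifPn => [rv|/negP rv].
    by apply: (T1 (v, h)) => //; split=> //; left.
  by apply: (T2 (v, h)) => [|[]] //; split=> //; left.
- move=> v h sv hv hh; apply: (T2 (v, h)) => [|[hr _]]; first by split=> //; right.
  exact: (vacuum_nring hh hr).
- by move=> v h sv hv hh rv; apply: (T4 (v, h)) => //; split=> //; left.
- move=> w hww sw; apply: T5 => -[v h] /= [/= sv hv _] [hh rv]; apply: inner_fk_size => //.
    exact: hw.
  by rewrite size_cat /= sv addnS eq_sym.
Qed.

Lemma slot_tail_family m : exists Q : orth_family (seq (hletter A)) (LS m) F,
  [/\ forall b v h, bword E b -> size v = m -> ringw v -> in_Hring h ->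
        Q b (LSw m v h) = fk0 (v ++ h :: b),
      forall b v h, bword E b -> size v = m -> ringw v -> vacuum_letter h ->
        Q b (LSw m v h) = 0,
      forall b v h, bword E b -> size v = m -> ringw v -> in_Hring h ->
        reduced (v ++ h :: b) -> adj (Q b) (fk (v ++ h :: b)) = LSw m v h &
      forall b w, Hword w -> size w != (m + size b).+1 -> adj (Q b) (fk w) = 0].
Proof.
have ex b : exists T : bop (LS m) F, (~ bword E b -> T = 0) /\ (bword E b ->
  [/\ forall v h, size v = m -> ringw v -> in_Hring h -> T (LSw m v h) = fk0 (v ++ h :: b),
      forall v h, size v = m -> ringw v -> vacuum_letter h -> T (LSw m v h) = 0,
      forall z, sqn (T z) <= sqn z,
      forall v h, size v = m -> ringw v -> in_Hring h -> reduced (v ++ h :: b) ->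
        adj T (fk (v ++ h :: b)) = LSw m v h &
      forall w, Hword w -> size w != (m + size b).+1 -> adj T (fk w) = 0]).
  have [hb|nb] := pselect (bword E b); last by exists 0; split.
  by have [T hT] := slot_tail_isometry m hb; exists T; split.
have [Q hQ] := choice ex.
have Qle b z : sqn (Q b z) <= sqn z.
  have [hb|nb] := pselect (bword E b); first by have [_ _ + _ _] := (hQ b).2 hb; apply.
  by rewrite (hQ b).1 // bop0E sqn0 sqn_ge0.
have Qorth b c z z' : b != c -> inner (Q b z) (Q c z') = 0.
  move=> bc.
  have [hb|nb] := pselect (bword E b); last by rewrite (hQ b).1 // bop0E inner0l.
  have [hc|nc] := pselect (bword E c); last by rewrite (hQ c).1 // bop0E inner0r.
  have [Tb Tb' _ _ _] := (hQ b).2 hb; have [Tc Tc' _ _ _] := (hQ c).2 hc.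
  apply: (inner_total0 (LSw_total W m) (LSw_total W m)) =>
    _ _ [[u g] [/= su hu hg] <-] [[v h] [/= sv hv hh] <-] /=.
  case: hg => hg; last by rewrite Tb' // inner0l.
  case: hh => hh; last by rewrite Tc' // inner0r.
  rewrite Tb // Tc // /fk0; case: ifP => ru; last by rewrite inner0l.
  case: ifP => rv; last by rewrite inner0r.
  have hub : Hword (u ++ g :: b).
    split=> //; apply/ringw_cat; split=> //; apply/ringw_cons; split=> //.
    by case: hb => -[].
  have hvc : Hword (v ++ h :: c).
    split=> //; apply/ringw_cat; split=> //; apply/ringw_cons; split=> //.
    by case: hc => -[].
  have [s|s] := eqVneq (size (u ++ g :: b)) (size (v ++ h :: c)); last exact: inner_fk_size.
  have sbc : size b = size c by move: s; rewrite !size_cat /= su sv => /addnI [].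
  rewrite inner_fk // winner_cat ?su // winner_cons (winner_basis Eorth hb.2 hc.2 sbc).
  by rewrite (negbTE bc) !mulr0.
exists (OrthFamily Qle Qorth); split=> /=.
- by move=> b v h hb; have [+ _ _ _ _] := (hQ b).2 hb; apply.
- by move=> b v h hb; have [_ + _ _ _] := (hQ b).2 hb; apply.
- by move=> b v h hb; have [_ _ _ + _] := (hQ b).2 hb; apply.
- move=> b w hw sw; have [hb|nb] := pselect (bword E b).
    by have [_ _ _ _] := (hQ b).2 hb; apply.
  by rewrite (hQ b).1 //; apply: inner_eq0 => z; rewrite adjPr bop0E inner0l.
Qed.

End Tails.

(* The vector v (x) xi_i of the tensor product corresponds to the word v in F. *)
Definition slot_word (p : seq (hletter A) * hletter A) :=
  if `[< in_Hring p.2 >] then rcons p.1 p.2 else p.1.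

(** For a vacuum letter too the reducedness is that of v followed by index i: v (x) xi_i has a
    counterpart in F only if v does not end in index i. *)
Definition slot_ok (i : I) (p : seq (hletter A) * hletter A) : Prop :=
  tag p.2 = i /\ reduced (rcons p.1 p.2).

Lemma slot_wordE v h : in_Hring h -> slot_word (v, h) = rcons v h.
Proof. by move=> hh; rewrite /slot_word /= asboolT. Qed.

Lemma slot_word_vacuum v h : vacuum_letter h -> slot_word (v, h) = v.
Proof. by move=> hh; rewrite /slot_word /= asboolF //; exact: vacuum_nring. Qed.

Lemma Hword_slot n p : slot n p -> reduced (rcons p.1 p.2) -> Hword (slot_word p).
Proof.
case: p => v h [/= _ hv [hh|hh]] r.
  rewrite slot_wordE //; split=> //; rewrite -cats1.
  by apply/ringw_cat; split=> //; apply/ringw_cons.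
rewrite slot_word_vacuum //; split=> //.
by move: r; rewrite -cats1; exact: reduced_catl.
Qed.

Lemma size_slot_word n p : slot n p ->
  (in_Hring p.2 /\ size (slot_word p) = n.+1) \/ (vacuum_letter p.2 /\ size (slot_word p) = n).
Proof.
case: p => v h [/= sv _ [hh|hh]]; [left|right]; split=> //.
  by rewrite slot_wordE // size_rcons sv.
by rewrite slot_word_vacuum.
Qed.

(** A ring letter and a vacuum letter give words of different lengths. Equality of the tags is
    essential: v (x) xi_i and v (x) xi_j are orthogonal for distinct i and j but share the word
    v. *)
Lemma inner_slot n p q : slot n p -> slot n q -> tag p.2 = tag q.2 ->
  reduced (rcons p.1 p.2) -> reduced (rcons q.1 q.2) ->
  inner (fk (slot_word p)) (fk (slot_word q)) = winner p.1 q.1 * tagged_inner p.2 q.2.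
Proof.
move=> hp hq e rp rq; have [hwp hwq] := (Hword_slot hp rp, Hword_slot hq rq).
case: p q hp hq e rp rq hwp hwq => [u g] [v h] [/= su hu hg] [/= sv hv hh] e rp rq.
case: hg => hg; [rewrite (slot_wordE _ hg) | rewrite (slot_word_vacuum _ hg)];
  (case: hh => hh; [rewrite (slot_wordE _ hh) | rewrite (slot_word_vacuum _ hh)]) => hwp hwq.
- by rewrite inner_fk ?size_rcons ?su ?sv // -!cats1 winner_cat ?su // winner_cons winner_nil mulr1.
- rewrite inner_fk_size ?size_rcons ?su ?sv //; first by rewrite tagged_inner_vacuum ?mulr0.
  by rewrite eqn_leq ltnn.
- rewrite inner_fk_size ?size_rcons ?su ?sv //.
    by rewrite tagged_innerC tagged_inner_vacuum // rmorph0 mulr0.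
  by rewrite eqn_leq ltnn andbF.
- by rewrite inner_fk ?su ?sv // vacuum_inner // mulr1.
Qed.

Lemma slot_isometry m (i : I) : exists T : bop (LS m) F,
  [/\ forall z, sqn (T z) <= sqn z,
      forall p, slot m p -> slot_ok i p ->
        T (LSw m p.1 p.2) = fk (slot_word p) /\ adj T (fk (slot_word p)) = LSw m p.1 p.2,
      forall p, slot m p -> ~ slot_ok i p -> T (LSw m p.1 p.2) = 0 &
      forall w, Hword w -> (forall p, slot m p -> slot_ok i p ->
        inner (fk (slot_word p)) (fk w) = 0) -> adj T (fk w) = 0].
Proof.
have [||T [T1 T2 T3 T4 T5]] := @partial_isometry _ (LS m) F _ (slot m)
  (slot_ok i) (fun p => LSw m p.1 p.2) (fun p => fk (slot_word p)) (LSw_total W m).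
- move=> p q hp hq [ep rp] [eq rq]; rewrite (inner_slot hp hq) ?ep ?eq //.
  by case: hp hq => sp hp _ [sq hq _]; rewrite inner_LSw.
- move=> p q [sp hp _] [sq hq _] [ep rp] nq; rewrite inner_LSw //.
  have [eq|ne] := eqVneq (tag q.2) i; last first.
    by rewrite tagged_inner_neq ?mulr0 // ep eq_sym.
  apply: (winner_eq0_cat2 (b := [::])); rewrite ?cats1 ?sp //.
  by apply/negP => rq; apply: nq.
exists T; split=> //.
- by move=> p hp op; split; [exact: T1 | exact: T4].
- by move=> w hw h; apply: T5 => p hp op; exact: h.
Qed.

Lemma last_letter_slot m i v h : size v = m -> tag h = i -> Hword (rcons v h) ->
  [/\ slot m (v, h), slot_ok i (v, h) & slot_word (v, h) = rcons v h].
Proof.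
move=> sv th [r]; rewrite -cats1 => /ringw_cat[hv /ringw_cons[hh _]].
by split; [split=> //; left | by split | rewrite slot_wordE // cats1].
Qed.

Lemma vacuum_slot m i v : size v = m -> Hword v ->
  reduced (rcons v (HL (xi i))) ->
  [/\ slot m (v, HL (xi i)), slot_ok i (v, HL (xi i)) & slot_word (v, HL (xi i)) = v].
Proof.
move=> sv [_ hv] r; have hx : vacuum_letter (HL (xi i)) by [].
by split; [split=> //; right | by split | exact: (slot_word_vacuum v hx)].
Qed.

Lemma inner_slot_eq0 m i w : Hword w ->
  ~ (exists v h, [/\ size v = m, tag h = i & w = rcons v h]) ->
  ~ (size w = m /\ reduced (rcons w (HL (xi i)))) ->
  forall p, slot m p -> slot_ok i p -> inner (fk (slot_word p)) (fk w) = 0.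
Proof.
move=> hw n1 n2 p hp [tp rp]; have hpw := Hword_slot hp rp.
have [s|s] := eqVneq (size (slot_word p)) (size w); last exact: inner_fk_size.
rewrite inner_fk //; case: p hp tp rp hpw s => v h [/= sv hv hh] th r.
case: hh => hh; [rewrite (slot_wordE _ hh) | rewrite (slot_word_vacuum _ hh)] => hpw.
  rewrite size_rcons sv; case/lastP: w hw n1 {n2} => [//|w g] hw n1.
  rewrite size_rcons => -[sw]; rewrite -!cats1 winner_cat ?sv // winner_cons.
  rewrite tagged_inner_neq ?mul0r ?mulr0 // th eq_sym; apply/eqP => tg.
  by apply: n1; exists w, g.
rewrite sv => sw; apply: contrapT => /eqP nz; apply: n2; split=> //.
have := winner_tags _ nz; rewrite sv => /(_ sw) e.
by move: r; rewrite !reducedE !map_rcons e th.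
Qed.

(** The partial isometries of different indices overlap in F, so their adjoints form the family:
    these have ranges in different summands H_i of the slot. *)
Lemma slot_family m : exists Q : orth_family I F (LS m),
  [/\ forall i p, slot m p -> slot_ok i p ->
        adj (Q i) (LSw m p.1 p.2) = fk (slot_word p) /\ Q i (fk (slot_word p)) = LSw m p.1 p.2,
      forall i p, slot m p -> ~ slot_ok i p -> adj (Q i) (LSw m p.1 p.2) = 0 &
      forall i w, Hword w -> (forall p, slot m p -> slot_ok i p ->
        inner (fk (slot_word p)) (fk w) = 0) -> Q i (fk w) = 0].
Proof.
have [T hT] := choice (slot_isometry m).
(* A word of length m + 1 ending in index i comes from v (x) h; one of length m not ending in index
   i comes from w (x) xi_i; any other word is killed. *)
have Tcases i w : Hword w -> adj (T i) (fk w) = 0 \/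
    exists p, [/\ slot m p, slot_ok i p & adj (T i) (fk w) = LSw m p.1 p.2].
  move=> hw; have [_ h1 _ h3] := hT i.
  have [[v [h [sv th e]]]|n1] := pselect (exists v h, [/\ size v = m, tag h = i & w = rcons v h]).
    right; rewrite {}e in hw *; have [s1 s2 s3] := last_letter_slot sv th hw.
    by exists (v, h); split=> //; rewrite -s3; have [_ ->] := h1 _ s1 s2.
  have [[sw r]|n2] := pselect (size w = m /\ reduced (rcons w (HL (xi i)))).
    right; have [s1 s2 s3] := vacuum_slot sw hw r.
    by exists (w, HL (xi i)); split=> //; rewrite -{1}s3; have [_ ->] := h1 _ s1 s2.
  by left; apply: h3 => //; exact: inner_slot_eq0.
have Qle i z : sqn (adj (T i) z) <= sqn z.
  rewrite -[leRHS]mul1r; apply: adj_le => // y; rewrite mul1r.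
  by have [+ _ _ _] := hT i; apply.
have Ftot := fk_total F.
have Qorth i j z z' : i != j -> inner (adj (T i) z) (adj (T j) z') = 0.
  move=> ij; apply: (inner_total0 Ftot Ftot) => _ _ [w hw <-] [w' hw' <-].
  have [->|[p [[sp hp _] [tp _] ->]]] := Tcases i w hw; first by rewrite inner0l.
  have [->|[q [[sq hq _] [tq _] ->]]] := Tcases j w' hw'; first by rewrite inner0r.
  by rewrite inner_LSw // tagged_inner_neq ?mulr0 // tp tq.
exists (OrthFamily Qle Qorth); split=> /= i; rewrite ?adjK; have [_ h1 h2 h3] := hT i.
- by move=> p; exact: h1.
- by move=> p; exact: h2.
- by move=> w; exact: h3.
Qed.

End Families.

(** * The two maps on elementary tensors *)

Definition single_family (R : realType) (H K : hilbert R) (T : bop H K)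
    (hT : forall v, sqn (T v) <= sqn v) : orth_family unit H K.
Proof. by exists (fun=> T) => // -[] []. Defined.

Section Maps.
Variables (R : realType) (I : eqType) (A : I -> nc_space R) (W : free_spaces A).
Local Notation Lp := (fs_pow W).
Local Notation LS := (fs_powS W).
Local Notation F := (fs_F W).
Local Notation fk := (@fk R I A W).
Local Notation fk0 := (@fk0 R I A W).
Local Notation Lw := (@Lw R I A W).
Local Notation LSw := (@LSw R I A W).
Local Notation HL h := (Tagged (fun i => nc_L2 (A i)) h).
Local Notation xi i := (nc_xi (A i)).
Local Notation hats := (@hats R I A).
Local Notation annihilate := (@annihilate R I A W).
Implicit Types (b u v w : seq (hletter A)) (g h : hletter A).
Implicit Types (x y : aletter A) (s a al : seq (aletter A)).

Definition letters : set (hletter A) := projT1 (cid (letter_basis A)).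

Lemma letters_ring h : letters h -> in_Hring h.
Proof. by rewrite /letters; case: cid => E [h1 _ _] /=; exact: h1. Qed.

Lemma letters_orth g h : letters g -> letters h -> tagged_inner g h = (g == h)%:R.
Proof. by rewrite /letters; case: cid => E [_ h2 _] /=; exact: h2. Qed.

Lemma letters_dense h : in_Hring h -> cspan [set k | letters (HL k)] (tagged h).
Proof. by rewrite /letters; case: cid => E [_ _ h3] /=; exact: h3. Qed.

Local Notation bw := (bword letters).

Definition tailQ m : orth_family (seq (hletter A)) (Lp m) F :=
  projT1 (cid (tail_family W letters_orth m)).

Lemma tailQE m b u : bw b -> size u = m -> ringw u -> tailQ m b (Lw m u) = fk0 (u ++ b).
Proof. by rewrite /tailQ; case: cid => Q [h1 _ _] /=; exact: h1. Qed.

Lemma adj_tailQ m b u : bw b -> size u = m -> ringw u -> reduced (u ++ b) ->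
  adj (tailQ m b) (fk (u ++ b)) = Lw m u.
Proof. by rewrite /tailQ; case: cid => Q [_ h2 _] /=; exact: h2. Qed.

Lemma adj_tailQ0 m b w : Hword w -> size w != (m + size b)%N -> adj (tailQ m b) (fk w) = 0.
Proof. by rewrite /tailQ; case: cid => Q [_ _ h3] /=; exact: h3. Qed.

Definition slotTailQ m : orth_family (seq (hletter A)) (LS m) F :=
  projT1 (cid (slot_tail_family W letters_orth m)).

Lemma slotTailQE m b v h : bw b -> size v = m -> ringw v -> in_Hring h ->
  slotTailQ m b (LSw m v h) = fk0 (v ++ h :: b).
Proof. by rewrite /slotTailQ; case: cid => Q [h1 _ _ _] /=; exact: h1. Qed.

Lemma slotTailQ_vacuum m b v h : bw b -> size v = m -> ringw v -> vacuum_letter h ->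
  slotTailQ m b (LSw m v h) = 0.
Proof. by rewrite /slotTailQ; case: cid => Q [_ h1 _ _] /=; exact: h1. Qed.

Lemma adj_slotTailQ m b v h : bw b -> size v = m -> ringw v -> in_Hring h ->
  reduced (v ++ h :: b) -> adj (slotTailQ m b) (fk (v ++ h :: b)) = LSw m v h.
Proof. by rewrite /slotTailQ; case: cid => Q [_ _ h1 _] /=; exact: h1. Qed.

Lemma adj_slotTailQ0 m b w : Hword w -> size w != (m + size b).+1 ->
  adj (slotTailQ m b) (fk w) = 0.
Proof. by rewrite /slotTailQ; case: cid => Q [_ _ _ h1] /=; exact: h1. Qed.

Definition slotQ m : orth_family I F (LS m) := projT1 (cid (slot_family W m)).

Lemma adj_slotQ m i p : slot m p -> slot_ok i p ->
  adj (slotQ m i) (LSw m p.1 p.2) = fk (slot_word p).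
Proof. by rewrite /slotQ; case: cid => Q [h1 _ _] /= hp op; case: (h1 i p hp op). Qed.

Lemma slotQE m i p : slot m p -> slot_ok i p -> slotQ m i (fk (slot_word p)) = LSw m p.1 p.2.
Proof. by rewrite /slotQ; case: cid => Q [h1 _ _] /= hp op; case: (h1 i p hp op). Qed.

Lemma adj_slotQ0 m i p : slot m p -> ~ slot_ok i p -> adj (slotQ m i) (LSw m p.1 p.2) = 0.
Proof. by rewrite /slotQ; case: cid => Q [_ h1 _] /=; exact: h1. Qed.

Lemma slotQ0 m i w : Hword w -> (forall p, slot m p -> slot_ok i p ->
   inner (fk (slot_word p)) (fk w) = 0) -> slotQ m i (fk w) = 0.
Proof. by rewrite /slotQ; case: cid => Q [_ _ h1] /=; exact: h1. Qed.

Lemma bword_nil : bw [::].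
Proof. by split=> //; exact: Hword_nil. Qed.

Lemma tail0_le m (v : F) : sqn (adj (tailQ m [::]) v) <= sqn v.
Proof.
rewrite -[leRHS]mul1r; apply: adj_le => // y; rewrite mul1r; exact: ofam_le.
Qed.

(** Projection onto the words of length m: the adjoint of [tailQ] for the empty tail. *)
Definition lengthQ m : orth_family unit F (Lp m) := single_family (@tail0_le m).

Lemma adj_lengthQ m i u : size u = m -> ringw u -> adj (lengthQ m i) (Lw m u) = fk0 u.
Proof. by move=> su hu; rewrite /= adjK tailQE ?cats0 //; exact: bword_nil. Qed.

Lemma lengthQE m i w : Hword w -> lengthQ m i (fk w) = if size w == m then Lw m w else 0.
Proof.
move=> hw /=; case: eqP => [sw|/eqP sw]; last by rewrite adj_tailQ0 ?addn0.
by rewrite -{1}[w]cats0 (adj_tailQ bword_nil sw) ?cats0 //; case: hw.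
Qed.

Lemma pairings_cons x s h u : pairings (x :: s) (h :: u) = pairing x h * pairings s u.
Proof. by rewrite /pairings big_cons. Qed.

Lemma pairings_nil : pairings [::] ([::] : seq (hletter A)) = 1.
Proof. by rewrite /pairings big_nil. Qed.

Lemma pairings_tags s u : size s = size u -> pairings s u != 0 -> map tag s = map tag u.
Proof.
elim: s u => [|x s IH] [|h u] //= [ss]; rewrite pairings_cons mulf_eq0 negb_or => /andP[xh su].
congr (_ :: _); last exact: IH.
by apply/eqP; apply: contraNT xh => xh; rewrite /pairing (eq_sym (tag h)) (negbTE xh).
Qed.

Lemma hats_rev_Hword al : reduced al -> ringa al -> Hword (hats (rev al)).
Proof.
by move=> ra ha; split; [rewrite hats_reduced rev_reduced | apply: hats_ring; exact: ringa_rev].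
Qed.

Lemma size_hats s : size (hats s) = size s. Proof. exact: size_map. Qed.

Lemma Hword_create al x u : reduced (x :: al) -> ringa (x :: al) -> Hword u ->
  startok (tag x) u -> Hword (hats (rev (x :: al)) ++ u).
Proof.
move=> ra ha [ru hu] xu; split; first exact: reduced_revcat.
by apply/ringw_cat; split=> //; apply: hats_ring; exact: ringa_rev.
Qed.

Lemma Hword_diag al x h w : reduced (x :: al) -> ringa (x :: al) -> Hword (h :: w) ->
  tag h = tag x -> Hword (hats (rev al) ++ diag_letter x h :: w).
Proof.
move=> ra ha hu e; have [hh hs hw] := (Hword_cons _ _).1 hu.
rewrite e in hs; have [r hr] := Hword_create ra ha hw hs.
split; first by move: r; rewrite rev_cons /hats map_rcons cat_rcons !reducedE !map_cat.
move/ringw_cat: hr => [_ hw']; apply/ringw_cat; split.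
  by apply: hats_ring; apply: ringa_rev; have [] := (ringa_cons _ _).1 ha.
by apply/ringw_cons; split=> //; exact: diag_ring.
Qed.

(** Length selects one term: only the annihilation of all of u leaves a word of length k, every
    other outcome being longer. *)
Lemma lengthQ_annihilate al u k i : reduced al -> ringa al -> Hword u ->
  size al = (size u + k)%N ->
  lengthQ k i (annihilate al u) =
    pairings (take (size u) al) u *: Lw k (hats (rev (drop (size u) al))).
Proof.
elim: u al => [|h u IH] [|x al] //.
- move=> _ _ _; rewrite add0n => <-; rewrite pairings_nil scale1r lengthQE //; exact: Hword_nil.
- move=> ra ha hu; rewrite add0n => sa.
  rewrite take0 drop0 pairings_nil scale1r [annihilate _ _]/= cats0 lengthQE.
    by rewrite size_hats size_rev sa eqxx.
  exact: hats_rev_Hword.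
move=> ra ha hu [sa]; have ra' := reduced_behead ra; have [hx ha'] := (ringa_cons _ _).1 ha.
have [hh hs hw] := (Hword_cons _ _).1 hu.
rewrite [annihilate _ _]/= [take _ _]/= [drop _ _]/= pairings_cons.
have [e|ne] := eqVneq (tag h) (tag x).
  rewrite bopDr bopZr (IH al) // lengthQE; last exact: Hword_diag.
  rewrite size_cat size_hats size_rev /= sa ifF ?add0r ?scalerA //.
  by apply/eqP; lia.
rewrite lengthQE; last exact: Hword_create.
rewrite size_cat size_hats size_rev /= sa ifF; last by apply/eqP; lia.
by rewrite /pairing (negbTE ne) mul0r scale0r.
Qed.

Lemma slotQ_size k i w : Hword w -> (k.+1 < size w)%N -> slotQ k i (fk w) = 0.
Proof.
move=> hw sw; apply: slotQ0 => // p hp [_ rp]; apply: inner_fk_size => //.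
  exact: Hword_slot hp rp.
by case: (size_slot_word hp) => -[_ ->]; apply/eqP; lia.
Qed.

Lemma LSw_split m v i (h : nc_L2 (A i)) :
  LSw m v (HL h) = LSw m v (HL (centered h)) + inner (xi i) h *: LSw m v (HL (xi i)).
Proof.
have [T hT] := LS_insertr (Lw m v); have [P hP] := S_insert W i.
rewrite /LSw -!hT -!hP -bopZr -bopDr -bopZr -bopDr.
by rewrite /centered subrK.
Qed.

(** Once v is annihilated, the diagonal part of x on h gives a word of length k + 1 and the scalar
    part one of length k. In the slot these are the centered part and the xi-component of x h, which
    add up to x h; all other words are too long. *)
Lemma slotQ_annihilate_ring al1 x al2 v h k :
  reduced (al1 ++ x :: al2) -> ringa (al1 ++ x :: al2) -> Hword (rcons v h) ->
  size al1 = size v -> size al2 = k ->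
  slotQ k (tag h) (annihilate (al1 ++ x :: al2) (rcons v h)) =
    pairings al1 v *: (if tag h == tag x then LSw k (hats (rev al2)) (HL (act x h)) else 0).
Proof.
elim: al1 v => [|y al1 IH] [|g v] //.
  move=> ra ha hu _ sk; rewrite pairings_nil scale1r /=.
  have [hx ha2] := (ringa_cons _ _).1 ha; have ra2 := reduced_behead ra.
  have [hh _ _] := (Hword_cons _ _).1 hu.
  have [e|ne] := eqVneq (tag h) (tag x); last first.
    apply: slotQ_size; first exact: Hword_create.
    by rewrite size_cat size_hats size_rev /= sk; lia.
  have hc := hats_rev_Hword ra2 ha2.
  have sc : size (hats (rev al2)) = k by rewrite size_hats size_rev.
  have hd := Hword_diag ra ha hu e.
  have rx : reduced (rcons (hats (rev al2)) (HL (xi (tag x)))).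
    by move: hd => [+ _]; rewrite -cats1 !reducedE !map_cat.
  have [s1 s2 s3] := vacuum_slot sc hc rx.
  have -> : annihilate al2 [::] = fk (hats (rev al2)) by case: (al2) => [|z r] /=; rewrite ?cats0.
  rewrite cats1 in hd *.
  have [s4 s5 s6] := last_letter_slot sc (erefl : tag (diag_letter x h) = tag x) hd.
  rewrite bopDr bopZr e -{1}s6 -{2}s3 !slotQE // LSw_split; congr (_ + _ *: _).
  by rewrite /pairing e eqxx.
move=> ra ha hu [s1] sk; have ra' := reduced_behead ra.
have [hy ha'] := (ringa_cons _ _).1 ha; have [hg hs hw] := (Hword_cons _ _).1 hu.
rewrite [annihilate _ _]/= pairings_cons.
have [e|ne] := eqVneq (tag g) (tag y).
  rewrite bopDr bopZr IH // slotQ_size; first by rewrite add0r scalerA.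
    exact: Hword_diag.
  by rewrite size_cat size_hats size_rev size_cat /= size_rcons; lia.
rewrite /pairing (negbTE ne) mul0r scale0r; apply: slotQ_size; first exact: Hword_create.
by rewrite size_cat size_hats size_rev /= size_cat /= size_rcons; lia.
Qed.

(** Here v stands for v (x) xi_i. After v is gone, x creates [hat x], that is x xi; if i is not the
    index of x, the resulting word of length k + 1 fits no slot of index i. *)
Lemma slotQ_annihilate_vacuum al1 x al2 v i k :
  reduced (al1 ++ x :: al2) -> ringa (al1 ++ x :: al2) -> Hword v ->
  size al1 = size v -> size al2 = k ->
  slotQ k i (annihilate (al1 ++ x :: al2) v) =
    pairings al1 v *: (if i == tag x then LSw k (hats (rev al2)) (hat x) else 0).
Proof.
elim: al1 v => [|y al1 IH] [|g v] //.
  move=> ra ha hu _ sk; rewrite pairings_nil scale1r /= cats0.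
  have hw := hats_rev_Hword ra ha.
  have sc : size (hats (rev al2)) = k by rewrite size_hats size_rev.
  have e : hats (rev (x :: al2)) = rcons (hats (rev al2)) (hat x).
    by rewrite rev_cons /hats map_rcons.
  rewrite e in hw *; have [ix|ne] := eqVneq i (tag x).
    have [s4 s5 s6] := last_letter_slot sc (esym ix : tag (hat x) = i) hw.
    by rewrite -s6 slotQE.
  apply: slotQ0 => //; apply: inner_slot_eq0 => //.
    by move=> [v [h [sv th /rcons_inj[_ eh]]]]; move: ne; rewrite -th -eh /= eqxx.
  by case; rewrite size_rcons sc => /eqP + _; rewrite eqn_leq ltnn.
move=> ra ha hu [s1] sk; have ra' := reduced_behead ra.
have [hy ha'] := (ringa_cons _ _).1 ha; have [hg hs hw] := (Hword_cons _ _).1 hu.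
rewrite [annihilate _ _]/= pairings_cons.
have [e|ne] := eqVneq (tag g) (tag y).
  rewrite bopDr bopZr IH // slotQ_size; first by rewrite add0r scalerA.
    exact: Hword_diag.
  by rewrite size_cat size_hats size_rev size_cat /=; lia.
rewrite /pairing (negbTE ne) mul0r scale0r; apply: slotQ_size; first exact: Hword_create.
by rewrite size_cat size_hats size_rev /= size_cat /=; lia.
Qed.

End Maps.

(** * The two maps agree with [iota] and [kappa] on words *)

Section Identities.
Variables (R : realType) (I : eqType) (A : I -> nc_space R) (W : free_spaces A).
Local Notation S := (fs_S W).
Local Notation LS := (fs_powS W).
Local Notation F := (fs_F W).
Local Notation fk := (@fk R I A W).
Local Notation fk0 := (@fk0 R I A W).
Local Notation Lw := (@Lw R I A W).
Local Notation LSw := (@LSw R I A W).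
Local Notation HL h := (Tagged (fun i => nc_L2 (A i)) h).
Local Notation hats := (@hats R I A).
Local Notation annihilate := (@annihilate R I A W).
Local Notation bw := (bword (@letters R I A)).
Local Notation tailQ := (@tailQ R I A W).
Local Notation slotTailQ := (@slotTailQ R I A W).
Local Notation slotQ := (@slotQ R I A W).
Local Notation lengthQ := (@lengthQ R I A W).
Implicit Types (b u v w : seq (hletter A)) (g h : hletter A).
Implicit Types (x y : aletter A) (s a al c : seq (aletter A)).

Lemma ringa_cat s c : ringa (s ++ c) <-> ringa s /\ ringa c.
Proof.
split=> [h|[hs hc] y]; last by rewrite mem_cat => /orP[/hs|/hc].
by split=> y yw; apply: h; rewrite mem_cat yw ?orbT.
Qed.

Lemma fk0E w : reduced w -> fk0 w = fk w. Proof. by rewrite /fk0 => ->. Qed.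

Lemma pairings_nreduced s u : size s = size u -> reduced s -> ~~ reduced u -> pairings s u = 0.
Proof.
move=> e rs; apply: contraNeq => /(pairings_tags e) t.
by move: rs; rewrite !reduced_tags t.
Qed.

Lemma theta_length m k s c : size s = m -> size c = k ->
  reduced (c ++ rev s) -> ringa (c ++ rev s) ->
  theta (lengthQ m) (lengthQ k) (kappa_word W (c ++ rev s)) = contract_op W m k s c.
Proof.
move=> sm ck rcs hcs; have [hc hs'] := (ringa_cat _ _).1 hcs.
have hs : ringa s by move=> y ys; apply: hs'; rewrite mem_rev.
have rs : reduced s by rewrite -rev_reduced; exact: (cat_sorted2 rcs).2.
have [t [hT ht]] := contract_opE W k sm hs hc.
apply: (total_eq (Lw_total W m)) => _ [u [su hu] <-].
rewrite hT ht // (theta_single _ _ (b := tt)); last by case.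
rewrite adj_lengthQ // /fk0; case: ifPn => ru; last first.
  by rewrite !bop0r pairings_nreduced ?scale0r // sm.
have -> : c ++ rev s = rev (s ++ rev c) by rewrite rev_cat revK.
rewrite kappa_annihilate //; first last.
- by rewrite -[s ++ _]revK rev_cat revK; exact: ringa_rev.
- by rewrite -rev_reduced rev_cat revK.
rewrite lengthQ_annihilate //.
- by rewrite su -sm take_size_cat // drop_size_cat // revK.
- by rewrite -rev_reduced rev_cat revK.
- by rewrite -[s ++ _]revK rev_cat revK; exact: ringa_rev.
- by rewrite size_cat size_rev sm su ck.
Qed.

Lemma theta_slot m k s x c : size s = m -> size c = k ->
  reduced (c ++ x :: rev s) -> ringa (c ++ x :: rev s) ->
  theta (slotQ m) (slotQ k) (kappa_word W (c ++ x :: rev s)) =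
    op_tensor (contract_op W m k s c) (coordinate W x).
Proof.
move=> sm ck rcs hcs; have [hc /ringa_cons[hx hs']] := (ringa_cat _ _).1 hcs.
have hs : ringa s by move=> y ys; apply: hs'; rewrite mem_rev.
have ae : c ++ x :: rev s = rev (s ++ x :: rev c).
  by rewrite rev_cat rev_cons revK cat_rcons.
have ra : reduced (s ++ x :: rev c) by rewrite -rev_reduced -ae.
have ha : ringa (s ++ x :: rev c) by rewrite -[s ++ _]revK -ae; exact: ringa_rev.
have [t [hT ht]] := contract_opE W k sm hs hc.
apply: (total_eq (LSw_total W m)) => _ [[v h] [/= sv hv hh] <-] /=.
rewrite [RHS](op_tensorE _ hT) hT ht // coordinateE.
have rhsE : ht_tens (LS k) (pairings s v *: Lw k (hats c))
    (if tag h == tag x then hs_in S (HL (act x h)) else 0) =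
    pairings s v *: (if tag h == tag x then LSw k (hats c) (HL (act x h)) else 0).
  have [T1 hT1] := LS_insertl k (if tag h == tag x then hs_in S (HL (act x h)) else 0).
  rewrite -hT1 bopZr hT1; case: ifP => // _; congr (_ *: _).
  by have [T2 hT2] := LS_insertr (Lw k (hats c)); rewrite -hT2 bop0r.
rewrite {}rhsE.
have hsl : slot m (v, h) by [].
rewrite (theta_single _ _ (b := tag h)) => [|i ih]; last first.
  by apply: (adj_slotQ0 W hsl) => -[/= e _]; rewrite e eqxx in ih.
(* If v h is not reduced, the left side is 0. So is the right: a nonzero contraction gives v the
   indices of s, and then h of the index of x would make v h reduced like s x. *)
have [rv|nrv] := boolP (reduced (rcons v h)); last first.
  rewrite (adj_slotQ0 W hsl); last by case=> _ /= rv; rewrite rv in nrv.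
  rewrite !bop0r; case: eqVneq => [e|_]; last by rewrite scaler0.
  have [->|nz] := eqVneq (pairings s v) 0; first by rewrite scale0r.
  have tt := pairings_tags (etrans sm (esym sv)) nz.
  case/negP: nrv; have : reduced (rcons s x).
    by move: ra; rewrite -cat_rcons => /cat_sorted2[].
  by rewrite !reduced_tags !map_rcons tt e.
have hok : slot_ok (tag h) (v, h) by [].
rewrite (adj_slotQ W hsl hok).
have hwp := Hword_slot hsl rv.
rewrite ae kappa_annihilate //.
case: hh => hh.
  rewrite slot_wordE // in hwp *; rewrite slotQ_annihilate_ring ?size_rev ?revK ?sm //.
rewrite slot_word_vacuum // in hwp *; rewrite slotQ_annihilate_vacuum ?size_rev ?revK ?sm //.
congr (_ *: _); case: eqVneq => // e; congr (LSw k _ _).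
case: h e hh {hv hsl rv hok hwp} => j h /= e; subst j; rewrite /vacuum_letter actE /= => ->.
by [].
Qed.

Lemma bw_drop w n : bw w -> bw (drop n w).
Proof.
move=> [[rw hw] Ew]; split; last by move=> h hn; apply: Ew; exact: mem_drop hn.
split; last by move=> h hn; apply: hw; exact: mem_drop hn.
by move: rw; rewrite -{1}(cat_take_drop n w); exact: reduced_catr.
Qed.

Lemma ringw_take w n : ringw w -> ringw (take n w).
Proof. by move=> hw h hn; apply: hw; exact: mem_take hn. Qed.

(** A basis word w reaches the family only through its own tail [drop m w], so the sum has one
    term. *)
Lemma theta_tail m k s c w : size s = m -> size c = k -> ringa s -> ringa c -> bw w ->
  theta (tailQ m) (tailQ k) (contract_op W m k s c) (fk w) =
    if (m <= size w)%N then pairings s (take m w) *: fk0 (hats c ++ drop m w) else 0.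
Proof.
move=> sm ck hs hc hw; have [hww _] := hw; have [rw rgw] := hww.
have [t [hT ht]] := contract_opE W k sm hs hc.
case: leqP => [mw|wm]; last first.
  apply: theta_zero => b; apply: adj_tailQ0 => //; rewrite neq_ltn.
  by rewrite (leq_trans wm) ?leq_addr.
have hb := bw_drop m hw; have su : size (take m w) = m by rewrite size_take_min (minn_idPl mw).
have hu := ringw_take (n := m) rgw.
have e : adj (tailQ m (drop m w)) (fk w) = Lw m (take m w).
  by rewrite -{2}(cat_take_drop m w) adj_tailQ // cat_take_drop.
have e2 : fk w = tailQ m (drop m w) (Lw m (take m w)).
  by rewrite tailQE // cat_take_drop fk0E.
rewrite (theta_single _ _ (b := drop m w)) => [|b bn]; last first.
  by rewrite e2; exact: adj_ofam_orth.
rewrite e hT ht // bopZr tailQE ?size_hats //; exact: hats_ring.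
Qed.

Lemma theta_slot_tail m k s x c w : size s = m -> size c = k -> ringa s -> ringa c -> bw w ->
  theta (slotTailQ m) (slotTailQ k) (op_tensor (contract_op W m k s c) (coordinate W x)) (fk w) =
    if drop m w is h :: w' then
      if tag h == tag x then pairings s (take m w) *: fk0 (hats c ++ diag_letter x h :: w') else 0
    else 0.
Proof.
move=> sm ck hs hc hw; have [hww _] := hw; have [rw rgw] := hww.
have [t [hT ht]] := contract_opE W k sm hs hc.
case E : (drop m w) => [|h w'].
  apply: theta_zero => b; apply: adj_slotTailQ0 => //; rewrite neq_ltn ltnS.
  move/eqP: E; rewrite -size_eq0 size_drop subn_eq0 => wm.
  by rewrite (leq_trans wm) ?leq_addr.
have mw : (m < size w)%N by rewrite -subn_gt0 -size_drop E.
have hb : bw w'.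
  have : drop m.+1 w = w' by rewrite -addn1 addnC -drop_drop E /= drop0.
  by move <-; exact: bw_drop.
have we : w = take m w ++ h :: w' by rewrite -E cat_take_drop.
have su : size (take m w) = m by rewrite size_take_min (minn_idPl (ltnW mw)).
have hu := ringw_take (n := m) rgw.
have hh : in_Hring h by apply: rgw; rewrite we mem_cat inE eqxx orbT.
have rww : reduced (take m w ++ h :: w') by rewrite -we.
have e : adj (slotTailQ m w') (fk w) = LSw m (take m w) h.
  by rewrite {1}we adj_slotTailQ.
have e2 : fk w = slotTailQ m w' (LSw m (take m w) h).
  by rewrite slotTailQE // fk0E // -we.
rewrite (theta_single _ _ (b := w')) => [|b bn]; last first.
  by rewrite e2; exact: adj_ofam_orth.
rewrite e [op_tensor _ _ _](op_tensorE _ hT) hT ht // coordinateE.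
have [T1 hT1] := LS_insertl k (if tag h == tag x then hs_in S (HL (act x h)) else 0).
rewrite -hT1 !bopZr hT1; case: eqVneq => [th|_]; last first.
  by have [T2 hT2] := LS_insertr (Lw k (hats c)); rewrite -hT2 !bop0r scaler0.
(* The xi-component of x h is dropped by [slotTailQ]; it is the annihilation part of x, which
   belongs to the components of the first kind. *)
congr (_ *: _); rewrite -[ht_tens _ _ _]/(LSw k (hats c) (HL (act x h))) LSw_split.
rewrite bopDr bopZr slotTailQE ?size_hats //; try exact: hats_ring.
- rewrite slotTailQ_vacuum ?scaler0 ?addr0 ?size_hats //; exact: hats_ring.
- exact: diag_ring.
Qed.

(** Here m counts the annihilating letters, while the components of [iota] are numbered by the k
    creating ones. *)
Definition tail_summand al w m : F :=
  if (m <= size w)%N then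
    pairings (take m al) (take m w) *: fk0 (hats (rev (drop m al)) ++ drop m w)
  else 0.

Definition slot_summand al w m : F :=
  if drop m al is x :: al' then
    if drop m w is h :: w' then
      if tag h == tag x then
        pairings (take m al) (take m w) *: fk0 (hats (rev al') ++ diag_letter x h :: w')
      else 0
    else 0
  else 0.

(** Induction on both words: the terms with m > 0 are the pairing of the two first letters times the
    terms of the shorter words, so only m = 0 needs attention. If the first indices agree, the term
    m = 0 of the first kind vanishes and that of the second kind is the diagonal part; if they
    differ, only the pure creation term survives. *)
Lemma annihilate_sum al w : reduced al -> ringa al -> Hword w ->
  annihilate al w = \sum_(m < (size al).+1) tail_summand al w m
    + \sum_(m < size al) slot_summand al w m.
Proof.
elim: al w => [|x al IH] w.
  move=> _ _ [rw _]; rewrite big_ord1 big_ord0 addr0 /tail_summand /= take0 drop0.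
  by rewrite pairings_nil scale1r fk0E //; case: (w).
move=> ra ha hw; have ra' := reduced_behead ra; have [hx ha'] := (ringa_cons _ _).1 ha.
case: w hw => [|h w] hw.
  rewrite [\sum_(m < size _) _]big1 ?addr0; last first.
    by move=> m _; rewrite /slot_summand /=; case: drop.
  rewrite big_ord_recl big1 ?addr0; last by move=> m _.
  rewrite /tail_summand /= pairings_nil scale1r fk0E //.
  by have := hats_rev_Hword ra ha; rewrite cats0 => -[].
have [hh hs hww] := (Hword_cons _ _).1 hw.
rewrite -[size (x :: al)]/((size al).+1).
rewrite [\sum_(m < (size _).+2) _]big_ord_recl.
rewrite [\sum_(m < (size _).+1) slot_summand _ _ _]big_ord_recl.
have ts (m : nat) : tail_summand (x :: al) (h :: w) m.+1 = pairing x h *: tail_summand al w m.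
  rewrite /tail_summand /= ltnS pairings_cons; case: leqP => _; last by rewrite scaler0.
  by rewrite scalerA.
have ss (m : nat) : slot_summand (x :: al) (h :: w) m.+1 = pairing x h *: slot_summand al w m.
  rewrite /slot_summand /= pairings_cons; case: (drop m al) => [|y al']; first by rewrite scaler0.
  case: (drop m w) => [|g w']; first by rewrite scaler0.
  by case: ifP => _; rewrite ?scaler0 // scalerA.
rewrite (eq_bigr (fun m : 'I_(size al).+1 => pairing x h *: tail_summand al w m) (fun m _ => ts m)).
rewrite (eq_bigr (fun m : 'I_(size al) => pairing x h *: slot_summand al w m) (fun m _ => ss m)).
rewrite -!scaler_sumr [tail_summand _ _ ord0]/tail_summand.
rewrite [slot_summand _ _ ord0]/slot_summand /= pairings_nil !scale1r.
have [e|ne] := eqVneq (tag h) (tag x).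
  rewrite IH // scalerDr.
  (* Creating x directly before h of the same index is not reduced: this is where the compression
     cuts the ampliated operator down to the true one. *)
  have -> : fk0 (hats (rev (x :: al)) ++ h :: w) = 0.
    rewrite /fk0 ifF //; apply/negP; rewrite rev_cons /hats map_rcons cat_rcons => r.
    have : reduced (hat x :: h :: w) by exact: reduced_catr r.
    by rewrite reduced_cons /= e eqxx.
  rewrite fk0E; last by have [] := Hword_diag ra ha hw e.
  by rewrite add0r addrCA addrA.
rewrite /pairing (negbTE ne) !scale0r !addr0 fk0E //.
by have [] := Hword_create ra ha hw ne.
Qed.

Section Degree.
Variable d : nat.

Definition J_map (T : Bspace F F) : Xambient W d := fun j =>
  match j return Xcomp W j with
  | inl k => theta (lengthQ (d - k)) (lengthQ k) T
  | inr k => theta (slotQ (d - k - 1)) (slotQ k) T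
  end.

Definition J_inv (y : Xambient W d) : Bspace F F :=
  \sum_(k < d.+1) theta (tailQ (d - k)) (tailQ k) (y (inl k)) +
  \sum_(k < d) theta (slotTailQ (d - k - 1)) (slotTailQ k) (y (inr k)).

Lemma J_map_word a : size a = d -> reduced a -> ringa a ->
  J_map (kappa_word W a) = iota_word W a.
Proof.
move=> sa ra ha; apply: functional_extensionality_dep => -[k|k] /=.
  have kd : (k <= d)%N by rewrite -ltnS.
  rewrite -[in LHS](cat_take_drop k a) -[drop k a in LHS]revK theta_length //.
  - by rewrite size_rev size_drop sa.
  - by rewrite size_take_min sa (minn_idPl kd).
  - by rewrite revK cat_take_drop.
  - by rewrite revK cat_take_drop.
have kd : (k < d)%N := ltn_ord k.
case E : (drop k a) => [|x v].
  by move: (congr1 size E); rewrite size_drop sa /=; lia.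
have ae : a = take k a ++ x :: rev (rev v) by rewrite revK -E cat_take_drop.
rewrite {1}ae theta_slot //; rewrite -?ae //.
- by rewrite size_rev; move: (congr1 size E); rewrite size_drop sa /=; lia.
- by rewrite size_take_min sa (minn_idPl (ltnW kd)).
Qed.

Lemma J_inv_word a : size a = d -> reduced a -> ringa a ->
  J_inv (iota_word W a) = kappa_word W a.
Proof.
move=> sa ra ha.
apply: (total_eq (fk_total_in W (@letters_ring R I A) (@letters_dense R I A))) => _ [w hw <-].
have hww : bw w by [].
have [hw1 _] := hw.
rewrite -[in RHS](revK a) kappa_annihilate ?rev_reduced //; last exact: ringa_rev.
rewrite annihilate_sum ?rev_reduced //; last exact: ringa_rev.
rewrite size_rev sa /J_inv bopDE !bop_sumE; congr (_ + _).
  (* With k letters creating, m = d - k annihilate, so the order of summation is reversed. *)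
  rewrite [RHS](reindex_inj rev_ord_inj) /=; apply: eq_bigr => k _; rewrite subSS.
  have kd : (k <= d)%N by rewrite -ltnS.
  have [s1 s2] : size (drop k a) = (d - k)%N /\ size (take k a) = k.
    by rewrite size_drop size_take_min sa (minn_idPl kd).
  have tr : take (d - k) (rev a) = rev (drop k a).
    by rewrite take_rev sa subKn.
  have dr : drop (d - k) (rev a) = rev (take k a).
    by rewrite drop_rev sa subKn.
  have [hc hd] : ringa (take k a) /\ ringa (drop k a).
    by apply/ringa_cat; rewrite cat_take_drop.
  rewrite theta_tail ?size_rev //; last exact: ringa_rev.
  by rewrite /tail_summand tr dr revK.
(* One letter acts diagonally, so now m = d - k - 1. *)
rewrite [RHS](reindex_inj rev_ord_inj) /=; apply: eq_bigr => k _.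
have kd : (k < d)%N := ltn_ord k.
have -> : (d - k.+1 = d - k - 1)%N by rewrite -subnDA addn1.
have sc : size (take k a) = k by rewrite size_take_min sa (minn_idPl (ltnW kd)).
case E : (drop k a) => [|x v].
  by move: (congr1 size E); rewrite size_drop sa /=; lia.
have ae : a = take k a ++ x :: v by rewrite -E cat_take_drop.
have sv : size v = (d - k - 1)%N.
  by move: (congr1 size E); rewrite size_drop sa /=; lia.
have [hc /ringa_cons[hx hv]] : ringa (take k a) /\ ringa (x :: v).
  by apply/ringa_cat; rewrite -ae.
rewrite theta_slot_tail ?size_rev //; last exact: ringa_rev.
have tr : take (d - k - 1) (rev a) = rev v.
  by rewrite ae rev_cat rev_cons cat_rcons -sv -(size_rev v) take_size_cat.
have dr : drop (d - k - 1) (rev a) = x :: rev (take k a).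
  by rewrite {1}ae rev_cat rev_cons cat_rcons -sv -(size_rev v) drop_size_cat.
by rewrite /slot_summand tr dr revK.
Qed.

End Degree.

End Identities.

(** * The isomorphism *)

Section Isomorphism.
Variables (R : realType) (I : eqType) (A : I -> nc_space R) (W : free_spaces A).
Local Notation LS := (fs_powS W).
Local Notation F := (fs_F W).
Variable d : nat.
Local Notation X := (Xambient W d).
Local Notation BF := (Bspace F F).
Local Notation J := (@J_map R I A W d).
Local Notation Ji := (@J_inv R I A W d).

Definition J_inv_comp (j : Xindex d) : Xcomp W j -> BF :=
  match j return Xcomp W j -> BF with
  | inl k => fun T => theta (tailQ W (d - k)) (tailQ W k) T
  | inr k => fun T => theta (slotTailQ W (d - k - 1)) (slotTailQ W k) T
  end.

Lemma J_invE (y : X) : Ji y = \sum_(j : Xindex d) J_inv_comp (y j).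
Proof. by rewrite big_sumType. Qed.

Lemma J_map_lin a x y : J (a *: x + y) = a *: J x + J y.
Proof. by apply: functional_extensionality_dep => -[k|k]; exact: theta_lin. Qed.

Lemma J_inv_comp_lin j a (x y : Xcomp W j) :
  J_inv_comp (a *: x + y) = a *: J_inv_comp x + J_inv_comp y.
Proof. by case: j x y => k x y; exact: theta_lin. Qed.

Lemma J_inv_lin a x y : Ji (a *: x + y) = a *: Ji x + Ji y.
Proof.
rewrite !J_invE scaler_sumr -big_split; apply: eq_bigr => j _.
exact: J_inv_comp_lin.
Qed.

Lemma linear_comb (U V : lmodType R[i]) (f : U -> V) (T : Type) (r : seq T) (c : T -> R[i])
    (x : T -> U) : (forall a u v, f (a *: u + v) = a *: f u + f v) ->
  f (\sum_(p <- r) c p *: x p) = \sum_(p <- r) c p *: f (x p).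
Proof.
move=> lf; have f0 : f 0 = 0.
  by have := lf (-1) 0 0; rewrite scaler0 addr0 scaleN1r addNr.
elim: r => [|p r IH]; first by rewrite !big_nil.
by rewrite !big_cons lf IH.
Qed.

Lemma J_kappa f : Sigma A d f -> J (kappa W f) = iota_map W d f.
Proof.
move=> hf; rewrite /kappa (linear_comb _ _ _ J_map_lin) /iota_map.
rewrite big_seq [RHS]big_seq; apply: eq_bigr => p pf; congr (_ *: _).
by have [h1 h2 h3] := hf p pf; exact: J_map_word.
Qed.

Lemma J_inv_iota f : Sigma A d f -> Ji (iota_map W d f) = kappa W f.
Proof.
move=> hf; rewrite /iota_map (linear_comb _ _ _ J_inv_lin) /kappa.
rewrite big_seq [RHS]big_seq; apply: eq_bigr => p pf; congr (_ *: _).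
by have [h1 h2 h3] := hf p pf; exact: J_inv_word.
Qed.

Lemma theta_weakstar_continuous (B : eqType) (H K H' K' : hilbert R)
    (Q : orth_family B H H') (Q' : orth_family B K K') :
  continuous (theta Q Q' : weakstar (Bspace H K) -> weakstar (Bspace H' K')).
Proof.
apply: weakstar_continuous => w hw; apply: (weakstar_functional (E := Bspace H K)).
exact: theta_normal.
Qed.

Lemma continuous_csum (T : topologicalType) (Jt : Type) (r : seq Jt) (f : Jt -> T -> R[i]^o) :
  (forall j, continuous (f j)) -> continuous (fun t => \sum_(j <- r) f j t : R[i]^o).
Proof.
move=> cf; elim: r => [|j r IH].
  rewrite (_ : (fun t => _) = fun=> 0 : R[i]^o); first exact: cst_continuous.
  by apply: funext => t; rewrite big_nil.
rewrite (_ : (fun t => _) = fun t => f j t + \sum_(i <- r) f i t : R[i]^o).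
  by move=> t; apply: cvgD; [exact: cf | exact: IH].
by apply: funext => t; rewrite big_cons.
Qed.

Lemma J_map_continuous : continuous (J : weakstar BF -> weakstar X).
Proof.
apply: weakstar_continuous => _ [v [hv ->]].
apply: continuous_csum => -[k|k]; apply: (weakstar_functional (E := BF)); apply: theta_normal.
  exact: (hv (inl k)).
exact: (hv (inr k)).
Qed.

(** A normal functional is a plain function given by limits; additivity follows from uniqueness of
    these limits. *)
Lemma normal_functional_sum (H K : hilbert R) (w : bop H K -> R[i]) (T : Type) (r : seq T)
    (f : T -> bop H K) : normal_functional w ->
  w (\sum_(t <- r) f t) = \sum_(t <- r) w (f t).
Proof.
case=> x [y [_ _ hw]].
have wD (P Q : bop H K) : w (P + Q) = w P + w Q.
  have h := cvgD (hw P) (hw Q); have h' := hw (P + Q).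
  rewrite (_ : series _ = series (fun n => inner (y n) (P (x n)) : R[i]^o) \+
      series (fun n => inner (y n) (Q (x n)) : R[i]^o)) in h'.
    exact: (@norm_cvg_unique _ R[i]^o _ _ _ _ h' (h _)).
  apply: funext => n; rewrite /series /= -big_split /=.
  by apply: eq_bigr => k _; exact: innerDr.
have w0 : w 0 = 0 by apply: (addrI (w 0)); rewrite -wD !addr0.
by apply: (big_morph w).
Qed.

Lemma J_inv_continuous : continuous (Ji : weakstar X -> weakstar BF).
Proof.
apply: weakstar_continuous => w hw; apply: (weakstar_functional (E := X)).
exists (fun j z => w (J_inv_comp z)); split.
  by case=> k; exact: theta_normal.
by apply: funext => y; rewrite J_invE (normal_functional_sum _ _ hw).
Qed.

Lemma vector_functional (H K : hilbert R) (y : K) (z : H) :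
  normal_functional (fun T : bop H K => inner y (T z)).
Proof.
pose f (V : hilbert R) (u : V) (n : nat) := if n == 0%N then u else 0.
have fs (V : hilbert R) (u : V) : square_summable (f V u).
  apply/square_summableP; exists (sqn u) => -[|n]; first by rewrite big_geq // sqn_ge0.
  rewrite big_nat_recl //= big1 ?addr0 // => k _; exact: sqn0.
exists (f _ z), (f _ y); split=> // T; apply/cvg_normcP => e e0.
exists 1%N => -[|n] // _; rewrite /series /= big_nat_recl //= big1.
  by rewrite addr0 subrr /= expr0n addr0 sqrtr0.
by move=> k _; exact: inner0l.
Qed.

Lemma zero_functional (H K : hilbert R) : normal_functional (fun _ : bop H K => 0).
Proof.
have := vector_functional (0 : K) (0 : H); congr normal_functional.
by apply: funext => T; rewrite inner0l.
Qed.

Lemma predual_comp (j : Xindex d) (w : Xcomp W j -> R[i]) : os_predual (Xcomp W j) w ->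
  os_predual X (fun x => w (x j)).
Proof.
move=> hw; pose v := dfwith (fun i => (fun _ : Xcomp W i => 0 : R[i])) j w.
exists v; split.
  move=> i; have [<-|ji] := eqVneq j i; first by rewrite /v dfwithin.
  rewrite /v dfwithout //; case: (i) => k; exact: zero_functional.
apply: funext => x; rewrite (bigD1 j) //= big1 ?addr0; first by rewrite /v dfwithin.
by move=> i ij; rewrite /v dfwithout // eq_sym.
Qed.

Lemma Mbar_fixed x : Mbar W d x -> Ji (J x) = x.
Proof.
move=> hx; apply: bop_ext => z; apply: inner_inj => y.
have cw := weakstar_functional (E := BF) (vector_functional y z).
apply: (wclosure_eq (f := fun T : weakstar BF => inner y (Ji (J T) z) : R[i]^o)
  (g := fun T : weakstar BF => inner y (T z) : R[i]^o) _ _ _ hx).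
- move=> T; apply: (@continuous_comp _ _ _ (Ji \o J : weakstar BF -> weakstar BF)
    (fun T : weakstar BF => inner y (T z) : R[i]^o)); last exact: cw.
  exact (@continuous_comp (weakstar BF) (weakstar X) (weakstar BF) J Ji T
    (@J_map_continuous T) (@J_inv_continuous (J T))).
- exact: cw.
- by move=> _ [f hf <-]; rewrite J_kappa // J_inv_iota.
Qed.

Lemma iota_fixed x : wclosure (iota_map W d @` Sigma A d) x -> J (Ji x) = x.
Proof.
move=> hx; apply: functional_extensionality_dep => j.
suff h : forall w : Xcomp W j -> R[i], os_predual (Xcomp W j) w -> w (J (Ji x) j) = w (x j).
  by move: h; case: (j) => k h; apply: bop_ext => z; apply: inner_inj => y;
    apply: (h (fun T => inner y (T z))); exact: vector_functional.
move=> w hw; have cw := weakstar_functional (predual_comp hw).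
apply: (wclosure_eq (f := fun T : weakstar X => w (J (Ji T) j) : R[i]^o)
  (g := fun T : weakstar X => w (T j) : R[i]^o) _ _ _ hx).
- move=> T; apply: (@continuous_comp _ _ _ (J \o Ji : weakstar X -> weakstar X)
    (fun T : weakstar X => w (T j) : R[i]^o)); last exact: cw.
  exact (@continuous_comp (weakstar X) (weakstar BF) (weakstar X) Ji J T
    (@J_inv_continuous T) (@J_map_continuous (Ji T))).
- exact: cw.
- by move=> _ [f hf <-]; rewrite J_inv_iota // J_kappa.
Qed.

Lemma linfty_coordinate (x : aletter A) : in_Mring x -> linfty_M (coordinate W x).
Proof.
(* The default of [tagged_as] gives 0 away from the index of x. *)
move=> [Mx _]; pose a i := tagged_as (Tagged (fun i => nc_bop (A i)) (0 : nc_bop (A i))) x.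
have aE i : tag x != i -> a i = 0
  by move=> ne; rewrite /a /tagged_as; case: eqP => // e; case/eqP: ne; exact: esym e.
have aT : a (tag x) = tagged x by rewrite /a; case: (x) => k T /=; rewrite tagged_asE.
exists a; split=> [i|i h].
  have [<-|ne] := eqVneq (tag x) i; first by rewrite aT.
  by rewrite aE //; exact: vn_set0.
rewrite coordinateE /=; have [e|ne] := eqVneq i (tag x).
  by subst i; rewrite actE aT.
rewrite aE ?rep0 1?eq_sym //.
by have [T hT] := S_insert W i; rewrite -hT bop0r.
Qed.

(** Membership in the weak-* closed tensor product holds on words, where the component is an
    elementary tensor, and passes to the closure by continuity of [theta]. *)
Lemma J_map_vn (k : 'I_d) x : Mbar W d x ->
  @vn_tensor _ _ _ W (d - k - 1)%N k (J x (inr k) : bop (LS (d - k - 1)%N) (LS k)).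
Proof.
apply: (wclosure_map (E := BF) (F := Bspace (LS (d - k - 1)%N) (LS k))
  (f := fun T : BF => J T (inr k))); first exact: theta_weakstar_continuous.
move=> _ [f hf <-]; apply: subset_closure; rewrite J_kappa //.
have -> : iota_map W d f (inr k) = \sum_(p <- f) p.1 *: iota_word W p.2 (inr k).
  rewrite /iota_map; elim: (f) => [|p r IH]; first by rewrite !big_nil.
  by rewrite !big_cons -IH.
rewrite big_seq; elim/big_ind: _ => [|u v|p pf]; [exact: lspan0 | exact: lspan_add |].
apply: lspan_scale; apply: lspan_incl; have [h1 h2 h3] := hf p pf.
rewrite /iota_word; case E : (drop k p.2) => [|y v].
  by move: (congr1 size E); rewrite size_drop h1 /=; have := ltn_ord k; lia.
exists (contract_op W (d - k - 1) k (rev v) (take k p.2)), (coordinate W y); split=> //.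
by apply: linfty_coordinate; apply: h3; rewrite -(cat_take_drop k p.2) E mem_cat inE eqxx orbT.
Qed.

Lemma J_map_Ebar x : Mbar W d x -> Ebar W d (J x).
Proof.
move=> hx; split; first by move=> k; exact: J_map_vn.
apply: (wclosure_map J_map_continuous) hx => _ [f hf <-].
by apply: subset_closure; exists f => //; rewrite J_kappa.
Qed.

Lemma J_inv_Mbar y : Ebar W d y -> Mbar W d (Ji y).
Proof.
move=> [_ hy]; apply: (wclosure_map J_inv_continuous) hy => _ [f hf <-].
by apply: subset_closure; exists f => //; rewrite J_inv_iota.
Qed.

Lemma J_map_cb n (x : 'I_n -> 'I_n -> BF) : os_norm x <= 1 ->
  os_norm (fun p q => J (x p q)) <= 1.
Proof.
move=> hx; apply: bigmax_le; first exact: ler01.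
by move=> -[k|k] _; apply: le_trans hx; exact: theta_mxnorm.
Qed.

(** The triangle inequality in squared form: one factor 2d + 1 comes from [sqn_sum_le], the other
    from adding 2d + 1 contractive components (d + 1 of the first kind, d of the second). *)
Lemma J_inv_cb n (x : 'I_n -> 'I_n -> X) : os_norm x <= 1 ->
  os_norm (fun p q => Ji (x p q)) <= (2 * d + 1)%N%:R.
Proof.
move=> hx; have hj j : os_norm (fun p q => x p q j) <= 1.
  by apply: le_trans hx; exact: (le_bigmax _ (fun j => os_norm (fun p q => x p q j)) j).
apply: mxnorm_le => // h; set Sh := \sum_q sqn (h q).
have Sh0 : 0 <= Sh by apply: sumr_ge0 => q _; exact: sqn_ge0.
have hZ j : \sum_p sqn (\sum_q J_inv_comp (x p q j) (h q)) <= Sh.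
  have hjj : bop_mxnorm (fun p q => J_inv_comp (x p q j)) <= 1.
    by apply: le_trans (hj j); case: (j) => k; exact: theta_mxnorm.
  rewrite (le_trans (mxnorm_bound _ h)) // -[leRHS]mul1r ler_wpM2r //.
  by rewrite -[leRHS](expr1n _ 2) ler_sqr ?nnegrE ?mxnorm_ge0.
have sX : size (index_enum (Xindex d)) = (2 * d + 1)%N.
  by rewrite /index_enum -enumT -cardE card_sum !card_ord; lia.
have e p : \sum_q Ji (x p q) (h q) =
    \sum_(j : Xindex d) \sum_q J_inv_comp (x p q j) (h q).
  by rewrite exchange_big; apply: eq_bigr => q _; rewrite J_invE bop_sumE.
under eq_bigr => p _ do rewrite e.
have : \sum_p sqn (\sum_(j : Xindex d) \sum_q J_inv_comp (x p q j) (h q)) <=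
    \sum_p (2 * d + 1)%N%:R * \sum_(j : Xindex d) sqn (\sum_q J_inv_comp (x p q j) (h q)).
  by apply: ler_sum => p _; rewrite (le_trans (sqn_sum_le _ _)) // sX.
move/le_trans; apply; rewrite -mulr_sumr expr2 -mulrA ler_wpM2l // exchange_big /=.
have : \sum_(j : Xindex d) \sum_p sqn (\sum_q J_inv_comp (x p q j) (h q)) <=
    \sum_(j : Xindex d) Sh by apply: ler_sum => j _; exact: hZ.
by move/le_trans; apply; rewrite sumr_const -sX /index_enum -enumT -cardE mulr_natl.
Qed.

End Isomorphism.

Theorem theorem2p11 (R : realType) (I : eqType) (A : I -> nc_space R)
    (W : free_spaces A) (d : nat) (hd : (1 <= d)%N) :
  exists (J : Bspace (fs_F W) (fs_F W) -> Xambient W d)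
         (Jinv : Xambient W d -> Bspace (fs_F W) (fs_F W)),
    [/\ (forall a x y, Mbar W d x -> Mbar W d y ->
           J (a *: x + y) = a *: J x + J y),
        (forall f, Sigma A d f -> J (kappa W f) = iota_map W d f),
        (set_bij (Mbar W d) (Ebar W d) J
         /\ forall x, Mbar W d x -> Jinv (J x) = x),
        wcontinuous_on (Mbar W d) J &
        ((cbnorm (Mbar W d) J <= 1)%E
         /\ (cbnorm (Ebar W d) Jinv <= ((2 * d + 1)%N%:R)%:E)%E)].
Proof.
exists (@J_map R I A W d), (@J_inv R I A W d); split.
- by move=> a x y _ _; exact: J_map_lin.
- exact: J_kappa.
- split; last exact: Mbar_fixed.
  split; first by move=> x; exact: J_map_Ebar.
    move=> x y; rewrite !inE => hx hy e.
    by rewrite -(Mbar_fixed hx) e Mbar_fixed.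
  move=> y hy; exists (J_inv y); first exact: J_inv_Mbar.
  by apply: iota_fixed; case: hy.
- by apply: continuous_subspaceT; exact: J_map_continuous.
- split.
    apply: ge_ereal_sup => _ [n [x [_ hx ->]]]; rewrite lee_fin; exact: J_map_cb.
  apply: ge_ereal_sup => _ [n [x [_ hx ->]]]; rewrite lee_fin; exact: J_inv_cb.
Qed.
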